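(* Let $\Lambda$ be a $d$-dimensional lattice, let $\bm x,\bm y\in\mathbb R^d$, and let $\nu\in\mathbb C$ be such that $\nu\neq d$ if $\bm y\in\Lambda^*$. Then the Epstein zeta function $Z_{\Lambda,\nu}(\bm x,\bm y)$ is well-defined (i.e. the meromorphic continuation in $\nu$ of the defining lattice sum exists and has a finite value at $\nu$), and for any $\lambda>0$ it holds that $$ Z_{\Lambda,\nu}(\bm x,\bm y)=\frac{(\pi/\lambda^2)^{\nu/2}}{\Gamma(\nu/2)}\left[\sum_{\bm z\in\Lambda}G_\nu\Big(\frac{\bm z-\bm x}{\lambda}\Big)e^{-2\pi i\bm y\cdot\bm z}+\frac{\lambda^d}{V_\Lambda}\sum_{\bm k\in\Lambda^*}G_{d-\nu}\big(\lambda(\bm k+\bm y)\big)e^{-2\pi i\bm x\cdot(\bm k+\bm y)}\right]. $$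
   Context: A $d$-dimensional lattice is a set $\Lambda=A\mathbb Z^d$ with $A\in\mathbb R^{d\times d}$ regular; $V_\Lambda=|\det A|$, and the reciprocal lattice is $\Lambda^*=A^{-T}\mathbb Z^d$. For $\bm x,\bm y\in\mathbb R^d$, the Epstein zeta function $Z_{\Lambda,\nu}(\bm x,\bm y)$ is the meromorphic continuation to $\nu\in\mathbb C$ of the lattice sum $\sum'_{\bm z\in\Lambda}e^{-2\pi i\bm y\cdot\bm z}/|\bm x-\bm z|^{\nu}$, $\mathrm{Re}(\nu)>d$, where the primed sum excludes the summand $\bm z=\bm x$ (if $\bm x\in\Lambda$). $\Gamma(s,x)$ is the upper incomplete gamma function, i.e. for $x>0$ the entire function of $s\in\mathbb C$ given by $\int_x^\infty t^{s-1}e^{-t}\,dt$. The upper Crandall function is, for $\nu\in\mathbb C$, $$G_\nu(\bm z)=\frac{\Gamma(\nu/2,\pi\bm z^2)}{(\pi\bm z^2)^{\nu/2}}\quad(\bm z\in\mathbb R^d\setminus\{\bm 0\}),\qquad G_\nu(\bm 0)=-\frac2\nu,$$ where $\bm z^2=\sum_j z_j^2$. Here $1/\Gamma$ is the entire reciprocal gamma function, and when $\bm x\in\Lambda$ and $\nu=0$ the product $G_\nu(\bm 0)/\Gamma(\nu/2)$ is understood through its removable singularity, $G_\nu(\bm 0)/\Gamma(\nu/2)=-1/\Gamma(\nu/2+1)$. *)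

(* Defs.v *)
From HB Require Import structures.
From mathcomp Require Import all_boot all_order all_algebra finmap.
From mathcomp Require Import complex.
From mathcomp Require Import all_classical all_reals all_analysis.
From mathcomp Require Import showcase.summability.

Set Implicit Arguments.
Unset Strict Implicit.
Unset Printing Implicit Defensive.

Import Order.TTheory GRing.Theory Num.Theory numFieldNormedType.Exports.

Local Open Scope classical_set_scope.
Local Open Scope ring_scope.
Local Open Scope complex_scope.

(* The type R[i] carries its usual topology through its alias R[i]^o. *)

Definition cexp (R : realType) (z : R[i]) : R[i] :=
  (expR (complex.Re z))%:C * (cos (complex.Im z) +i* sin (complex.Im z)).

(* Only used for x > 0, where it is the principal value. *)
Definition cpow (R : realType) (x : R) (s : R[i]) : R[i] :=
  cexp (s * (ln x)%:C).

(* e^(-2 pi i t) *)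
Definition phase (R : realType) (t : R) : R[i] :=
  cexp (0 +i* (- (2 * pi * t))).

Definition cintegral (R : realType) (D : set R) (f : R -> R[i]) : R[i] :=
  (\int[lebesgue_measure]_(t in D) complex.Re (f t))%R
  +i* (\int[lebesgue_measure]_(t in D) complex.Im (f t))%R.

(* The integral converges absolutely for every s when x > 0, and for x = 0
   when 0 < Re s. *)
Definition upper_gamma (R : realType) (s : R[i]) (x : R) : R[i] :=
  cintegral `]x, +oo[ (fun t => cpow t (s - 1) * (expR (- t))%:C).

(* 1 / Gamma(s) = s (s + 1) ... (s + n - 1) / Gamma(s + n), with n so large
   that Re s + n > 0 and Gamma(s + n) is given by Euler's integral. *)
Definition rgamma (R : realType) (s : R[i]) : R[i] :=
  let n := (Num.truncn `|complex.Re s|).+1 in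
  (\prod_(i < n) (s + i%:R)) / upper_gamma (s + n%:R) 0.

Definition dot (R : realType) (d : nat) (u v : 'cV[R]_d) : R :=
  \sum_(j < d) u j 0 * v j 0.

Definition enorm (R : realType) (d : nat) (u : 'cV[R]_d) : R :=
  Num.sqrt (dot u u).

Definition lattice (R : realType) (d : nat) (A : 'M[R]_d) : set 'cV[R]_d :=
  [set A *m map_mx intr n | n in [set: 'cV[int]_d]].

Definition reciprocal_lattice (R : realType) (d : nat) (A : 'M[R]_d) :
    set 'cV[R]_d :=
  lattice (invmx A)^T.

(* The net of the sums of f over the finite subsets of D converges to S;
   over R[i] this is absolute convergence with sum S. *)
Definition has_sum (R : realType) (T : choiceType) (D : set T) (f : T -> R[i])
    (S : R[i]) : Prop :=
  partial_sum (fun z => if z \in D then f z else 0) @ totally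
    --> (S : R[i]^o).

Definition analytic_at (R : realType) (f : R[i] -> R[i]) (s : R[i]) : Prop :=
  exists a : nat -> R[i], \forall z \near (s : R[i]^o),
    series (fun k => a k * (z - s) ^+ k) @ \oo --> (f z : R[i]^o).

(* f has around s a Laurent expansion with finite principal part; the value
   f s itself is irrelevant. *)
Definition meromorphic_at (R : realType) (f : R[i] -> R[i]) (s : R[i]) : Prop :=
  exists (N : nat) (g : R[i] -> R[i]), analytic_at g s /\
    \forall z \near (s : R[i]^o)^', f z = g z / (z - s) ^+ N.

Definition epstein_term (R : realType) (d : nat) (x y : 'cV[R]_d) (nu : R[i])
    (z : 'cV[R]_d) : R[i] :=
  phase (dot y z) / cpow (enorm (x - z)) nu.

(* Z is the meromorphic continuation of nu |-> Z_{Lambda,nu}(x, y), where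
   Lambda = A Z^d; its values at poles are unspecified. *)
Definition epstein_zeta (R : realType) (d : nat) (A : 'M[R]_d)
    (x y : 'cV[R]_d) (Z : R[i] -> R[i]) : Prop :=
  (forall s : R[i], meromorphic_at Z s) /\
  (forall nu : R[i], d%:R < complex.Re nu ->
    has_sum (lattice A `\ x) (epstein_term x y nu) (Z nu)).

Definition crandall (R : realType) (d : nat) (nu : R[i]) (z : 'cV[R]_d) :
    R[i] :=
  if z == 0 then - (2 / nu)
  else upper_gamma (nu / 2) (pi * dot z z) / cpow (pi * dot z z) (nu / 2).

(* G_nu(z) / Gamma(nu / 2), extended to nu = 0, z = 0 by its limit. *)
Definition crandall_over_gamma (R : realType) (d : nat) (nu : R[i])
    (z : 'cV[R]_d) : R[i] :=
  if (nu == 0) && (z == 0) then - rgamma (nu / 2 + 1)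
  else rgamma (nu / 2) * crandall nu z.

(* Main.v *)
Require Import Defs.
From HB Require Import structures.
From mathcomp Require Import all_boot all_order all_algebra finmap.
From mathcomp Require Import complex.
From mathcomp Require Import all_classical all_reals all_analysis.
From mathcomp Require Import showcase.summability measurable_realfun ring lra zify.

Set Implicit Arguments.
Unset Strict Implicit.
Unset Printing Implicit Defensive.

Import Order.TTheory GRing.Theory Num.Theory numFieldNormedType.Exports.

Local Open Scope classical_set_scope.
Local Open Scope ring_scope.
Local Open Scope complex_scope.

(* Gaussian Poisson summation on the lattice gives, for u > 0, an identity
   sum_n f_n e^(-a_n u) = c u^(-d/2) sum_k g_k e^(-b_k/u), where a_n, b_k are
   pi times the squared lengths of (z - x)/lambda and lambda (k + y). For
   Re s > d/2, s = nu/2, multiply by u^(s-1), integrate over (0,1) both ways,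
   and add the integrals over (1,oo) of the left terms with a_n > 0: the left
   side becomes Gamma(s) sum_n f_n a_n^(-s), up to the elementary contribution
   of a_n = 0, and the right side becomes two series of incomplete gamma
   integrals over (1,oo). These series are Mellin integrals of exponentially
   decaying functions, hence entire in s, so the right side is the continuation.
   The one-dimensional Poisson formula is obtained in Polya's way, as the limit
   of a finite identity for (2 cos)^(2m) averaged over roots of unity; the
   d-dimensional one follows by induction with Schur complements. *)


(** * Unconditional sums of complex numbers *)

(** Since [has_sum] is convergence along finite subsets, every series is treated as an unordered
    [usum]. A bound [absum] on all finite sums of moduli is what licenses rearrangements, termwise
    limits and termwise integrals; it is explicit because domination must be uniform in shifts and
    in u.

    Three obstacles shape the rest. The limit in Polya's argument leaves a factor with central
    binomial coefficients; its limit is calibrated on the self-dual series instead of being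
    computed. Meromorphy is given by local expansions at each point, so uniqueness of the
    continuation needs an identity theorem, proved from power series alone; likewise Mellin
    integrals are shown analytic by expanding u^s in s. Finally [rgamma] divides by Euler's
    integral, so its analyticity requires that Gamma has no zero in the right half-plane.

    The vectors z = x and k = -y, where the Gaussian does not decay, give the values of the Crandall
    function at 0. The first is carried by 1/Gamma(nu/2 + 1), which is regular at nu = 0; the second
    is the only source of a pole, at nu = d. *)

Definition cmod (R : realType) (z : R[i]) : R := complex.Re `|z|.

Section Cmod.
Variable R : realType.
Implicit Types (z w : R[i]).

Lemma cmodE z : `|z| = (cmod z)%:C.
Proof. by rewrite /cmod normc_def. Qed.

Lemma cmod_ge0 z : 0 <= cmod z.
Proof. by rewrite -ler0c -cmodE. Qed.

Lemma cmod0 : cmod (0 : R[i]) = 0.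
Proof. by apply: complexI; rewrite -cmodE normr0. Qed.

Lemma cmod1 : cmod (1 : R[i]) = 1.
Proof. by apply: complexI; rewrite -cmodE normr1. Qed.

Lemma cmod_eq0 z : (cmod z == 0) = (z == 0).
Proof. by rewrite -[RHS]normr_eq0 cmodE -(inj_eq (@complexI R)). Qed.

Lemma cmod_gt0 z : (0 < cmod z) = (z != 0).
Proof. by rewrite lt_def cmod_ge0 andbT cmod_eq0. Qed.

Lemma cmodN z : cmod (- z) = cmod z.
Proof. by rewrite /cmod normrN. Qed.

Lemma cmodD z w : cmod (z + w) <= cmod z + cmod w.
Proof. by rewrite -lecR rmorphD /= -!cmodE ler_normD. Qed.

Lemma cmodB z w : cmod (z - w) <= cmod z + cmod w.
Proof. by rewrite -(cmodN w) cmodD. Qed.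

Lemma cmodC z w : cmod (z - w) = cmod (w - z).
Proof. by rewrite -cmodN opprB. Qed.

Lemma cmodM z w : cmod (z * w) = cmod z * cmod w.
Proof. by apply: complexI; rewrite rmorphM /= -!cmodE normrM. Qed.

Lemma cmodX z n : cmod (z ^+ n) = cmod z ^+ n.
Proof. by apply: complexI; rewrite rmorphXn /= -!cmodE normrX. Qed.

Lemma cmodV z : cmod z^-1 = (cmod z)^-1.
Proof. by apply: complexI; rewrite fmorphV /= -!cmodE normfV. Qed.

Lemma cmod_real (x : R) : cmod x%:C = `|x|.
Proof. by rewrite /cmod normc_def /= expr0n addr0 sqrtr_sqr. Qed.

Lemma cmod_Re z : `|complex.Re z| <= cmod z.
Proof. by rewrite -lecR -cmodE normc_ge_Re. Qed.

Lemma cmod_Im z : `|complex.Im z| <= cmod z.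
Proof.
case: z => a b; rewrite /cmod normc_def /= -sqrtr_sqr ler_wsqrtr //.
by rewrite lerDr sqr_ge0.
Qed.

Lemma cmod_le z : cmod z <= `|complex.Re z| + `|complex.Im z|.
Proof.
case: z => a b /=.
have -> : a +i* b = a%:C + 'i * b%:C by rewrite [LHS]complexE.
apply: le_trans (cmodD _ _) _; rewrite cmodM !cmod_real.
suff -> : cmod ('i : R[i]) = 1 by rewrite mul1r.
by rewrite /cmod normc_def /= expr0n add0r expr1n sqrtr1.
Qed.

Lemma cmod_sum (I : Type) (r : seq I) (f : I -> R[i]) :
  cmod (\sum_(i <- r) f i) <= \sum_(i <- r) cmod (f i).
Proof.
elim/big_ind2: _ => [|a b u v hu hv|//]; first by rewrite cmod0.
by apply: le_trans (cmodD _ _) _; rewrite lerD.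
Qed.

Lemma Re_sum (I : Type) (r : seq I) (f : I -> R[i]) :
  complex.Re (\sum_(i <- r) f i) = \sum_(i <- r) complex.Re (f i).
Proof. by elim/big_rec2: _ => // i y1 y2 _ <-; case: (f i) y2 => [? ?] []. Qed.

Lemma Im_sum (I : Type) (r : seq I) (f : I -> R[i]) :
  complex.Im (\sum_(i <- r) f i) = \sum_(i <- r) complex.Im (f i).
Proof. by elim/big_rec2: _ => // i y1 y2 _ <-; case: (f i) y2 => [? ?] []. Qed.

(** A real epsilon and an arbitrary filter: one notion serves sequences, neighbourhoods and the net
    of finite sets. *)
Definition ccvg (T : Type) (F : set_system T) (f : T -> R[i]) (l : R[i]) :=
  forall e : R, 0 < e -> \forall x \near F, cmod (f x - l) < e.

Lemma ccvgP (T : Type) (F : set_system T) {FF : Filter F} (f : T -> R[i])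
    (l : R[i]) :
  (f @ F --> (l : R[i]^o)) <-> ccvg F f l.
Proof.
split.
  move=> /(@cvgrPdist_lt _ R[i]^o _ _ FF) h e e0.
  have e0' : 0 < e%:C by rewrite ltcR.
  have := h _ e0'; apply: filterS => x /=.
  by rewrite distrC cmodE ltcR.
move=> h; apply/(@cvgrPdist_lt _ R[i]^o _ _ FF) => e e0.
(* The order of [R[i]] only compares numbers with equal imaginary part, so a positive [e] is
   real. *)
have eE : e = (complex.Re e)%:C.
  by case: e e0 => a b; rewrite ltcE /= => /andP[/eqP-> _].
rewrite eE in e0 *; rewrite ltcR in e0.
have := h _ e0; apply: filterS => x /=.
by rewrite distrC cmodE ltcR.
Qed.

Lemma ccvg_cmodP (T : Type) (F : set_system T) {FF : Filter F} (f : T -> R[i])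
    (l : R[i]) :
  ccvg F f l <-> (cmod (f x - l) @[x --> F] --> 0).
Proof.
split.
  move=> h; apply/cvgrPdist_lt => e e0.
  have := h _ e0; apply: filterS => x /=.
  by rewrite distrC subr0 ger0_norm ?cmod_ge0.
move=> /cvgrPdist_lt h e e0.
have := h _ e0; apply: filterS => x /=.
by rewrite distrC subr0 ger0_norm ?cmod_ge0.
Qed.

Lemma ccvg_squeeze (T : Type) (F : set_system T) {FF : Filter F} (f : T -> R[i])
    (h : T -> R) (l : R[i]) :
  (\forall x \near F, cmod (f x - l) <= h x) -> h @ F --> 0 -> ccvg F f l.
Proof.
move=> fh /cvgrPdist_lt h0 e e0.
have := h0 _ e0; move: fh; apply: filterS2 => x le.
by rewrite sub0r normrN; apply: le_lt_trans; apply: le_trans le (ler_norm _).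
Qed.

Lemma ccvgRI (T : Type) (F : set_system T) {FF : Filter F} (f : T -> R[i])
    (l : R[i]) :
  (complex.Re (f x) @[x --> F] --> complex.Re l) ->
  (complex.Im (f x) @[x --> F] --> complex.Im l) -> ccvg F f l.
Proof.
move=> /cvgrPdist_lt h1 /cvgrPdist_lt h2 e e0.
have e2 : 0 < e / 2 by rewrite divr_gt0.
have := h1 _ e2; have := h2 _ e2; apply: filterS2 => x.
rewrite distrC => hi; rewrite distrC => hr.
apply: le_lt_trans (cmod_le _) _.
rewrite [e]splitr.
by move: hi hr; case: (f x) (l) => a b [c d] /= hi hr; apply: ltrD.
Qed.

Lemma ccvg_Re (T : Type) (F : set_system T) {FF : Filter F} (f : T -> R[i])
    (l : R[i]) :
  ccvg F f l -> complex.Re (f x) @[x --> F] --> complex.Re l.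
Proof.
move=> h; apply/cvgrPdist_lt => e e0.
have := h _ e0; apply: filterS => x; rewrite cmodC.
apply: le_lt_trans; apply: le_trans (cmod_Re _).
by case: (f x) (l) => a b [].
Qed.

Lemma ccvg_Im (T : Type) (F : set_system T) {FF : Filter F} (f : T -> R[i])
    (l : R[i]) :
  ccvg F f l -> complex.Im (f x) @[x --> F] --> complex.Im l.
Proof.
move=> h; apply/cvgrPdist_lt => e e0.
have := h _ e0; apply: filterS => x; rewrite cmodC.
apply: le_lt_trans; apply: le_trans (cmod_Im _).
by case: (f x) (l) => a b [].
Qed.

Lemma ccvg_real (T : Type) (F : set_system T) {FF : Filter F} (f : T -> R)
    (l : R) : f @ F --> l -> ccvg F (fun x => (f x)%:C) l%:C.
Proof. by move=> h; apply: ccvgRI => //=; exact: cvg_cst. Qed.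

Lemma ccvg_cst (T : Type) (F : set_system T) {FF : Filter F} (l : R[i]) :
  ccvg F (fun _ : T => l) l.
Proof. by move=> e e0; apply: nearW => x; rewrite subrr cmod0. Qed.

Lemma near_ccvg (T : Type) (F : set_system T) {FF : Filter F}
    (f g : T -> R[i]) (l : R[i]) :
  (\forall x \near F, f x = g x) -> ccvg F f l -> ccvg F g l.
Proof.
by move=> fg fl e e0; have := fl _ e0; move: fg; apply: filterS2 => x ->.
Qed.

Lemma ccvgD (T : Type) (F : set_system T) {FF : Filter F} (f g : T -> R[i])
    (l m : R[i]) :
  ccvg F f l -> ccvg F g m -> ccvg F (fun x => f x + g x) (l + m).
Proof.
move=> /ccvg_cmodP fl /ccvg_cmodP gm.
apply: (@ccvg_squeeze _ _ _ _ (fun x => cmod (f x - l) + cmod (g x - m))).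
  by apply: nearW => x; rewrite opprD addrACA cmodD.
by rewrite -[0]addr0; apply: cvgD.
Qed.

Lemma ccvgM (T : Type) (F : set_system T) {FF : Filter F} (f g : T -> R[i])
    (l m : R[i]) :
  ccvg F f l -> ccvg F g m -> ccvg F (fun x => f x * g x) (l * m).
Proof.
move=> /ccvg_cmodP fl /ccvg_cmodP gm.
apply: (@ccvg_squeeze _ _ _ _ (fun x => cmod (f x - l) * cmod (g x - m)
   + (cmod l * cmod (g x - m) + cmod m * cmod (f x - l)))).
  apply: nearW => x.
  have -> : f x * g x - l * m = (f x - l) * (g x - m) +
     (l * (g x - m) + m * (f x - l)) by ring.
  by apply: le_trans (cmodD _ _) _; rewrite -!cmodM lerD2l cmodD.
have -> : 0 = 0 * 0 + (cmod l * 0 + cmod m * 0) :> R by ring.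
by apply: cvgD; [exact: cvgM|apply: cvgD; apply: cvgM => //; exact: cvg_cst].
Qed.

Lemma ccvgZ (T : Type) (F : set_system T) {FF : Filter F} (c : R[i])
    (f : T -> R[i]) (l : R[i]) : ccvg F f l -> ccvg F (fun x => c * f x) (c * l).
Proof. by move=> fl; exact: (ccvgM (ccvg_cst c) fl). Qed.

Lemma ccvgB (T : Type) (F : set_system T) {FF : Filter F} (f g : T -> R[i])
    (l m : R[i]) :
  ccvg F f l -> ccvg F g m -> ccvg F (fun x => f x - g x) (l - m).
Proof.
move=> fl gm; apply: ccvgD fl _.
rewrite -mulN1r; apply: near_ccvg (ccvgZ (-1) gm).
by apply: nearW => x; rewrite mulN1r.
Qed.

Lemma ccvg_sum (T I : Type) (F : set_system T) {FF : Filter F} (r : seq I)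
    (f : T -> I -> R[i]) (g : I -> R[i]) :
  (forall i, ccvg F (f^~ i) (g i)) ->
  ccvg F (fun x => \sum_(i <- r) f x i) (\sum_(i <- r) g i).
Proof.
move=> fg; elim: r => [|i r IH].
  by rewrite big_nil; under eq_fun do rewrite big_nil; exact: ccvg_cst.
by rewrite big_cons; under eq_fun do rewrite big_cons; exact: (ccvgD (fg i) IH).
Qed.

Lemma ccvg_cmod (T : Type) (F : set_system T) {FF : Filter F} (f : T -> R[i])
    (l : R[i]) :
  ccvg F f l -> cmod (f x) @[x --> F] --> cmod l.
Proof.
move=> h; apply/cvgrPdist_lt => e e0.
have := h _ e0; apply: filterS => x; apply: le_lt_trans.
rewrite ler_norml !lerBlDr lerBrDr.
have := cmodD (f x - l) l; have := cmodD (l - f x) (f x).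
by rewrite !subrK (cmodC l); lra.
Qed.

Lemma ccvg_unique (T : Type) (F : set_system T) {FF : ProperFilter F}
    (f : T -> R[i]) (l m : R[i]) :
  ccvg F f l -> ccvg F f m -> l = m.
Proof.
move=> fl fm; apply/eqP; rewrite -subr_eq0 -cmod_eq0 eq_le cmod_ge0 andbT.
apply/ler_addgt0Pl => e e0; rewrite addr0.
have e2 : 0 < e / 2 by rewrite divr_gt0.
have [x [h1 h2]] := filter_ex (filterI (fl _ e2) (fm _ e2)).
have -> : l - m = (f x - m) - (f x - l) by ring.
by rewrite [e]splitr ltW //; apply: le_lt_trans (cmodB _ _) (ltrD _ _).
Qed.

Lemma ccvg_cmod_le (T : Type) (F : set_system T) {FF : ProperFilter F}
    (f : T -> R[i]) (l : R[i]) (M : R) :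
  ccvg F f l -> (\forall x \near F, cmod (f x) <= M) -> cmod l <= M.
Proof.
move=> fl fM; apply/ler_addgt0Pl => e e0.
have [x [h1 h2]] := filter_ex (filterI (fl _ e0) fM).
have -> : l = f x - (f x - l) by ring.
apply: le_trans (cmodB _ _) _; rewrite addrC; exact: lerD (ltW _) _.
Qed.

End Cmod.

Arguments ccvgZ {R T F FF} c {f l}.

#[global] Existing Instance totally_filter.

Definition usum (R : realType) (T : choiceType) (f : T -> R[i]) (S : R[i]) :=
  ccvg totally (partial_sum f) S.

(** Absolute summability is recorded with its bound, because domination needs one bound for a whole
    family of series. *)
Definition absum (R : realType) (T : choiceType) (f : T -> R[i]) (M : R) :=
  forall K : {fset T}, \sum_(i <- K) cmod (f i) <= M.

Section Usum.
Variables (R : realType) (T : choiceType).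
Implicit Types (f g : T -> R[i]) (S : R[i]) (M : R).

Lemma partial_sumE (V : zmodType) (f : T -> V) (K : {fset T}) :
  partial_sum f K = \sum_(i <- K) f i.
Proof. by rewrite /partial_sum big_seq_fsetE. Qed.

Lemma near_totally (P : set {fset T}) :
  (\forall K \near totally, P K) <->
  exists J : {fset T}, forall K : {fset T}, fsubset J K -> P K.
Proof.
split; first by case=> J _ h; exists J => K JK; apply: h.
by case=> J h; exists J => // K; apply: h.
Qed.

Lemma usumP f S : usum f S <-> forall e : R, 0 < e ->
  exists J : {fset T}, forall K : {fset T}, fsubset J K ->
    cmod (\sum_(i <- K) f i - S) < e.
Proof.
split.
  move=> h e e0; have /near_totally[J hJ] := h _ e0.
  by exists J => K JK; rewrite -partial_sumE; apply: hJ.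
move=> h e e0; have [J hJ] := h _ e0.
by apply/near_totally; exists J => K JK; rewrite partial_sumE; apply: hJ.
Qed.

Lemma usum_unique f S S' : usum f S -> usum f S' -> S = S'.
Proof. exact: ccvg_unique. Qed.

Lemma eq_usum f g S : f =1 g -> usum f S -> usum g S.
Proof. by move=> /funext ->. Qed.

Lemma usumD f g S S' : usum f S -> usum g S' ->
  usum (fun i => f i + g i) (S + S').
Proof.
move=> h h'; rewrite /usum.
have -> : partial_sum (fun i => f i + g i) = partial_sum f \+ partial_sum g.
  by apply/funext => K; rewrite /= /partial_sum big_split.
exact: ccvgD.
Qed.

Lemma usumZ f S c : usum f S -> usum (fun i => c * f i) (c * S).
Proof.
move=> h; rewrite /usum.
have -> : partial_sum (fun i => c * f i) = (fun K => c * partial_sum f K).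
  by apply/funext => K; rewrite /= /partial_sum mulr_sumr.
exact: ccvgZ.
Qed.

Lemma usumN f S : usum f S -> usum (fun i => - f i) (- S).
Proof.
move=> h; have := @usumZ f S (-1) h; rewrite mulN1r.
by apply: eq_usum => i; rewrite mulN1r.
Qed.

Lemma usumB f g S S' : usum f S -> usum g S' ->
  usum (fun i => f i - g i) (S - S').
Proof. by move=> h h'; exact: (usumD h (usumN h')). Qed.

Lemma big_fset_disj (V : zmodType) (f : T -> V) (J K : {fset T}) :
  fdisjoint J K ->
  \sum_(i <- (J `|` K)%fset) f i = \sum_(i <- J) f i + \sum_(i <- K) f i.
Proof.
move=> /fdisjointP dJK.
rewrite -big_cat; apply: perm_big; apply: uniq_perm; rewrite ?fset_uniq //.
  rewrite cat_uniq !fset_uniq andbT /=; apply/hasPn => i iK.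
  by apply/negP => /dJK; rewrite iK.
by move=> i; rewrite mem_cat inE.
Qed.

Lemma big_fset_subset (V : zmodType) (f : T -> V) (J K : {fset T}) :
  fsubset J K ->
  \sum_(i <- K) f i = \sum_(i <- J) f i + \sum_(i <- (K `\` J)%fset) f i.
Proof.
move=> JK; have {1}-> : K = (J `|` (K `\` J))%fset.
  by apply/fsetP => i; rewrite !inE; case: (boolP (i \in J)) => //= /(fsubsetP JK) ->.
by rewrite big_fset_disj //; apply/fdisjointP => i iJ; rewrite !inE iJ.
Qed.

Lemma usum_fin f (J : {fset T}) : (forall i, i \notin J -> f i = 0) ->
  usum f (\sum_(i <- J) f i).
Proof.
move=> h; apply/usumP => e e0; exists J => K JK.
rewrite (big_fset_subset _ JK) [X in _ + X - _]big1_seq ?addr0 ?subrr ?cmod0 //.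
by move=> i /andP[_]; rewrite !inE => /andP[/h].
Qed.

Lemma absum_fin f (J : {fset T}) : (forall i, i \notin J -> f i = 0) ->
  absum f (\sum_(i <- J) cmod (f i)).
Proof.
move=> h K; apply: (@le_trans _ _ (\sum_(i <- (K `|` J)%fset) cmod (f i))).
  rewrite (big_fset_subset _ (fsubsetUl K J)) lerDl.
  by apply: sumr_ge0 => i _; exact: cmod_ge0.
rewrite (big_fset_subset _ (fsubsetUr K J)) [X in _ + X]big1_seq ?addr0 //.
by move=> i /andP[_]; rewrite !inE => /andP[/h-> _]; rewrite cmod0.
Qed.

Lemma absum_ge0 f M : absum f M -> 0 <= M.
Proof. by move=> /(_ fset0); rewrite big_seq_fset0. Qed.

Lemma absum_le f g M : (forall i, cmod (f i) <= cmod (g i)) ->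
  absum g M -> absum f M.
Proof. by move=> h hg K; apply: le_trans (hg K); apply: ler_sum. Qed.

(** The finite sums of moduli have a supremum; a finite set within [e] of it leaves less than [e] to
    any finite set disjoint from it. *)
Lemma absum_tail f M : absum f M -> forall e : R, 0 < e ->
  exists J : {fset T}, forall K : {fset T}, fdisjoint K J ->
    \sum_(i <- K) cmod (f i) < e.
Proof.
move=> fM e e0.
pose A := [set x | exists K : {fset T}, x = \sum_(i <- K) cmod (f i)].
have supA : has_sup A.
  split; first by exists (\sum_(i <- fset0) cmod (f i)); exists fset0.
  by exists M => _ [K ->].
have [_ [J ->] hJ] := sup_adherent e0 supA.
exists J => K dKJ.
have := sup_upper_bound supA (ex_intro _ (K `|` J)%fset erefl).
rewrite big_fset_disj //= => h.
by rewrite -(ltrD2r (\sum_(i <- J) cmod (f i))); apply: le_lt_trans h _;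
  rewrite -ltrBlDl.
Qed.

Lemma absum_tail0 f M : absum f M -> forall e : R, 0 < e ->
  exists J : {fset T}, absum (fun i => if i \in J then 0 else f i) e.
Proof.
move=> fM e e0; have [J hJ] := absum_tail fM e0; exists J => K.
have -> : \sum_(i <- K) cmod (if i \in J then 0 else f i) =
          \sum_(i <- (K `\` J)%fset) cmod (f i).
  rewrite [RHS](_ : _ = \sum_(i <- K | i \notin J) cmod (f i)).
    rewrite [RHS]big_mkcond; apply: eq_bigr => i _.
    by case: (i \in J) => //=; rewrite cmod0.
  rewrite [RHS]big_fset_condE; apply: perm_big; apply: uniq_perm => // i.
  by rewrite !inE /= andbC.
by apply/ltW/hJ/fdisjointP => i; rewrite !inE => /andP[].
Qed.

(** Real and imaginary parts are Cauchy nets by the tail estimate. A sum of modulus above [M] would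
    be approached by finite sums of modulus above [M]. *)
Lemma absum_usum f M : absum f M -> exists2 S, usum f S & cmod S <= M.
Proof.
move=> fM.
have cau (g : T -> R) : (forall i, `|g i| <= cmod (f i)) ->
    cvg (partial_sum g @ totally).
  move=> gf; apply: cauchy_cvg; apply/cauchyP => e e0.
  have [J hJ] := absum_tail fM e0.
  have hK K : fsubset J K -> `|partial_sum g J - partial_sum g K| < e.
    move=> JK; rewrite !partial_sumE (big_fset_subset _ JK) opprD addNKr normrN.
    apply: le_lt_trans (ler_norm_sum _ _ _) _.
    apply: le_lt_trans (hJ (K `\` J)%fset _); first exact: ler_sum.
    by apply/fdisjointP => i; rewrite !inE => /andP[].
  by exists (partial_sum g J); apply/near_totally; exists J => K /hK.
have hR : forall i, `|complex.Re (f i)| <= cmod (f i) by move=> i; exact: cmod_Re.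
have hI : forall i, `|complex.Im (f i)| <= cmod (f i) by move=> i; exact: cmod_Im.
have /cvg_ex[a ha] := cau _ hR; have /cvg_ex[b hb] := cau _ hI.
have hS : usum f (a +i* b).
  apply: ccvgRI => /=.
    rewrite (_ : (fun K => _) = partial_sum (fun i => complex.Re (f i))) //.
    by apply/funext => K; rewrite !partial_sumE Re_sum.
  rewrite (_ : (fun K => _) = partial_sum (fun i => complex.Im (f i))) //.
  by apply/funext => K; rewrite !partial_sumE Im_sum.
exists (a +i* b) => //; rewrite leNgt; apply/negP => lt.
have /usumP/(_ (cmod (a +i* b) - M)) := hS; rewrite subr_gt0 => /(_ lt)[J].
move=> /(_ _ (fsubset_refl J)); apply/negP; rewrite -leNgt lerBlDr.
apply: le_trans (lerD (lexx _) (fM J)).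
apply: le_trans (lerD (lexx _) (cmod_sum _ _)).
by rewrite cmodC; apply: le_trans (cmodD _ _); rewrite subrK.
Qed.

Lemma usum_cmod_le f S M : usum f S -> absum f M -> cmod S <= M.
Proof.
by move=> fS /absum_usum[S' fS']; rewrite (usum_unique fS fS').
Qed.

Lemma absumD f g M N : absum f M -> absum g N ->
  absum (fun i => f i + g i) (M + N).
Proof.
move=> hf hg K; apply: le_trans (lerD (hf K) (hg K)).
by rewrite -big_split /=; apply: ler_sum => i _; exact: cmodD.
Qed.

Lemma absumZ f c M : absum f M -> absum (fun i => c * f i) (cmod c * M).
Proof.
move=> hf K; under eq_bigr do rewrite cmodM.
by rewrite -mulr_sumr ler_wpM2l ?cmod_ge0.
Qed.

(** Tannery's theorem. A finite set carries [h] up to e/4, so the two tails cost at most e/4 each,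
    and on the finite set the terms converge. *)
Lemma usum_dominated (I : Type) (F : set_system I) (FF : ProperFilter F)
    (f : I -> T -> R[i]) (g h : T -> R[i]) (M : R) (S_ : I -> R[i]) (S : R[i]) :
  absum h M ->
  (\forall l \near F, forall i, cmod (f l i) <= cmod (h i)) ->
  (forall i, ccvg F (f^~ i) (g i)) ->
  (\forall l \near F, usum (f l) (S_ l)) -> usum g S -> ccvg F S_ S.
Proof.
move=> hM fh fg fS gS e e0.
have e4 : 0 < e / 4 by rewrite divr_gt0.
have [J hJ] := absum_tail hM e4.
have gh i : cmod (g i) <= cmod (h i).
  by apply: ccvg_cmod_le (fg i) _; move: fh; apply: filterS => l; apply.
have tail (u : T -> R[i]) U : usum u U -> (forall i, cmod (u i) <= cmod (h i)) ->
    cmod (U - \sum_(i <- J) u i) <= e / 4.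
  move=> hu uh; rewrite leNgt; apply/negP => lt.
  have /usumP/(_ (cmod (U - \sum_(i <- J) u i) - e / 4)) := hu.
  rewrite subr_gt0 => /(_ lt)[J' /(_ (J `|` J')%fset (fsubsetUr _ _))].
  rewrite (big_fset_subset _ (fsubsetUl J J')).
  set A := \sum_(i <- J) _; set B := \sum_(i <- _) _.
  apply/negP; rewrite -leNgt lerBlDr.
  apply: (@le_trans _ _ (cmod (A + B - U) + cmod B)).
    by rewrite cmodC; apply: le_trans (cmodB _ _); rewrite addrAC addrK.
  rewrite lerD2l; apply: le_trans (cmod_sum _ _) _.
  apply: le_trans (ltW (hJ ((J `|` J') `\` J)%fset _)); first exact: ler_sum.
  by apply/fdisjointP => i; rewrite !inE => /andP[].
apply: filterS3 fh fS (ccvg_sum J fg e4) => l hl fSl h1.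
have := tail _ _ gS gh; have := tail _ _ fSl hl.
set A := \sum_(i <- J) f l i in h1 *; set B := \sum_(i <- J) g i in h1 *.
move=> h2 h3.
have -> : S_ l - S = (S_ l - A) + (A - B) - (S - B).
  by rewrite addrA subrK opprB addrA subrK.
have := cmodB (S_ l - A + (A - B)) (S - B); have := cmodD (S_ l - A) (A - B).
by move: h1 h2 h3 e0; lra.
Qed.

End Usum.

Lemma usum_finType (R : realType) (T : finType) (f : T -> R[i]) :
  usum f (\sum_i f i).
Proof.
have p : perm_eq (seq_fset tt (enum T)) (enum T).
  by apply: uniq_perm => [||i]; rewrite ?fset_uniq ?enum_uniq ?seq_fsetE.
have := @usum_fin R T f (seq_fset tt (enum T)).
rewrite (perm_big _ p) big_enum; apply=> i.
by rewrite seq_fsetE mem_enum.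
Qed.

(** * Change of index set, double series, Cauchy products *)

Section Reindex.
Variables (R : realType).

Lemma absum_seq (T : choiceType) (f : T -> R[i]) (M : R) (s : seq T) :
  absum f M -> uniq s -> \sum_(i <- s) cmod (f i) <= M.
Proof.
move=> fM us; have p : perm_eq s (seq_fset tt s).
  by apply: uniq_perm => // i; rewrite seq_fsetE.
by rewrite (perm_big _ p).
Qed.

Lemma preim_fset (T U : choiceType) (h : T -> U) (K : {fset U}) :
  injective h -> exists K' : {fset T}, forall t, (t \in K') = (h t \in K).
Proof.
move=> hi.
suff : exists K' : {fset T}, forall t, (t \in K') = (h t \in (K : seq U)) by [].
elim: (K : seq U) => [|u s [K' hK']]; first by exists fset0.
have [[t0 tu]|nt] := pselect (exists t, h t = u).
  exists (t0 |` K')%fset => t; rewrite !inE hK' -tu.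
  by rewrite (inj_eq hi).
exists K' => t; rewrite hK' inE; case: eqP => // e.
by case: nt; exists t.
Qed.

Lemma sum_imfset (V : zmodType) (T U : choiceType) (h : T -> U) (f : U -> V)
    (K : {fset T}) :
  injective h ->
  \sum_(u <- [fset h t | t in K]%fset) f u = \sum_(t <- K) f (h t).
Proof.
move=> hi; rewrite -(big_map h xpredT f); apply: perm_big; apply: uniq_perm => //.
  by rewrite map_inj_uniq.
move=> u; apply/imfsetP/mapP => -[t tK ->]; by exists t.
Qed.

(** Finite subsets of [U] are pulled back, those of [T] pushed forward; points outside the range
    contribute 0 either way. *)
Lemma usum_inj (T U : choiceType) (h : T -> U) (f : U -> R[i]) (S : R[i]) :
  injective h -> (forall u, (forall t, h t <> u) -> f u = 0) ->
  usum (f \o h) S <-> usum f S.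
Proof.
move=> hi f0; split => /usumP hS; apply/usumP => e /hS[J hJ].
  exists [fset h t | t in J]%fset => K JK.
  have [K' hK'] := preim_fset K hi.
  have sub : fsubset [fset h t | t in K']%fset K.
    by apply/fsubsetP => _ /imfsetP[t /= + ->]; rewrite hK'.
  rewrite (big_fset_subset _ sub) sum_imfset //.
  rewrite [X in _ + X - _]big1_seq ?addr0.
    apply: hJ; apply/fsubsetP => t tJ; rewrite hK' (fsubsetP JK) //.
    by apply/imfsetP; exists t.
  move=> u /andP[_]; rewrite !inE => /andP[+ uK]; move=> /negP nu.
  apply: f0 => t tu; apply: nu; apply/imfsetP; exists t => //=.
  by rewrite hK' tu.
have [J' hJ'] := preim_fset J hi.
exists J' => K JK; rewrite -[X in cmod (X - S)](sum_imfset f K hi).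
have := hJ ([fset h t | t in K] `|` J)%fset (fsubsetUr _ _).
rewrite (big_fset_subset _ (fsubsetUl _ J)) [X in _ + X - _]big1_seq ?addr0 //.
move=> u /andP[_]; rewrite !inE => /andP[/negP nu]; rewrite (negPf (introN idP nu)) /=.
move=> uJ; apply: f0 => t tu; apply: nu; apply/imfsetP; exists t => //=.
by apply: (fsubsetP JK); rewrite hJ' tu.
Qed.

Lemma usum_bij (T U : choiceType) (h : T -> U) (f : U -> R[i]) (S : R[i]) :
  bijective h -> usum (f \o h) S <-> usum f S.
Proof.
move=> hb; apply: usum_inj; first exact: bij_inj.
by case: hb => g _ gK u /(_ (g u)); rewrite gK.
Qed.

Lemma absum_inj (T U : choiceType) (h : T -> U) (f : U -> R[i]) (M : R) :
  injective h -> absum f M -> absum (f \o h) M.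
Proof.
move=> hi fM K.
rewrite -(big_map h xpredT (fun u => cmod (f u))); apply: absum_seq => //.
by rewrite map_inj_uniq.
Qed.

Lemma absum_bij (T U : choiceType) (h : T -> U) (f : U -> R[i]) (M : R) :
  bijective h -> absum (f \o h) M -> absum f M.
Proof.
move=> [g hK gK] fM; have := absum_inj (can_inj gK) fM.
by apply: absum_le => u /=; rewrite gK.
Qed.

Lemma absum_int (f : int -> R[i]) (M N : R) :
  absum (f \o Posz) M -> absum (f \o Negz) N -> absum f (M + N).
Proof.
move=> fM fN K.
have iP : injective Posz by move=> a b [].
have iN : injective Negz by move=> a b [].
have [K1 h1] := preim_fset K iP; have [K2 h2] := preim_fset K iN.
have -> : K = ([fset Posz n | n in K1] `|` [fset Negz n | n in K2])%fset.
  apply/fsetP => z; rewrite inE; apply/idP/orP => [zK|[] /imfsetP[n /= + ->]];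
    rewrite ?h1 ?h2 //.
  by case: z zK => n nK; [left|right]; apply/imfsetP; exists n; rewrite ?h1 ?h2.
rewrite big_fset_disj; last first.
  apply/fdisjointP => z /imfsetP[n _ ->]; apply/negP => /imfsetP[k _ //].
by rewrite !sum_imfset //; apply: lerD; [exact: fM|exact: fN].
Qed.

Lemma usum_ext0 (T : choiceType) : usum (fun _ : T => 0 : R[i]) 0.
Proof. by have := @usum_fin R T (fun=> 0) fset0 (fun _ _ => erefl); rewrite big_seq_fset0. Qed.

Section Fubini.
Variables (T1 T2 : choiceType) (f : T1 * T2 -> R[i]).

Lemma usum_rows (G : T1 -> R[i]) (s : seq T1) : uniq s ->
  (forall i, usum (fun j => f (i, j)) (G i)) ->
  usum (fun p => if p.1 \in s then f p else 0) (\sum_(i <- s) G i).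
Proof.
move=> us hG; elim: s us => [_|i s IH /= /andP[nis us]].
  by rewrite big_nil; exact: usum_ext0.
rewrite big_cons.
have : usum (fun p : T1 * T2 => if p.1 == i then f p else 0) (G i).
  apply/(@usum_inj _ _ (fun j : T2 => (i, j))).
  - by move=> j j' [].
  - by move=> [i' j] /= h; case: eqP => // e; case: (h j); rewrite e.
  - by apply: eq_usum (hG i) => j /=; rewrite eqxx.
move=> /usumD/(_ (IH us)); apply: eq_usum => -[i' j] /=; rewrite inE.
by case: eqP => [->|_]; rewrite ?(negPf nis) /= ?addr0 ?add0r.
Qed.

(** Let [K] contain the first coordinates of a finite set carrying [f] up to e/2. Then [S] minus the
    rows of [K] is a sum over pairs that avoid this set. *)
Lemma usum_fubini (G : T1 -> R[i]) (S : R[i]) (M : R) :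
  absum f M -> usum f S -> (forall i, usum (fun j => f (i, j)) (G i)) ->
  usum G S.
Proof.
move=> fM fS hG; apply/usumP => e e0.
have [J hJ] := absum_tail0 fM e0.
have [J' hJ'] := absum_tail0 fM (divr_gt0 e0 (ltr0n R 2)).
exists [fset p.1 | p in J']%fset => K JK.
have hu := usumB fS (usum_rows (fset_uniq K) hG).
rewrite cmodC; apply: le_lt_trans (usum_cmod_le hu (M := e / 2) _) _.
  apply: absum_le hJ' => p; case: ifP => [pK|/negP npK].
    by rewrite subrr cmod0 cmod_ge0.
  rewrite subr0; case: ifP => // pJ; case: npK; apply: (fsubsetP JK).
  by apply/imfsetP; exists p.
by rewrite ltr_pdivrMr // ltr_pMr // ltr1n.
Qed.

Lemma absum_prod (B : T1 -> R) (M : R) :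
  (forall i, absum (fun j => f (i, j)) (B i)) ->
  (forall K : {fset T1}, \sum_(i <- K) B i <= M) -> absum f M.
Proof.
move=> fB BM K; pose K1 := [fset p.1 | p in K]%fset.
apply: le_trans (BM K1).
have -> : \sum_(p <- K) cmod (f p) =
    \sum_(i <- K1) \sum_(p <- K | p.1 == i) cmod (f p).
  rewrite (exchange_big_dep xpredT) //= big_seq [RHS]big_seq.
  apply: eq_bigr => p pK.
  under eq_bigl do rewrite eq_sym.
  rewrite -big_filter filter_pred1_uniq ?fset_uniq ?big_seq1 //.
  by apply/imfsetP; exists p.
apply: ler_sum => i _.
pose s := [seq p.2 | p <- K & p.1 == i].
have -> : \sum_(p <- K | p.1 == i) cmod (f p) = \sum_(j <- s) cmod (f (i, j)).
  rewrite big_map big_filter; apply: eq_bigr => -[a b] /= /eqP -> //.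
apply: (absum_seq (fB i)).
rewrite map_inj_in_uniq ?filter_uniq ?fset_uniq //.
move=> [a b] [a' b']; rewrite !mem_filter /=.
by move=> /andP[/eqP-> _] /andP[/eqP-> _] ->.
Qed.

End Fubini.

Lemma usum_ge_fset (T : choiceType) (x : T -> R) (b : R[i]) (K : {fset T}) :
  (forall i, 0 <= x i) -> usum (fun i => (x i)%:C) b ->
  \sum_(i <- K) x i <= complex.Re b.
Proof.
move=> x0 /usumP hb; rewrite leNgt; apply/negP => lt.
have [|J /(_ (K `|` J)%fset (fsubsetUr _ _))] := hb (\sum_(i <- K) x i - complex.Re b).
  by rewrite subr_gt0.
apply/negP; rewrite -leNgt; apply: le_trans (cmod_Re _); apply: le_trans (ler_norm _).
rewrite raddfB /= Re_sum lerD2r (big_fset_subset _ (fsubsetUl K J)) lerDl.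
by apply: sumr_ge0 => i _; exact: x0.
Qed.

(** Each [G i] is bounded by the row sum of the moduli; finitely many such rows together stay below
    [M]. *)
Lemma absum_rows (T1 T2 : choiceType) (f : T1 * T2 -> R[i]) (G : T1 -> R[i])
    (M : R) :
  absum f M -> (forall i, usum (fun j => f (i, j)) (G i)) -> absum G M.
Proof.
move=> fM hG.
pose g p : R[i] := (cmod (f p))%:C.
have gM : absum g M.
  by apply: absum_le fM => p; rewrite /g cmod_real ger0_norm ?cmod_ge0.
have gi i : absum (fun j => g (i, j)) M.
  by apply: (@absum_inj _ _ (fun j : T2 => (i, j)) _ _ _ gM) => j j' [].
have /choice[B hB] : forall i, exists b, usum (fun j => g (i, j)) b.
  by move=> i; have [b hb _] := absum_usum (gi i); exists b.
have GB i : cmod (G i) <= complex.Re (B i).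
  apply: (usum_cmod_le (hG i)) => K.
  by apply: (usum_ge_fset K _ (hB i)) => j; exact: cmod_ge0.
move=> K; apply: le_trans (ler_sum _ (fun i _ => GB i)) _.
rewrite -Re_sum; apply: le_trans (le_trans (ler_norm _) (cmod_Re _)) _.
apply: (usum_cmod_le (usum_rows (fset_uniq K) hB)).
by apply: absum_le gM => p; case: ifP => // _; rewrite cmod0 cmod_ge0.
Qed.

Lemma perm_fset_iota n : perm_eq (seq_fset tt (iota 0 n)) (iota 0 n).
Proof.
by apply: uniq_perm => [||i]; rewrite ?seq_fsetE ?fset_uniq ?iota_uniq.
Qed.

Lemma usum_series (a : nat -> R[i]) (S : R[i]) :
  usum a S -> ccvg \oo (series a) S.
Proof.
move=> /usumP aS e /aS[J hJ].
exists (\max_(i <- J) i).+1 => // n /= hn.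
rewrite /series /=.
have -> : \sum_(0 <= k < n) a k = \sum_(k <- seq_fset tt (iota 0 n)) a k.
  by rewrite (perm_big _ (perm_fset_iota n)) /index_iota subn0.
apply: hJ; apply/fsubsetP => i iJ; rewrite seq_fsetE mem_iota add0n /=.
by apply: leq_trans hn; rewrite ltnS; apply: leq_bigmax_seq.
Qed.

Lemma series_usum (a : nat -> R[i]) (S : R[i]) (M : R) :
  absum a M -> ccvg \oo (series a) S -> usum a S.
Proof.
move=> /absum_usum[S' aS' _] aS.
by rewrite (ccvg_unique aS (usum_series aS')).
Qed.

Lemma absum_mul (T1 T2 : choiceType) (a : T1 -> R[i]) (b : T2 -> R[i])
    (M N : R) :
  absum a M -> absum b N -> absum (fun p => a p.1 * b p.2) (M * N).
Proof.
move=> aM bN; apply: (@absum_prod _ _ _ (fun i => cmod (a i) * N)).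
  by move=> i; exact: (@absumZ _ _ b (a i) N bN).
by move=> K; rewrite -mulr_suml ler_wpM2r // (absum_ge0 bN).
Qed.

Lemma usum_mul (T1 T2 : choiceType) (a : T1 -> R[i]) (b : T2 -> R[i])
    (A B : R[i]) (M N : R) :
  absum a M -> absum b N -> usum a A -> usum b B ->
  usum (fun p => a p.1 * b p.2) (A * B).
Proof.
move=> aM bN aA bB; have abM := absum_mul aM bN.
have [S hS _] := absum_usum abM.
have hG : usum (fun i => a i * B) S.
  by apply: (usum_fubini abM hS) => i; exact: (@usumZ _ _ b B (a i) bB).
have hG' : usum (fun i => a i * B) (A * B).
  by rewrite mulrC; apply: eq_usum (@usumZ _ _ a A B aA) => i; rewrite mulrC.
by rewrite -(usum_unique hG hG').
Qed.

Definition cauchy_prod (a b : nat -> R[i]) (n : nat) : R[i] :=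
  \sum_(i < n.+1) a i * b (n - i)%N.

(** The injection (i, j) -> (i + j, i) makes the diagonal i + j = n the n-th row of a double family,
    so the row lemmas apply. *)
Lemma usum_cauchy_prod (a b : nat -> R[i]) (A B : R[i]) (M N : R) :
  absum a M -> absum b N -> usum a A -> usum b B ->
  usum (cauchy_prod a b) (A * B) /\ absum (cauchy_prod a b) (M * N).
Proof.
move=> aM bN aA bB.
pose f (p : nat * nat) := if (p.2 <= p.1)%N then a p.2 * b (p.1 - p.2)%N else 0.
pose h (p : nat * nat) := ((p.1 + p.2)%N, p.1).
have hi : injective h.
  by move=> [i j] [i' j'] [+ e]; rewrite /= e => /addnI ->.
have fh p : f (h p) = a p.1 * b p.2 by rewrite /f /= leq_addr addKn.
have f0 u : (forall t, h t <> u) -> f u = 0.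
  case: u => n i hu; rewrite /f /=; case: leqP => // le.
  by case: (hu (i, (n - i)%N)); rewrite /h /= subnKC.
have hS : usum f (A * B).
  apply/(usum_inj (A * B) hi f0); apply: eq_usum (usum_mul aM bN aA bB) => p.
  by rewrite /= fh.
have hM : absum f (M * N).
  move=> K; have [K' hK'] := preim_fset K hi.
  have sub : fsubset [fset h t | t in K']%fset K.
    by apply/fsubsetP => _ /imfsetP[t /= + ->]; rewrite hK'.
  rewrite (big_fset_subset _ sub) [X in _ + X]big1_seq ?addr0.
    rewrite sum_imfset //.
    by under eq_bigr do rewrite fh; exact: absum_mul.
  move=> u /andP[_]; rewrite !inE => /andP[/negP nu uK]; apply/eqP.
  rewrite cmod_eq0; apply/eqP; apply: f0 => t tu; apply: nu.
  by apply/imfsetP; exists t => //=; rewrite hK' tu.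
have rows n : usum (fun i => f (n, i)) (cauchy_prod a b n).
  have := @usum_fin R nat (fun i => f (n, i)) (seq_fset tt (iota 0 n.+1)).
  have -> : \sum_(i <- seq_fset tt (iota 0 n.+1)) f (n, i) = cauchy_prod a b n.
    rewrite (perm_big _ (perm_fset_iota n.+1)) /=.
    rewrite /cauchy_prod -[0%N :: iota 1 n]/(index_iota 0 n.+1) big_mkord.
    by apply: eq_bigr => i _; rewrite /f /= -ltnS ltn_ord.
  apply=> i; rewrite seq_fsetE mem_iota add0n /= /f /= ltnS.
  by case: leqP.
split; [exact: (usum_fubini hM hS rows)|exact: (absum_rows hM rows)].
Qed.

End Reindex.

(** * Power series and meromorphic functions *)

Section Analytic.
Variable R : realType.
Implicit Types (f g : R[i] -> R[i]) (s z : R[i]).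

Lemma near_cP s (P : R[i] -> Prop) :
  (\forall z \near (s : R[i]^o), P z) <->
  exists2 d : R, 0 < d & forall z, cmod (z - s) < d -> P z.
Proof.
split.
  move=> /nbhs_ballP[e /= e0 he].
  have eE : e = (complex.Re e)%:C.
    by case: e e0 {he} => a b; rewrite ltcE /= => /andP[/eqP-> _].
  exists (complex.Re e); first by rewrite -ltcR -eE.
  by move=> z zs; apply: he; rewrite /ball /= distrC cmodE eE ltcR.
move=> [d d0 hd]; apply/nbhs_ballP; exists d%:C; first by rewrite /= ltcR.
by move=> z; rewrite /ball /= distrC cmodE ltcR; exact: hd.
Qed.

Lemma near_dcP s (P : R[i] -> Prop) :
  (\forall z \near (s : R[i]^o)^', P z) <->
  exists2 d : R, 0 < d & forall z, z != s -> cmod (z - s) < d -> P z.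
Proof.
split=> [h|[d d0 hd]].
  have /near_cP[d d0 hd] : \forall z \near (s : R[i]^o), z != s -> P z by exact: h.
  by exists d => // z zs zd; apply: hd.
suff : \forall z \near (s : R[i]^o), z != s -> P z by [].
by apply/near_cP; exists d => // z zd zs; apply: hd.
Qed.

(* Analyticity with an absolutely convergent expansion on a closed disc; see
   [analytic_atP] for the equivalence with [analytic_at]. *)
Definition pan f s := exists (a : nat -> R[i]) (r M : R),
  [/\ 0 < r, absum (fun k => a k * r%:C ^+ k) M &
      forall z, cmod (z - s) <= r -> usum (fun k => a k * (z - s) ^+ k) (f z)].

Lemma absum_pow (a : nat -> R[i]) (r M : R) (w : R[i]) :
  0 <= r -> absum (fun k => a k * r%:C ^+ k) M -> cmod w <= r ->
  absum (fun k => a k * w ^+ k) M.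
Proof.
move=> r0 aM wr; apply: absum_le aM => k.
rewrite !cmodM !cmodX cmod_real ger0_norm // ler_wpM2l ?cmod_ge0 //.
by rewrite lerXn2r ?nnegrE ?cmod_ge0.
Qed.

Lemma absum_geo (q C : R) (a : nat -> R[i]) : 0 <= q -> q < 1 ->
  (forall k, cmod (a k) <= C * q ^+ k) -> absum a (C / (1 - q)).
Proof.
move=> q0 q1 aC K.
have C0 : 0 <= C by have := le_trans (cmod_ge0 _) (aC 0%N); rewrite expr0 mulr1.
pose N := (\max_(i <- K) i).+1.
apply: (@le_trans _ _ (\sum_(0 <= k < N) C * q ^+ k)).
  apply: (@le_trans _ _ (\sum_(k <- K) C * q ^+ k)); first exact: ler_sum.
  have sub : fsubset K (seq_fset tt (iota 0 N)).
    apply/fsubsetP => i iK; rewrite seq_fsetE mem_iota add0n /= ltnS.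
    exact: leq_bigmax_seq.
  have -> : \sum_(0 <= k < N) C * q ^+ k =
            \sum_(k <- seq_fset tt (iota 0 N)) C * q ^+ k.
    by rewrite (perm_big _ (perm_fset_iota N)) /index_iota subn0.
  rewrite (big_fset_subset _ sub) lerDl; apply: sumr_ge0 => i _.
  by rewrite mulr_ge0 // exprn_ge0.
rewrite -mulr_sumr; apply: ler_wpM2l => //.
rewrite -div1r ler_pdivlMr ?subr_gt0 // big_mkord.
have := subrX1 q N; rewrite -opprB => /(congr1 -%R); rewrite opprK => e.
by rewrite mulrC -(opprB q 1) mulNr -e gerBl exprn_ge0.
Qed.

Lemma absum_int_geo (q C : R) (f : int -> R[i]) : 0 <= q -> q < 1 ->
  (forall n, cmod (f n) <= C * q ^+ `|n|%N) -> exists M, absum f M.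
Proof.
move=> q0 q1 fC; exists (C / (1 - q) + C * q / (1 - q)); apply: absum_int.
  by apply: absum_geo => // k /=; exact: fC.
by apply: absum_geo => // k /=; rewrite -mulrA -exprS; exact: (fC (Negz k)).
Qed.

(** Convergence at one point at distance [p] bounds the terms there, so on the disc of radius p/2 a
    geometric series of ratio 1/2 dominates. *)
Lemma analytic_atP f s : analytic_at f s <-> pan f s.
Proof.
split; last first.
  move=> [a [r [M [r0 aM fa]]]]; exists a; apply/near_cP; exists r => // z zr.
  by apply/ccvgP/usum_series/fa/ltW.
move=> [a] /near_cP[d d0 hd].
pose p := d / 2; have p0 : 0 < p by rewrite divr_gt0.
have pd : p < d by rewrite ltr_pdivrMr // ltr_pMr // ltr1n.
have /ccvgP hp : series (fun k => a k * ((s + p%:C) - s) ^+ k) @ \oo -->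
    (f (s + p%:C) : R[i]^o).
  by apply: hd; rewrite addrAC subrr add0r cmod_real gtr0_norm.
(* From [N] on, a term is the difference of two partial sums within 1 of the limit; the finitely
   many earlier terms are added to the bound. *)
have [C hC] : exists C, forall k, cmod (a k * p%:C ^+ k) <= C.
  have [N _ hN] := hp 1 ltr01.
  exists (2 + \sum_(k < N) cmod (a k * p%:C ^+ k)) => k.
  have S0 : 0 <= \sum_(k < N) cmod (a k * p%:C ^+ k).
    by apply: sumr_ge0 => i _; exact: cmod_ge0.
  have [kN|Nk] := ltnP k N.
    rewrite (bigD1 (Ordinal kN)) //= addrCA lerDl addr_ge0 //.
    by apply: sumr_ge0 => i _; exact: cmod_ge0.
  have h1 := hN k Nk; have h2 := hN k.+1 (leqW Nk).
  rewrite /= in h1 h2.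
  have -> : a k * p%:C ^+ k =
     (series (fun k => a k * ((s + p%:C) - s) ^+ k) k.+1 - f (s + p%:C)) -
     (series (fun k => a k * ((s + p%:C) - s) ^+ k) k - f (s + p%:C)).
    rewrite !seriesEnat /= big_nat_recr //= [s + _]addrC addrK.
    by rewrite opprB addrA subrK addrAC subrr add0r.
  apply: le_trans (cmodB _ _) _; move: S0 h1 h2; lra.
pose r := p / 2; have r0 : 0 < r by rewrite divr_gt0.
have aM : absum (fun k => a k * r%:C ^+ k) (C / (1 - 2^-1)).
  apply: absum_geo; rewrite ?invr_ge0 ?invf_lt1 ?ltr1n // => k.
  have -> : a k * r%:C ^+ k = (a k * p%:C ^+ k) * (2^-1)%:C ^+ k.
    by rewrite -mulrA -exprMn -rmorphM.
  rewrite cmodM cmodX cmod_real ger0_norm ?invr_ge0 //.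
  by rewrite ler_wpM2r ?exprn_ge0 ?invr_ge0.
exists a, r, (C / (1 - 2^-1)); split => // z zr.
apply: series_usum (absum_pow (ltW r0) aM zr) _.
apply/ccvgP; apply: hd; apply: le_lt_trans zr _; apply: lt_trans pd.
by rewrite ltr_pdivrMr // ltr_pMr // ltr1n.
Qed.

(** Brings the expansions of two functions to a common disc. *)
Lemma pan_shrink f s (d : R) : pan f s -> 0 < d ->
  exists (a : nat -> R[i]) (r M : R),
  [/\ 0 < r, r < d, absum (fun k => a k * r%:C ^+ k) M &
      forall z, cmod (z - s) <= r -> usum (fun k => a k * (z - s) ^+ k) (f z)].
Proof.
move=> [a [r [M [r0 aM fa]]]] d0.
exists a, (Num.min r (d / 2)), M; split.
- by rewrite lt_min r0 divr_gt0.
- by rewrite gt_min ltr_pdivrMr // ltr_pMr // ltr1n orbT.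
- have m0 : 0 <= Num.min r (d / 2) by rewrite le_min (ltW r0) divr_ge0 // ltW.
  apply: (absum_pow (ltW r0) aM); rewrite cmod_real ger0_norm //.
  by rewrite ge_min lexx.
- by move=> z; rewrite le_min => /andP[zr _]; exact: fa.
Qed.

Lemma pan_ext f g s (d : R) : 0 < d ->
  (forall z, cmod (z - s) < d -> f z = g z) -> pan f s -> pan g s.
Proof.
move=> d0 fg /pan_shrink/(_ d0)[a [r [M [r0 rd aM fa]]]].
exists a, r, M; split => // z zr; rewrite -fg; first exact: fa.
exact: le_lt_trans zr rd.
Qed.

Lemma pan_comp f s (u v : R[i]) :
  pan f (u * s + v) -> pan (fun z => f (u * z + v)) s.
Proof.
move=> [a [r [M [r0 aM fa]]]].
have u1 : 0 < cmod u + 1 by rewrite ltr_wpDl ?cmod_ge0.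
pose r' := r / (cmod u + 1).
have r'0 : 0 < r' by rewrite divr_gt0.
have ur w : cmod w <= r' -> cmod (u * w) <= r.
  move=> wr; rewrite cmodM; apply: le_trans (ler_wpM2l (cmod_ge0 u) wr) _.
  rewrite mulrCA ger_pMr // ler_pdivrMr // mul1r lerDl; exact: ler01.
exists (fun k => a k * u ^+ k), r', M; split; first exact: r'0.
  have h : cmod (u * r'%:C) <= r by apply: ur; rewrite cmod_real gtr0_norm.
  by apply: absum_le (absum_pow (ltW r0) aM h) => k; rewrite exprMn mulrA.
move=> z zr; have e : u * z + v - (u * s + v) = u * (z - s).
  by rewrite opprD addrACA subrr addr0 mulrBr.
have := fa (u * z + v); rewrite e => /(_ (ur _ zr)).
by apply: eq_usum => k; rewrite exprMn mulrA.
Qed.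

Lemma pan_cst s (c : R[i]) : pan (fun=> c) s.
Proof.
pose a k : R[i] := if k == 0%N then c else 0.
have a0 z k : k \notin [fset 0%N]%fset -> a k * z ^+ k = 0.
  by rewrite inE => /negPf n0; rewrite /a n0 mul0r.
exists a, 1, (\sum_(k <- [fset 0%N]%fset) cmod (a k * 1%:C ^+ k)); split => //.
  exact: absum_fin (a0 _).
move=> z _; have := usum_fin (a0 (z - s)).
by rewrite big_seq_fset1 /a eqxx mulr1.
Qed.

Lemma pan_id s : pan id s.
Proof.
pose a k : R[i] := if k == 0%N then s else if k == 1%N then 1 else 0.
have a0 z k : k \notin [fset 0%N; 1%N]%fset -> a k * z ^+ k = 0.
  by rewrite !inE negb_or => /andP[/negPf n0 /negPf n1]; rewrite /a n0 n1 mul0r.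
exists a, 1, (\sum_(k <- [fset 0%N; 1%N]%fset) cmod (a k * 1%:C ^+ k)); split => //.
  exact: absum_fin (a0 _).
move=> z _; have := usum_fin (a0 (z - s)).
rewrite big_fsetU1 ?inE //= big_seq_fset1 /a eqxx mulr1 /= mul1r expr1.
by rewrite addrC subrK.
Qed.

Lemma panD f g s : pan f s -> pan g s -> pan (fun z => f z + g z) s.
Proof.
move=> fs /[dup] gs [b0 [d [M0 [d0 _ _]]]].
have [a [r [M [r0 rd aM fa]]]] := pan_shrink fs d0.
have [b [r' [N [r'0 r'r bN gb]]]] := pan_shrink gs r0.
exists (fun k => a k + b k), r', (M + N); split => //.
  have ar : absum (fun k => a k * r'%:C ^+ k) M.
    by apply: (absum_pow (ltW r0) aM); rewrite cmod_real gtr0_norm // ltW.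
  by apply: absum_le (absumD ar bN) => k; rewrite mulrDl.
move=> z zr; apply: eq_usum (usumD (fa z _) (gb z zr)).
  by move=> k; rewrite mulrDl.
exact: le_trans zr (ltW r'r).
Qed.

Lemma cauchy_prod_pow (a b : nat -> R[i]) (w : R[i]) n :
  cauchy_prod (fun k => a k * w ^+ k) (fun k => b k * w ^+ k) n =
  cauchy_prod a b n * w ^+ n.
Proof.
rewrite /cauchy_prod mulr_suml; apply: eq_bigr => i _.
by rewrite mulrACA -exprD subnKC // -ltnS.
Qed.

Lemma panM f g s : pan f s -> pan g s -> pan (fun z => f z * g z) s.
Proof.
move=> fs /[dup] gs [b0 [d [M0 [d0 _ _]]]].
have [a [r [M [r0 rd aM fa]]]] := pan_shrink fs d0.
have [b [r' [N [r'0 r'r bN gb]]]] := pan_shrink gs r0.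
have ar : absum (fun k => a k * r'%:C ^+ k) M.
  by apply: (absum_pow (ltW r0) aM); rewrite cmod_real gtr0_norm // ltW.
exists (cauchy_prod a b), r', (M * N); split => //.
  have [A hA _] := absum_usum ar; have [B hB _] := absum_usum bN.
  have [_] := usum_cauchy_prod ar bN hA hB.
  by apply: absum_le => k; rewrite cauchy_prod_pow.
move=> z zr; have zr' := le_trans zr (ltW r'r).
have [+ _] := usum_cauchy_prod (absum_pow (ltW r0) aM zr')
  (absum_pow (ltW r'0) bN zr) (fa z zr') (gb z zr).
by apply: eq_usum => k; rewrite cauchy_prod_pow.
Qed.

Lemma panZ f s (c : R[i]) : pan f s -> pan (fun z => c * f z) s.
Proof. exact: panM (pan_cst s c). Qed.

Lemma panB f g s : pan f s -> pan g s -> pan (fun z => f z - g z) s.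
Proof.
move=> fs gs; apply: (@pan_ext (fun z => f z + -1 * g z) _ s 1) => //.
  by move=> z _; rewrite mulN1r.
exact: panD fs (panZ (-1) gs).
Qed.

Lemma pan_prod (I : Type) (r : seq I) (f : I -> R[i] -> R[i]) s :
  (forall i, pan (f i) s) -> pan (fun z => \prod_(i <- r) f i z) s.
Proof.
move=> fs; elim: r => [|i r IH].
  by apply: (pan_ext ltr01 _ (pan_cst s 1)) => z _; rewrite big_nil.
by apply: (pan_ext ltr01 _ (panM (fs i) IH)) => z _; rewrite big_cons.
Qed.

Lemma panX f s n : pan f s -> pan (fun z => f z ^+ n) s.
Proof.
move=> fs; elim: n => [|n IH]; first exact: pan_cst.
by apply: (pan_ext ltr01 _ (panM fs IH)) => z _; rewrite exprS.
Qed.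

Lemma pan_affine (u v : R[i]) s : pan (fun z => u * z + v) s.
Proof. exact: panD (panZ _ (pan_id s)) (pan_cst s v). Qed.

(** Coefficients of the reciprocal of a power series with constant term 1. Each involves all earlier
    ones, so the recursion carries their list, latest first. *)
Fixpoint inv_coef_rev (c : nat -> R[i]) (n : nat) : seq R[i] :=
  if n is m.+1 then
    let l := inv_coef_rev c m in
    - \sum_(j < m.+1) c j.+1 * nth 0 l j :: l
  else [:: 1].

Definition inv_coef (c : nat -> R[i]) (n : nat) := head 0 (inv_coef_rev c n).

Lemma nth_inv_coef_rev c n j : (j <= n)%N ->
  nth 0 (inv_coef_rev c n) j = inv_coef c (n - j).
Proof.
elim: n j => [|n IH] [|j] //= jn.
by rewrite IH // subSS.
Qed.

Lemma inv_coefS c n :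
  inv_coef c n.+1 = - \sum_(j < n.+1) c j.+1 * inv_coef c (n - j).
Proof.
rewrite {1}/inv_coef /=; congr (- _); apply: eq_bigr => j _.
by rewrite nth_inv_coef_rev // -ltnS.
Qed.

(** By strong induction the recurrence gives Q^(k+1) times 2^0 + ... + 2^k, and that sum is below
    2^(k+1). *)
Lemma inv_coef_bound (c : nat -> R[i]) (Q : R) : 0 <= Q ->
  (forall k, cmod (c k.+1) <= Q ^+ k.+1) ->
  forall k, cmod (inv_coef c k) <= (2 * Q) ^+ k.
Proof.
move=> Q0 cQ; elim/ltn_ind => -[_|k IH].
  by rewrite expr0 /inv_coef /= cmod1.
rewrite inv_coefS cmodN; apply: le_trans (cmod_sum _ _) _.
apply: (@le_trans _ _ (\sum_(j < k.+1) Q ^+ k.+1 * 2 ^+ (k - j))).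
  apply: ler_sum => j _; rewrite cmodM.
  have jk : (j <= k)%N by rewrite -ltnS.
  apply: le_trans (ler_pM (cmod_ge0 _) (cmod_ge0 _) (cQ _) (IH _ _)) _.
    by rewrite ltnS leq_subr.
  by rewrite exprMn mulrCA -exprD addSn subnKC // mulrC.
rewrite -mulr_sumr exprMn mulrC ler_wpM2r ?exprn_ge0 //.
rewrite (reindex_inj rev_ord_inj) /=.
under eq_bigr => j _ do rewrite subSS subKn -1?ltnS //.
have := subrX1 (2 : R) k.+1; rewrite (_ : 2 - 1 = 1) ?mul1r; last by ring.
by move=> <-; rewrite gerBl.
Qed.

(** The series is normalized to constant term 1 and inverted formally. On a small disc the Cauchy
    product identity then shows that f does not vanish and that the formal inverse sums to f s / f
    z. *)
Lemma panV f s : pan f s -> f s != 0 -> pan (fun z => (f z)^-1) s.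
Proof.
move=> [a [r [M [r0 aM fa]]]] fs0.
have a0 : a 0%N = f s.
  have := fa s; rewrite subrr cmod0 => /(_ (ltW r0)) h.
  have := @usum_fin R nat (fun k => a k * 0 ^+ k) [fset 0%N]%fset.
  rewrite big_seq_fset1 mulr1 => h'; apply: (usum_unique (h' _) h) => i.
  by rewrite inE expr0n => /negPf->; rewrite mulr0.
have M0 : 0 <= M := absum_ge0 aM.
pose c k := (f s)^-1 * a k.
(* At least 1, so that M' <= M'^(k+1) and the bound M' / r^(k+1) becomes the power Q^(k+1) required
   by [inv_coef_bound]. *)
pose M' := Num.max 1 (cmod (f s)^-1 * M).
have M'1 : 1 <= M' by rewrite le_max lexx.
pose Q := M' / r.
have Q0 : 0 < Q by rewrite divr_gt0 // (lt_le_trans ltr01).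
have cQ k : cmod (c k.+1) <= Q ^+ k.+1.
  rewrite /Q expr_div_n ler_pdivlMr ?exprn_gt0 //.
  apply: (@le_trans _ _ M'); last by rewrite exprS ler_peMr ?exprn_ege1 // (le_trans ler01).
  rewrite /c cmodM -mulrA le_max; apply/orP; right.
  rewrite ler_wpM2l ?cmod_ge0 //.
  have := aM [fset k.+1]%fset; rewrite big_seq_fset1 cmodM cmodX cmod_real.
  by rewrite gtr0_norm.
have bQ := inv_coef_bound (ltW Q0) cQ.
pose b := inv_coef c.
(* The inverse has coefficients at most (2Q)^k, so radius 1/(4Q) yields ratio 1/2. *)
pose r' := Num.min r (4 * Q)^-1.
have r'0 : 0 < r' by rewrite lt_min r0 invr_gt0 mulr_gt0.
have bM : absum (fun k => b k * r'%:C ^+ k) (1 / (1 - 2^-1)).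
  apply: absum_geo; rewrite ?invr_ge0 ?invf_lt1 ?ltr1n // => k.
  rewrite cmodM cmodX cmod_real gtr0_norm // mul1r.
  apply: le_trans (ler_wpM2r _ (bQ k)) _; first by rewrite exprn_ge0 // ltW.
  have nn : 0 <= 2 * Q * r' by apply: mulr_ge0 (ltW r'0); apply: mulr_ge0 (ltW Q0).
  rewrite -exprMn lerXn2r ?nnegrE ?invr_ge0 //.
  have : r' <= (4 * Q)^-1 by rewrite ge_min lexx orbT.
  move=> h; apply: le_trans (ler_wpM2l (ltW (mulr_gt0 (ltr0n R 2) Q0)) h) _.
  by rewrite invfM mulrACA divff ?gt_eqF // mulr1; lra.
have cM : absum (fun k => c k * r'%:C ^+ k) (cmod (f s)^-1 * M).
  have rr : cmod r'%:C <= r by rewrite cmod_real gtr0_norm // ge_min lexx.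
  apply: absum_le (absumZ (f s)^-1 (absum_pow (ltW r0) aM rr)) => k.
  by rewrite /c mulrA.
have cb z : cmod (z - s) <= r' -> usum (fun k => b k * (z - s) ^+ k) (f s / f z).
  move=> zr; have zr' : cmod (z - s) <= r.
    by apply: le_trans zr _; rewrite ge_min lexx.
  have hc : usum (fun k => c k * (z - s) ^+ k) ((f s)^-1 * f z).
    by apply: eq_usum (usumZ (f s)^-1 (fa z zr')) => k; rewrite /c mulrA.
  have bz := absum_pow (ltW r'0) bM zr.
  have cz := absum_pow (ltW r'0) cM zr.
  have [B hB _] := absum_usum bz.
  have [h _] := usum_cauchy_prod cz bz hc hB.
  have cp k : cauchy_prod c b k = if k == 0%N then 1 else 0.
    have c0 : c 0%N = 1 by rewrite /c a0 mulVf.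
    case: k => [|k]; first by rewrite /cauchy_prod big_ord1 c0 mul1r.
    rewrite /cauchy_prod big_ord_recl /= subn0 c0 mul1r /b inv_coefS.
    under [X in _ + X]eq_bigr do rewrite /bump /= add1n subSS.
    by rewrite addNr.
  have h1 : usum (cauchy_prod (fun k => c k * (z - s) ^+ k)
     (fun k => b k * (z - s) ^+ k)) 1.
    have := @usum_fin R nat (fun k => cauchy_prod c b k * (z - s) ^+ k) [fset 0%N]%fset.
    rewrite big_seq_fset1 mulr1 cp eqxx => h1.
    apply: eq_usum (h1 _) => k; first by rewrite cauchy_prod_pow.
    by rewrite inE cp => /negPf->; rewrite mul0r.
  have e := usum_unique h h1.
  suff -> : f s / f z = B by [].
  have fz0 : f z != 0.
    by apply/eqP => fz; move: e; rewrite fz mulr0 mul0r => /esym/eqP; rewrite oner_eq0.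
  by rewrite -[LHS]mulr1 -e; field; rewrite fz0 fs0.
apply: (@pan_ext (fun z => (f s)^-1 * (f s / f z)) _ s 1) => //.
  by move=> z _; rewrite mulKf.
by apply: panZ; exists b, r', (1 / (1 - 2^-1)).
Qed.

(** If [a k] is the first nonzero coefficient, then at a zero at distance w the term |a k| w^k
    equals the modulus of the remaining terms, at most (w/r)^(k+1) M. Hence w cannot be arbitrarily
    small. *)
Lemma pan_zeros f s : pan f s ->
  (forall d : R, 0 < d -> exists z, [/\ z != s, cmod (z - s) < d & f z = 0]) ->
  exists2 d : R, 0 < d & forall z, cmod (z - s) < d -> f z = 0.
Proof.
move=> [a [r [M [r0 aM fa]]]] hz.
suff a0 k : a k = 0.
  exists r => // z /ltW zr; apply: usum_unique (fa z zr) _.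
  by apply: eq_usum (@usum_ext0 R nat) => k; rewrite a0 mul0r.
elim/ltn_ind: k => k IH; apply/eqP; rewrite -cmod_eq0 eq_le cmod_ge0 andbT.
rewrite leNgt; apply/negP => ak0.
have M0 : 0 <= M := absum_ge0 aM.
(* Below this distance (w/r)^(k+1) M is less than |a k| w^k; using M + 1 keeps the denominator
   positive. *)
pose d := Num.min r (cmod (a k) * r ^+ k.+1 / (M + 1)).
have M1 : 0 < M + 1 by rewrite ltr_wpDl.
have d0 : 0 < d by rewrite lt_min r0 divr_gt0 // mulr_gt0 // exprn_gt0.
have [z [zs zd fz]] := hz d d0.
have w0 : 0 < cmod (z - s) by rewrite cmod_gt0 subr_eq0.
move: zd; rewrite lt_min => /andP[zr zd].
have h := fa z (ltW zr).
have hk : usum (fun j => if j == k then a k * (z - s) ^+ k else 0) (a k * (z - s) ^+ k).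
  have := @usum_fin R nat (fun j => if j == k then a k * (z - s) ^+ k else 0) [fset k]%fset.
  rewrite big_seq_fset1 eqxx; apply=> j; by rewrite inE => /negPf->.
have := usumB h hk; rewrite fz sub0r => hB.
have : cmod (a k * (z - s) ^+ k) <= (cmod (z - s) / r) ^+ k.+1 * M.
  rewrite -cmodN; apply: (usum_cmod_le hB).
  have q0 : 0 <= cmod (z - s) / r by rewrite divr_ge0 ?ltW.
  have := absumZ (((cmod (z - s) / r)%:C) ^+ k.+1) aM.
  rewrite cmodX cmod_real ger0_norm //; apply: absum_le => j.
  case: eqP => [->|/eqP jk]; first by rewrite subrr cmod0 cmod_ge0.
  rewrite subr0; case: (ltngtP j k) jk => // jk _.
    by rewrite IH // !mul0r mulr0 cmod0.
  rewrite !cmodM !cmodX !cmod_real ger0_norm // (gtr0_norm r0).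
  rewrite mulrCA ler_wpM2l ?cmod_ge0 //.
  rewrite -(subnKC jk) !exprD mulrA -exprMn mulfVK ?gt_eqF //.
  rewrite ler_wpM2l ?exprn_ge0 ?cmod_ge0 //.
  by rewrite lerXn2r ?nnegrE ?cmod_ge0 ?ltW.
apply/negP; rewrite -ltNge cmodM cmodX expr_div_n exprS -mulrA.
move: zd; rewrite ltr_pdivlMr // => zd.
have rk : 0 < r ^+ k.+1 by rewrite exprn_gt0.
have wk : 0 < cmod (z - s) ^+ k by rewrite exprn_gt0.
set w := cmod (z - s) in w0 zr zd wk *; set rk1 := r ^+ k.+1 in rk zd *.
have -> : w * (w ^+ k / rk1) * M = w ^+ k * (w * M / rk1) by ring.
rewrite [X in _ < X]mulrC ltr_pM2l // ltr_pdivrMr //.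
by apply: le_lt_trans zd; rewrite ler_wpM2l ?ltW // ltrDl.
Qed.

Definition mero f s := exists (N : nat) (g : R[i] -> R[i]) (d : R),
  [/\ 0 < d, pan g s & forall z, z != s -> cmod (z - s) < d ->
    f z * (z - s) ^+ N = g z].

Lemma meromorphic_atP f s : meromorphic_at f s <-> mero f s.
Proof.
split.
  move=> [N [g [/analytic_atP gs /near_dcP[d d0 hd]]]].
  exists N, g, d; split => // z zs zd.
  by rewrite hd // mulfVK // expf_neq0 // subr_eq0.
move=> [N [g [d [d0 gs hd]]]]; exists N, g; split; first exact/analytic_atP.
apply/near_dcP; exists d => // z zs zd; rewrite -hd // mulfK //.
by rewrite expf_neq0 // subr_eq0.
Qed.

Lemma meroB f g s : mero f s -> mero g s -> mero (fun z => f z - g z) s.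
Proof.
move=> [N [u [d [d0 us hd]]]] [N' [v [d' [d'0 vs hd']]]].
exists (N + N')%N, (fun z => u z * (z - s) ^+ N' - v z * (z - s) ^+ N), (Num.min d d').
split; first by rewrite lt_min d0.
  have zs : pan (fun z => z - s) s by exact: panB (pan_id s) (pan_cst s s).
  by apply: panB; apply: panM => //; apply: panX.
move=> z zs; rewrite lt_min => /andP[zd zd'].
by rewrite -hd // -hd' // mulrBl exprD; congr (_ - _); ring.
Qed.

Lemma mero_zero f s : mero f s ->
  (forall d : R, 0 < d -> exists z, [/\ z != s, cmod (z - s) < d & f z = 0]) ->
  exists2 d : R, 0 < d & forall z, z != s -> cmod (z - s) < d -> f z = 0.
Proof.
move=> [N [g [d [d0 gs hd]]]] hz.
have [|d' d'0 hg] := pan_zeros gs.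
  move=> e e0; have [|z [zs ze fz]] := hz (Num.min e d); first by rewrite lt_min e0.
  move: ze; rewrite lt_min => /andP[ze zd]; exists z; split => //.
  by rewrite -hd // fz mul0r.
exists (Num.min d d'); first by rewrite lt_min d0.
move=> z zs; rewrite lt_min => /andP[zd /hg gz].
have := hd z zs zd; rewrite gz => /eqP; rewrite mulf_eq0 expf_eq0 subr_eq0.
by rewrite (negPf zs) andbF orbF => /eqP.
Qed.

(* The set where f vanishes nearby is propagated along a segment that reaches
   the half-plane. *)
Lemma mero_identity f (c : R) : (forall s, mero f s) ->
  (forall z, c < complex.Re z -> f z = 0) ->
  forall s, exists2 d : R, 0 < d & forall z, z != s -> cmod (z - s) < d -> f z = 0.
Proof.
move=> fm fc s1.
pose P s := exists2 d : R, 0 < d & forall z, z != s -> cmod (z - s) < d -> f z = 0.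
have Pclosed s : (forall e : R, 0 < e -> exists2 p, cmod (p - s) < e & P p) -> P s.
  move=> hs; apply: mero_zero (fm s) _ => e e0.
  have [p pe [d d0 hd]] := hs (e / 2) (divr_gt0 e0 (ltr0n R 2)).
  (* Both p + q and p + q/2 are zeros near [s]; at most one of them equals [s], so the other
     serves. *)
  pose q := Num.min d e / 4.
  have m0 : 0 < Num.min d e by rewrite lt_min d0.
  have q0 : 0 < q by rewrite divr_gt0.
  have qd : 2 * q < d by apply: (@lt_le_trans _ _ (Num.min d e));
    [rewrite /q; lra|rewrite ge_min lexx].
  have qe : 2 * q <= e / 2 by apply: (@le_trans _ _ (Num.min d e / 2));
    [rewrite /q; lra|rewrite ler_pM2r ?invr_gt0 // ge_min lexx orbT].
  have two (t : R) : 0 < t -> t < d -> p + t%:C != s -> t < e / 2 ->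
      exists z, [/\ z != s, cmod (z - s) < e & f z = 0].
    move=> t0 td ts te; exists (p + t%:C); split => //.
      have -> : p + t%:C - s = (p - s) + t%:C by ring.
      by apply: le_lt_trans (cmodD _ _) _; rewrite cmod_real gtr0_norm // [e]splitr ltrD.
    apply: hd; last by rewrite addrAC subrr add0r cmod_real gtr0_norm.
    rewrite -subr_eq0 addrAC subrr add0r.
    by rewrite -[0]/((0 : R)%:C) (inj_eq (@complexI R)) gt_eqF.
  have [e1|e1] := eqVneq (p + q%:C) s; last by apply: (two q) => //; lra.
  apply: (two (q / 2)); rewrite ?divr_gt0 //; try lra.
  rewrite -e1 (inj_eq (addrI p)) (inj_eq (@complexI R)).
  by apply/eqP; lra.
have Popen s : P s -> exists2 e : R, 0 < e & forall p, cmod (p - s) < e -> P p.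
  move=> [d d0 hd]; exists d => // p pd.
  have [->|ps] := eqVneq p s; first by exists d.
  have l0 : 0 < cmod (p - s) by rewrite cmod_gt0 subr_eq0.
  exists (Num.min (cmod (p - s)) (d - cmod (p - s))).
    by rewrite lt_min l0 subr_gt0.
  move=> z zp; rewrite lt_min => /andP[z1 z2]; apply: hd.
    by apply/eqP => zs; move: z1; rewrite zs cmodC ltxx.
  have -> : z - s = (z - p) + (p - s) by ring.
  by apply: le_lt_trans (cmodD _ _) _; rewrite -ltrBrDr.
(* The unit disc around this point lies in the half-plane where f vanishes. *)
pose s0 : R[i] := (c + 1)%:C.
have Ps0 : P s0.
  exists 1 => // z _; rewrite cmodC => zd; apply: fc.
  have := le_lt_trans (le_trans (ler_norm _) (cmod_Re _)) zd.
  by case: (z) => a b /=; lra.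
pose pt (t : R) := s0 + t%:C * (s1 - s0).
have ptd t u : cmod (pt t - pt u) = `|t - u| * cmod (s1 - s0).
  rewrite /pt opprD addrACA subrr add0r -mulrBl -rmorphB /= cmodM cmod_real //.
pose L := cmod (s1 - s0) + 1.
have L0 : 0 < L by rewrite ltr_wpDl ?cmod_ge0.
have ptL t u (e : R) : `|t - u| < e / L -> cmod (pt t - pt u) < e.
  move=> h; rewrite ptd; apply: (@le_lt_trans _ _ (`|t - u| * L)).
    by rewrite ler_wpM2l // lerDl.
  by rewrite -ltr_pdivlMr.
(* Parameters whose whole initial segment has the property: [Pclosed] gives it to the supremum, and
   [Popen] moves past the supremum unless it is 1. *)
pose A := [set t : R | 0 <= t <= 1 /\ forall u, 0 <= u <= t -> P (pt u)].
have A0 : A 0.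
  split=> [|u]; first by rewrite lexx ler01.
  by rewrite -eq_le => /eqP<-; rewrite /pt mul0r addr0.
have supA : has_sup A.
  by split; [exists 0|exists 1 => t [/andP[]]].
pose tau := sup A.
have t0 : 0 <= tau by exact: sup_upper_bound.
have t1 : tau <= 1 by apply: ge_sup => [|t [/andP[]]//]; exists 0.
have below u : 0 <= u -> u < tau -> P (pt u).
  move=> u0; rewrite -subr_gt0 => ut; have [t [_ At] tu] := sup_adherent ut supA.
  by apply: At; rewrite u0 /=; move: tu; rewrite -/tau; lra.
have Ptau : P (pt tau).
  apply: Pclosed => e e0; have eL : 0 < e / L by rewrite divr_gt0.
  have [t00|tp] := eqVneq tau 0.
    exists (pt tau); first by rewrite subrr cmod0.
    by rewrite t00; apply: A0.2; rewrite lexx.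
  have tau0 : 0 < tau by rewrite lt_def tp t0.
  pose m := Num.min tau (e / L).
  have m0 : 0 < m by rewrite lt_min tau0.
  have mt : m <= tau by rewrite ge_min lexx.
  have me : m <= e / L by rewrite ge_min lexx orbT.
  exists (pt (tau - m / 2)); last by apply: below; lra.
  by apply: ptL; rewrite addrAC subrr add0r normrN gtr0_norm; lra.
have Pall u : 0 <= u <= tau -> P (pt u).
  move=> /andP[u0]; rewrite le_eqVlt => /orP[/eqP-> //|]; exact: below.
have tau1 : tau = 1.
  apply/eqP; rewrite eq_le t1 leNgt; apply/negP => tlt.
  have [e e0 he] := Popen _ Ptau.
  have eL : 0 < e / L by rewrite divr_gt0.
  pose m := Num.min (1 - tau) (e / L / 2).
  have m0 : 0 < m by rewrite lt_min subr_gt0 tlt divr_gt0.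
  have mt : m <= 1 - tau by rewrite ge_min lexx.
  have me : m <= e / L / 2 by rewrite ge_min lexx orbT.
  suff : A (tau + m) by move=> /(sup_upper_bound supA); rewrite -/tau; lra.
  split; first by apply/andP; split; lra.
  move=> u /andP[u0 ut]; have [ult|ugt] := leP u tau; first by apply: Pall; rewrite u0.
  by apply/he/ptL; rewrite gtr0_norm; lra.
have := Pall 1; rewrite tau1 ler01 lexx => /(_ isT).
by rewrite /pt mul1r addrC subrK.
Qed.

(** The identity theorem gives equality only off [s]; analyticity of both functions at [s] extends
    it to the value there, which [mero] leaves free. *)
Lemma mero_unique f g (c : R) (s : R[i]) :
  (forall s, mero f s) -> (forall s, mero g s) ->
  (forall z, c < complex.Re z -> f z = g z) -> pan f s -> pan g s -> f s = g s.
Proof.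
move=> fm gm fg fs gs.
have [d d0 hd] : exists2 d : R, 0 < d &
    forall z, z != s -> cmod (z - s) < d -> f z - g z = 0.
  apply: (@mero_identity _ c) => [z|z zc]; first exact: meroB.
  by rewrite fg // subrr.
have [|d' d'0 hd'] := pan_zeros (panB fs gs).
  move=> e e0; pose q := Num.min d e / 2.
  have m0 : 0 < Num.min d e by rewrite lt_min d0.
  have q0 : 0 < q by rewrite divr_gt0.
  have qm : q < Num.min d e by rewrite ltr_pdivrMr // ltr_pMr // ltr1n.
  move: qm; rewrite lt_min => /andP[qd qe].
  have zs : s + q%:C != s.
    by rewrite -subr_eq0 addrAC subrr add0r -[0]/((0 : R)%:C) (inj_eq (@complexI R)) gt_eqF.
  exists (s + q%:C); split => //.
    by rewrite addrAC subrr add0r cmod_real gtr0_norm.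
  by apply: hd => //; rewrite addrAC subrr add0r cmod_real gtr0_norm.
by apply/eqP; rewrite -subr_eq0 hd' // subrr cmod0.
Qed.

End Analytic.

(** * The one-dimensional theta function *)

Section Phase.
Variable R : realType.
Implicit Types (z w : R[i]).

Lemma cexpD z w : cexp (z + w) = cexp z * cexp w.
Proof.
case: z w => a b [c d]; rewrite /cexp /= expRD cosD sinD rmorphM /=.
by rewrite mulrACA; congr (_ * _); apply/eqP; rewrite eq_complex /= eqxx addrC eqxx.
Qed.

Lemma cexp0 : cexp 0 = 1 :> R[i].
Proof. by rewrite /cexp /= expR0 cos0 sin0 mul1r. Qed.

Lemma cmod_cis (t : R) : cmod (cos t +i* sin t) = 1.
Proof. by rewrite /cmod normc_def /= cos2Dsin2 sqrtr1. Qed.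

Lemma cmod_cexp z : cmod (cexp z) = expR (complex.Re z).
Proof. by rewrite /cexp cmodM cmod_cis mulr1 cmod_real ger0_norm ?expR_ge0. Qed.

Lemma cexp_neq0 z : cexp z != 0.
Proof. by rewrite -cmod_eq0 cmod_cexp gt_eqF ?expR_gt0. Qed.

Lemma cexp_real (t : R) : cexp t%:C = (expR t)%:C.
Proof. by rewrite /cexp /= cos0 sin0 mulr1. Qed.

Lemma phaseE (t : R) : phase t = cos (2 * pi * t) +i* (- sin (2 * pi * t)).
Proof. by rewrite /phase /cexp /= expR0 cosN sinN mul1r. Qed.

Lemma phaseD (t u : R) : phase (t + u) = phase t * phase u.
Proof.
rewrite /phase -cexpD; congr cexp; apply/eqP; rewrite eq_complex /= addr0 eqxx /=.
by rewrite mulrDr opprD.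
Qed.

Lemma phase0 : phase 0 = 1 :> R[i].
Proof. by rewrite /phase mulr0 oppr0 cexp0. Qed.

Lemma cmod_phase (t : R) : cmod (phase t) = 1.
Proof. by rewrite /phase cmod_cexp expR0. Qed.

Lemma phase_neq0 (t : R) : phase t != 0.
Proof. exact: cexp_neq0. Qed.

Lemma phaseN (t : R) : phase (- t) = (phase t)^-1.
Proof.
by apply: (mulfI (phase_neq0 t)); rewrite -phaseD subrr phase0 divff ?phase_neq0.
Qed.

Lemma phaseMn (t : R) n : phase (t *+ n) = phase t ^+ n.
Proof. by elim: n => [|n IH]; rewrite ?mulr0n ?phase0 // mulrS phaseD IH exprS. Qed.

Lemma phase1 : phase 1 = 1 :> R[i].
Proof. by rewrite phaseE mulr1 mulr_natl cos2pi sin2pi oppr0. Qed.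

Lemma phase_int (n : int) : phase n%:~R = 1 :> R[i].
Proof.
case: n => n; first by rewrite -[X in phase X]/(n%:R) phaseMn phase1 expr1n.
by rewrite NegzE mulrNz phaseN -[X in phase X]/(n.+1%:R) phaseMn phase1 expr1n invr1.
Qed.

Lemma phaseDint (t : R) (n : int) : phase (t + n%:~R) = phase t.
Proof. by rewrite phaseD phase_int mulr1. Qed.

(** For the fractional part u, cos(2 pi u) = 1 forces sin(pi u) = 0, while the sine is positive
    between 0 and pi. *)
Lemma phase_eq1 (t : R) : phase t = 1 -> exists n : int, t = n%:~R.
Proof.
move=> t1; exists (Num.floor t); apply/eqP; rewrite -subr_eq0.
set u := t - _.
have u01 : 0 <= u < 1.
  rewrite subr_ge0 ge_floor /= ltrBlDr addrC.
  by have := lt_succ_floor t; rewrite intrD.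
have : phase u = 1 by rewrite /u phaseD t1 -mulrNz phase_int mulr1.
rewrite phaseE => -[cu _].
have : sin (pi * u) = 0.
  have : cos (pi * u *+ 2) = 1 by rewrite -cu; congr cos; ring.
  rewrite cos_mulr2n cos2sin2 => h; apply/eqP; rewrite -sqrf_eq0; apply/eqP.
  by move: h; lra.
move: u01 => /andP[u0 u1]; rewrite eq_le u0 andbT => su; rewrite leNgt.
apply/negP => up; have : 0 < sin (pi * u).
  by apply: sin_gt0_pi; rewrite mulr_gt0 ?pi_gt0 //= gtr_pMr ?pi_gt0.
by rewrite su ltxx.
Qed.

Lemma root_unity_sum (l : nat) (h : int) : (0 < l)%N ->
  \sum_(i < l) phase (i%:R * (h%:~R / l%:R)) =
  if (l %| h)%Z then l%:R else 0 :> R[i].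
Proof.
move=> l0; have lR : l%:R != 0 :> R by rewrite pnatr_eq0 -lt0n.
pose x : R[i] := phase (h%:~R / l%:R).
have -> : \sum_(i < l) phase (i%:R * (h%:~R / l%:R)) = \sum_(i < l) x ^+ i.
  by apply: eq_bigr => i _; rewrite mulr_natl phaseMn.
case: ifPn => [/dvdzP[n hn]|nd].
  have -> : x = 1 by rewrite /x hn intrM mulfK ?phase_int.
  by under eq_bigr do rewrite expr1n; rewrite sumr_const card_ord.
have x1 : x - 1 != 0.
  rewrite subr_eq0; apply/eqP => /phase_eq1[n] e; case/negP: nd.
  apply/dvdzP; exists n; apply: (@intr_inj R); rewrite intrM -e.
  by rewrite mulfVK.
have xl : x ^+ l = 1 by rewrite /x -phaseMn -[X in phase X]mulr_natr mulfVK // phase_int.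
by apply: (mulfI x1); rewrite -subrX1 mulr0 xl subrr.
Qed.

Lemma phase_continuous (t0 : R) (T : Type) (F : set_system T) {FF : Filter F}
    (t : T -> R) : t @ F --> t0 -> ccvg F (fun x => phase (t x)) (phase t0).
Proof.
move=> tt0.
have h : (fun x => 2 * pi * t x) @ F --> 2 * pi * t0 by apply: cvgM => //; exact: cvg_cst.
have hc : (fun x => cos (2 * pi * t x)) @ F --> cos (2 * pi * t0).
  by apply: continuous_cvg h; exact: continuous_cos.
have hs : (fun x => sin (2 * pi * t x)) @ F --> sin (2 * pi * t0).
  by apply: continuous_cvg h; exact: continuous_sin.
by apply: ccvgRI; under eq_fun do rewrite phaseE; rewrite phaseE //=; exact: cvgN.
Qed.

(* The expansion of (2 cos (pi t)) ^ (2 m), indexed by the distance to the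
   middle binomial coefficient. *)
Definition midbin (m : nat) (h : int) : nat := 'C(m.*2, m + `|h|).

(** Binomial expansion of the 2m-th power of [phase (t / 2) + phase (- t / 2)]. The index a
    corresponds to h = m - a, and symmetry of the coefficients leaves only |h|. *)
Lemma usum_midbin (m : nat) (t : R) :
  usum (fun h : int => (midbin m h)%:R * phase (t * h%:~R))
       (((2 * cos (pi * t)) ^+ m.*2)%:C).
Proof.
pose e (a : 'I_m.*2.+1) : int := m%:Z - a%:Z.
pose f (h : int) : R[i] := (midbin m h)%:R * phase (t * h%:~R).
have ei : injective e by move=> a b /(can_inj (subKr _)) [] /val_inj.
have binE (a : 'I_m.*2.+1) : midbin m (e a) = 'C(m.*2, a).
  rewrite /midbin /e; have [am|ma] := leqP a m.
    rewrite -[RHS]bin_sub; last by rewrite -ltnS ltn_ord.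
    by congr 'C(_, _); lia.
  by congr 'C(_, _); have := ltn_ord a; lia.
have f0 h : (forall a, e a <> h) -> f h = 0.
  move=> hn; rewrite /f /midbin bin_small ?mul0r // ltnNge; apply/negP => le.
  have hm : (`|h| <= m)%N by move: le; rewrite -addnn leq_add2l.
  have lt : (`|m%:Z - h| < m.*2.+1)%N by lia.
  by apply: (hn (Ordinal lt)); rewrite /e /=; lia.
apply/(usum_inj _ ei f0).
have := usum_finType (f \o e).
suff -> : \sum_i (f \o e) i = ((2 * cos (pi * t)) ^+ m.*2)%:C by [].
have c2 : (2 * cos (pi * t))%:C = phase (t / 2) + phase (- t / 2) :> R[i].
  rewrite !phaseE !mulNr mulrN cosN sinN opprK.
  apply/eqP; rewrite eq_complex /= addNr eqxx andbT.
  by rewrite -mulr2n mulr_natl; apply/eqP; congr (cos _ *+ 2); field.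
rewrite rmorphXn /= c2 exprDn; apply: eq_bigr => a _ /=.
rewrite /f binE -!phaseMn -phaseD mulr_natl; congr (phase _ *+ _).
have am : (a <= m.*2)%N by rewrite -ltnS.
rewrite /e intrB -(mulr_natr (t / 2)) -(mulr_natr (- t / 2)) natrB //.
have -> : (m.*2)%:R = 2 * m%:R :> R by rewrite -muln2 natrM mulrC.
by field.
Qed.

Lemma usum_sum (T : choiceType) (I : Type) (s : seq I) (f : I -> T -> R[i])
    (S : I -> R[i]) :
  (forall i, usum (f i) (S i)) ->
  usum (fun x => \sum_(i <- s) f i x) (\sum_(i <- s) S i).
Proof.
move=> h; elim: s => [|i s IH].
  by rewrite big_nil; apply: eq_usum (@usum_ext0 R T) => x; rewrite big_nil.
rewrite big_cons; apply: eq_usum (usumD (h i) IH) => x.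
by rewrite big_cons.
Qed.

(** Poisson summation in finite form: the expansions at the points (i + w)/l are summed against the
    character of [r], and the sum of roots of unity keeps exactly the h congruent to [r] modulo
    [l]. *)
Lemma usum_midbin_mod (m l : nat) (r : int) (w : R) : (0 < l)%N ->
  usum (fun n : int => l%:R * ((midbin m (n * l%:Z + r))%:R * phase (w * n%:~R)))
   (\sum_(i < l) ((2 * cos (pi * ((i%:R + w) / l%:R))) ^+ m.*2)%:C
      * phase (- ((i%:R + w) / l%:R * r%:~R))).
Proof.
move=> l0; have lR : l%:R != 0 :> R by rewrite pnatr_eq0 -lt0n.
pose F (h : int) : R[i] := if (l %| h - r)%Z then
  l%:R * ((midbin m h)%:R * phase (w * ((h - r)%:~R / l%:R))) else 0.
pose e (n : int) := n * l%:Z + r.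
have ei : injective e by move=> a b /addIr /mulIf; apply; lia.
have F0 u : (forall t, e t <> u) -> F u = 0.
  move=> h; rewrite /F; case: ifP => // /dvdzP[n hn].
  by case: (h n); rewrite /e -hn subrK.
have h1 := usum_sum (index_enum 'I_l) (fun i : 'I_l =>
  usumZ (phase (- ((i%:R + w) / l%:R * r%:~R))) (usum_midbin m ((i%:R + w) / l%:R))).
have h2 : usum F (\sum_(i < l) ((2 * cos (pi * ((i%:R + w) / l%:R))) ^+ m.*2)%:C
      * phase (- ((i%:R + w) / l%:R * r%:~R))).
  under eq_bigr do rewrite mulrC.
  apply: eq_usum h1 => h; rewrite /F.
  have -> : \sum_(i < l) phase (- ((i%:R + w) / l%:R * r%:~R)) *
     ((midbin m h)%:R * phase ((i%:R + w) / l%:R * h%:~R)) =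
     (midbin m h)%:R * phase (w * ((h - r)%:~R / l%:R)) *
     \sum_(i < l) phase (i%:R * ((h - r)%:~R / l%:R)).
    rewrite mulr_sumr; apply: eq_bigr => i _.
    rewrite mulrCA -[RHS]mulrA -!phaseD; congr (_ * phase _).
    by rewrite intrB; field.
  by rewrite root_unity_sum //; case: ifP => _; rewrite ?mulr0 // mulrC.
apply: eq_usum ((usum_inj _ ei F0).2 h2) => n /=.
rewrite /F /e addrK dvdz_mull // intrM mulfK //.
Qed.

End Phase.

(** * Ratios of central binomial coefficients *)

Section MidbinRatio.
Variable R : realType.

(* With [k <= K] fixed, the ratios of consecutive central coefficients are
   squeezed between exponentials, which sum to k^2 in the exponent. *)
Lemma midbin_ratio_le (m K k : nat) : (0 < m)%N -> (k <= K)%N ->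
  ('C(m.*2, m + k))%:R / ('C(m.*2, m))%:R
    <= expR (- (k%:R ^+ 2 / (m + K)%:R)) :> R.
Proof.
move=> m0; have mK : 0 < (m + K)%:R :> R by rewrite ltr0n addn_gt0 m0.
have c0 : 0 < ('C(m.*2, m))%:R :> R by rewrite ltr0n bin_gt0 -addnn leq_addl.
elim: k => [_|k IH kK].
  by rewrite addn0 divff ?gt_eqF // expr0n mul0r oppr0 expR0.
have [km|mk] := ltnP k m; last first.
  by rewrite bin_small ?mul0r ?expR_ge0 // -addnn ltn_add2l ltnS.
have m1 : 0 < (m + k.+1)%:R :> R by rewrite ltr0n addnS.
have rec : ('C(m.*2, m + k.+1))%:R = ('C(m.*2, m + k))%:R * ((m - k)%:R / (m + k.+1)%:R) :> R.
  apply: (mulIf (lt0r_neq0 m1)); rewrite -mulrA mulfVK ?gt_eqF // -!natrM.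
  congr (_%:R); have := mul_bin_left m.*2 (m + k); rewrite -addnn addnS subnDl mulnC => ->.
  by rewrite mulnC.
rewrite rec mulrAC.
apply: (@le_trans _ _ (expR (- (k%:R ^+ 2 / (m + K)%:R)) * expR (- ((2 * k%:R + 1) / (m + K)%:R)))).
  apply: ler_pM (IH (ltnW kK)) _; [exact: divr_ge0 (ler0n _ _) (ltW c0)|
    exact: divr_ge0 (ler0n _ _) (ltW m1)|].
  apply: (@le_trans _ _ (1 - (2 * k%:R + 1) / (m + K)%:R)); last first.
    exact: expR_ge1Dx.
  rewrite lerBrDr -lerBrDl.
  have -> : 1 - (m - k)%:R / (m + k.+1)%:R = (2 * k%:R + 1) / (m + k.+1)%:R :> R.
    move: m1; rewrite natrB ?(ltnW km) // addnS -addn1 !natrD => m1.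
    by field; rewrite gt_eqF.
  rewrite ler_wpM2l ?addr_ge0 ?mulr_ge0 // lef_pV2 ?posrE // ler_nat leq_add2l //.
rewrite -expRD le_eqVlt; apply/orP; left; apply/eqP; congr expR.
by rewrite -[k.+1]addn1 natrD; field; rewrite -natrD gt_eqF.
Qed.

(** The inverse of a consecutive ratio is 1 + (2k + 1)/(m - k), at most an exponential. The step has
    k < K, hence m - k >= m - K + 1, which is the denominator of the statement. *)
Lemma midbin_ratio_ge (m K k : nat) : (K <= m)%N -> (k <= K)%N ->
  expR (- (k%:R ^+ 2 / (m - K).+1%:R)) <=
  ('C(m.*2, m + k))%:R / ('C(m.*2, m))%:R :> R.
Proof.
move=> Km; have mK : 0 < (m - K).+1%:R :> R by rewrite ltr0n.
have c0 : 0 < ('C(m.*2, m))%:R :> R by rewrite ltr0n bin_gt0 -addnn leq_addl.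
elim: k => [_|k IH kK].
  by rewrite addn0 divff ?gt_eqF // expr0n mul0r oppr0 expR0.
have km : (k < m)%N by exact: leq_trans kK Km.
have m1 : 0 < (m + k.+1)%:R :> R by rewrite ltr0n addnS.
have rec : ('C(m.*2, m + k.+1))%:R = ('C(m.*2, m + k))%:R * ((m - k)%:R / (m + k.+1)%:R) :> R.
  apply: (mulIf (lt0r_neq0 m1)); rewrite -mulrA mulfVK ?gt_eqF // -!natrM.
  congr (_%:R); have := mul_bin_left m.*2 (m + k); rewrite -addnn addnS subnDl mulnC => ->.
  by rewrite mulnC.
rewrite rec [X in _ <= X]mulrAC.
apply: (@le_trans _ _ (expR (- (k%:R ^+ 2 / (m - K).+1%:R)) * expR (- ((2 * k%:R + 1) / (m - K).+1%:R)))).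
  rewrite -expRD le_eqVlt; apply/orP; left; apply/eqP; congr expR.
  by rewrite -[k.+1]addn1 natrD; field; rewrite gt_eqF.
apply: ler_pM (expR_ge0 _) (expR_ge0 _) (IH (ltnW kK)) _.
have mk : 0 < (m - k)%:R :> R by rewrite ltr0n subn_gt0.
rewrite expRN -[X in _ <= X]invf_div lef_pV2 ?posrE ?expR_gt0 ?divr_gt0 //.
apply: le_trans (expR_ge1Dx _); rewrite -lerBlDl.
have -> : (m + k.+1)%:R / (m - k)%:R - 1 = (2 * k%:R + 1) / (m - k)%:R :> R.
  move: mk; rewrite natrB ?(ltnW km) // => mk.
  by rewrite addnS -addn1 !natrD; field; rewrite gt_eqF.
by rewrite ler_wpM2l ?addr_ge0 ?mulr_ge0 // lef_pV2 ?posrE // ler_nat; lia.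
Qed.

End MidbinRatio.

(** * Elementary bounds for sine and cosine *)

Section TrigBounds.
Variable R : realType.
Implicit Types x : R.

Lemma sin_norm_le x : `|sin x| <= `|x|.
Proof.
wlog x0 : x / 0 <= x.
  move=> H; have [/H//|/ltW x0] := leP 0 x.
  by rewrite -(normrN x) -(normrN (sin x)) -sinN; apply: H; rewrite oppr_ge0.
have [c _] := @MVT_segment R sin cos 0 x x0 (fun y _ => is_derive_sin y)
  (continuous_subspaceT (@continuous_sin R)).
rewrite sin0 !subr0 => ->; rewrite normrM ler_piMl //; exact: cos_max.
Qed.

Lemma cos_ge x : 1 - cos x <= x ^+ 2 / 2.
Proof.
have -> : cos x = 1 - 2 * sin (x / 2) ^+ 2.
  have {1}-> : x = x / 2 *+ 2 by rewrite -mulr_natr mulfVK.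
  by rewrite cos_mulr2n cos2sin2; ring.
have := sin_norm_le (x / 2); rewrite -ler_sqr ?nnegrE // !real_normK ?num_real //.
by rewrite expr_div_n; lra.
Qed.

(** Mean value theorem for sin z - z, whose derivative is controlled by [cos_ge]; the constant 1/2
    is not sharp but suffices for the uses below. *)
Lemma sin_dist_le x : `|sin x - x| <= `|x| ^+ 3 / 2.
Proof.
wlog x0 : x / 0 <= x.
  move=> H; have [/H//|/ltW x0] := leP 0 x.
  have := H (- x); rewrite oppr_ge0 x0 sinN normrN => /(_ isT).
  by rewrite -opprD normrN.
have d (y : R) : is_derive y 1 (fun z => sin z - z) (cos y - 1) by apply: is_deriveB.
have [|c /itvP cx] := @MVT_segment R (fun z => sin z - z) (fun y => cos y - 1) 0 x x0 (fun y _ => d y).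
  by apply: derivable_within_continuous => y _; case: (d y).
rewrite sin0 !subr0 => ->; rewrite normrM exprSr -mulrAC ler_wpM2r //.
rewrite ler0_norm ?subr_le0 ?cos_le1 // opprB.
apply: le_trans (cos_ge c) _; rewrite ler_pM2r // ger0_norm //.
by rewrite ler_sqr ?nnegrE ?cx.
Qed.

(** Up to 1 the cubic bound gives sin y >= y/2. From 1 to pi/2 the sine increases, so it stays at
    least 1/2, and |x|/4 < 1/2 because pi/2 < 2. *)
Lemma sin_ge_quarter x : `|x| <= pi / 2 -> `|x| / 4 <= `|sin x|.
Proof.
wlog x0 : x / 0 <= x.
  move=> H; have [/H//|/ltW x0] := leP 0 x.
  have := H (- x); rewrite oppr_ge0 x0 sinN !normrN => /(_ isT); exact.
rewrite (ger0_norm x0) => xp.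
have small (y : R) : 0 <= y -> y <= 1 -> y / 2 <= sin y.
  move=> y0 y1; have := sin_dist_le y; rewrite ler_norml (ger0_norm y0) => /andP[h _].
  have : y ^+ 3 <= y by rewrite exprS ler_piMr // expr_le1.
  by move: h; lra.
apply: le_trans (ler_norm _).
have [x1|/ltW x1] := leP x 1; first by have := small x x0 x1; lra.
have s1 : sin 1 <= sin x.
  have p1 := @pihalf_ge1 R; have p0 := @pi_gt0 R.
  move: (x1); rewrite le_eqVlt => /orP[/eqP<-//|x1']; apply/ltW.
  by rewrite ltr_sin // in_itv /=; apply/andP; split; lra.
by have := small 1 ler01 (lexx 1); have := @pihalf_lt2 R; lra.
Qed.

End TrigBounds.

(** * Gaussian limits of binomial ratios and of powers of cosines *)

Section SqrtLimits.
Variable R : realType.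

Let sq (m : nat) : R := Num.sqrt m%:R.

Lemma near_cvg (f g : nat -> R) (v : R) :
  (\forall m \near \oo, f m = g m) -> f @ \oo --> v -> g @ \oo --> v.
Proof. by move=> fg; apply: cvg_trans; exact: near_eq_cvg. Qed.

Lemma sqrt_nat_cvgy : sq m @[m --> \oo] --> +oo.
Proof.
apply/cvgryPge => A; exists (Num.truncn (A ^+ 2)).+1 => // m /= hm.
apply: le_trans (ler_norm _) _; rewrite -sqrtr_sqr ler_wsqrtr //.
apply/ltW; apply: lt_le_trans (truncnS_gt _) _; by rewrite ler_nat.
Qed.

Lemma sqrt_nat_inv0 : (sq m)^-1 @[m --> \oo] --> 0.
Proof. by apply/gtr0_cvgV0; [near=> m; rewrite sqrtr_gt0 ltr0n; near: m; exists 1%N|exact: sqrt_nat_cvgy].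
Unshelve. all: by end_near. Qed.

Lemma sq_sqr m : sq m * sq m = m%:R.
Proof. by rewrite -expr2 sqr_sqrtr. Qed.

Lemma expR_cvg (u : nat -> R) (v : R) : u @ \oo --> v ->
  expR (u m) @[m --> \oo] --> expR v.
Proof. by move=> uv; apply: continuous_cvg uv; exact: continuous_expR. Qed.

(** Local limit theorem. With K = k the ratio bounds have exponents k^2/(m + k) and k^2/(m - k + 1);
    both tend to v^2, since k/sqrt m tends to |v| and k/m to 0. *)
Lemma midbin_lim (h : nat -> int) (v : R) :
  (h m)%:~R / sq m @[m --> \oo] --> v ->
  (midbin m (h m))%:R / ('C(m.*2, m))%:R @[m --> \oo] --> expR (- v ^+ 2).
Proof.
move=> hv; pose k m := `|h m|%N.
have kE m : (k m)%:R = `|(h m)%:~R| :> R by rewrite /k -intr_norm natr_absz.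
have kv : (k m)%:R / sq m @[m --> \oo] --> `|v|.
  apply: near_cvg (cvg_norm hv); near=> m.
  by rewrite kE normrM normfV (ger0_norm (sqrtr_ge0 _)).
have km : (k m)%:R / m%:R @[m --> \oo] --> (0 : R).
  rewrite -(mulr0 `|v|); apply: near_cvg (cvgM kv sqrt_nat_inv0).
  by near=> m; rewrite /= -mulrA -invfM sq_sqr.
have m1 : m%:R^-1 @[m --> \oo] --> (0 : R).
  rewrite -(mulr0 0); apply: near_cvg (cvgM sqrt_nat_inv0 sqrt_nat_inv0).
  by near=> m; rewrite /= -invfM sq_sqr.
have kv2 : ((k m)%:R / sq m) ^+ 2 @[m --> \oo] --> v ^+ 2.
  by rewrite -[v ^+ 2]real_normK ?num_real // expr2; exact: cvgM.
have lim (e : nat -> R) : e @ \oo --> 0 ->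
    expR (- (((k m)%:R / sq m) ^+ 2 / (1 + e m))) @[m --> \oo] --> expR (- v ^+ 2).
  move=> e0; apply: expR_cvg; apply: cvgN.
  rewrite -[v ^+ 2]divr1 -[X in _ / X]addr0.
  apply: cvgM => //; apply: cvgV; first by rewrite addr0 oner_neq0.
  by apply: cvgD => //; exact: cvg_cst.
have near1 : \forall m \near \oo, (0 < m)%N by exists 1%N.
have near2 : \forall m \near \oo, (k m <= m)%N.
  have /cvgrPdist_lt/(_ 1 ltr01) := km; apply: filterS2 near1 => m m0.
  rewrite sub0r normrN ger0_norm ?divr_ge0 // ltr_pdivrMr ?ltr0n // mul1r ltr_nat.
  exact: ltnW.
have up := lim _ km.
have lo : expR (- (((k m)%:R / sq m) ^+ 2 / (1 + (m%:R^-1 - (k m)%:R / m%:R)))) @[m --> \oo]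
    --> expR (- v ^+ 2).
  by apply: lim; rewrite -[0]subr0; exact: cvgB.
apply: squeeze_cvgr lo up.
apply: filterS2 near1 near2 => m m0 kle.
have mR : m%:R != 0 :> R by rewrite pnatr_eq0 -lt0n.
have sqm : ((k m)%:R / sq m) ^+ 2 = (k m)%:R ^+ 2 / m%:R :> R.
  by rewrite expr_div_n [sq m ^+ 2]expr2 sq_sqr.
apply/andP; split; rewrite sqm.
  apply: le_trans (midbin_ratio_ge R kle (leqnn _)).
  rewrite ler_expR lerN2 le_eqVlt; apply/orP; left; apply/eqP.
  have d0 : m%:R - (k m)%:R + 1 != 0 :> R.
    by rewrite gt_eqF // ltr_wpDl // subr_ge0 ler_nat.
  rewrite -[(m - k m).+1]addn1 natrD natrB //; field.
  by rewrite mR addrCA addrC d0.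
apply: le_trans (midbin_ratio_le R m0 (leqnn _)) _.
rewrite ler_expR lerN2 le_eqVlt; apply/orP; left; apply/eqP.
have d0 : m%:R + (k m)%:R != 0 :> R by rewrite gt_eqF // ltr_wpDr // ltr0n.
by rewrite natrD; field; rewrite mR d0.
Unshelve. all: by end_near. Qed.

(** With x = sin(t)^2 the power is (1 - x)^m, and exp(-x/(1 - x)) <= 1 - x <= exp(-x). The cubic
    bound on sin t - t shows that m x tends to v^2. *)
Lemma cos_pow_lim (t : nat -> R) (v : R) :
  t m * sq m @[m --> \oo] --> v ->
  cos (t m) ^+ m.*2 @[m --> \oo] --> expR (- v ^+ 2).
Proof.
move=> tv.
have t0 : t @ \oo --> 0.
  rewrite -(mulr0 v); apply: near_cvg (cvgM tv sqrt_nat_inv0).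
  near=> m; rewrite /= mulfK // gt_eqF // sqrtr_gt0 ltr0n.
  by near: m; exists 1%N.
have sv : sin (t m) * sq m @[m --> \oo] --> v.
  have h : `|t m| ^+ 2 / 2 * `|t m * sq m| @[m --> \oo] --> 0.
    have -> : 0 = `|0 : R| ^+ 2 / 2 * `|v| :> R by rewrite normr0 expr0n !mul0r.
    apply: cvgM; last exact: cvg_norm.
    by apply: cvgM; [rewrite expr2; apply: cvgM; exact: cvg_norm|exact: cvg_cst].
  have : sin (t m) * sq m - t m * sq m @[m --> \oo] --> 0.
    apply/norm_cvg0P; apply: squeeze_cvgr (cvg_cst 0) h; near=> m.
    rewrite normr_ge0 /= -mulrBl !normrM mulrA ler_wpM2r //.
    by apply: le_trans (sin_dist_le _) _; rewrite exprSr mulrAC.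
  move=> /cvgD/(_ tv); rewrite add0r; apply: near_cvg.
  by near=> m; rewrite /= subrK.
pose x m := sin (t m) ^+ 2.
have x0 : x @ \oo --> 0.
  have -> : 0 = sin (0 : R) * sin 0 by rewrite sin0 mulr0.
  by apply: cvgM; apply: continuous_cvg t0; exact: continuous_sin.
have xv : m%:R * x m @[m --> \oo] --> v ^+ 2.
  rewrite expr2; apply: near_cvg (cvgM sv sv).
  by near=> m; rewrite /= mulrACA sq_sqr mulrC.
have up : expR (- (m%:R * x m)) @[m --> \oo] --> expR (- v ^+ 2).
  by apply: expR_cvg; exact: cvgN.
have lo : expR (- (m%:R * x m / (1 - x m))) @[m --> \oo] --> expR (- v ^+ 2).
  apply: expR_cvg; apply: cvgN; rewrite -[v ^+ 2]divr1 -[X in _ / X]subr0.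
  apply: cvgM => //; apply: cvgV; first by rewrite subr0 oner_neq0.
  by apply: cvgB => //; exact: cvg_cst.
apply: squeeze_cvgr lo up.
have /cvgrPdist_lt/(_ 1 ltr01) := x0; apply: filterS => m.
rewrite sub0r normrN ger0_norm ?sqr_ge0 // => x1.
have -> : cos (t m) ^+ m.*2 = (1 - x m) ^+ m.
  by rewrite -cos2sin2 -exprM mul2n.
have x1' : 0 < 1 - x m by rewrite subr_gt0.
apply/andP; split.
  rewrite -mulrA -mulrN expRM_natl.
  apply: lerXn2r; rewrite ?nnegrE; [exact: expR_ge0|exact: ltW|].
  rewrite expRN -[1 - x m]invrK lef_pV2 ?posrE ?expR_gt0 ?invr_gt0 //.
  apply: le_trans (expR_ge1Dx _); rewrite invrK le_eqVlt; apply/orP; left.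
  by apply/eqP; field; rewrite gt_eqF.
rewrite -(mulrN m%:R) expRM_natl.
apply: lerXn2r; rewrite ?nnegrE; [exact: ltW|exact: expR_ge0|].
exact: expR_ge1Dx.
Unshelve. all: by end_near. Qed.

End SqrtLimits.

(** Modulus l of the finite identity. It grows like sqrt(pi q m), so that h = n l + r with r/l -> C
    has h^2/m -> pi q (n + C)^2. *)
Definition theta_len (R : realType) (q : R) (m : nat) : nat :=
  Num.truncn (Num.sqrt (pi * q) * Num.sqrt m%:R).

Lemma near_sqrt_gt0 (R : realType) : \forall m \near \oo, 0 < Num.sqrt (m%:R : R).
Proof. by exists 1%N => // m /= m0; rewrite sqrtr_gt0 ltr0n. Qed.

(** * Passage to the limit in the finite identity *)

Section Theta1.
Variable R : realType.

Local Notation sq m := (Num.sqrt (m%:R : R)).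

Variables (q C w : R).
Hypothesis q0 : 0 < q.

Let b : R := Num.sqrt (pi * q).
Let l (m : nat) : nat := theta_len q m.
(** An integer residue with r/l tending to the real shift [C]. *)
Let r (m : nat) : int := Num.floor (C * (l m)%:R).
(** The finite identity is applied with j0 + w in place of w. This centres the window of l integers
    j so that |j + w| <= l/2, and the angles pi (j + w)/l stay where [sin_ge_quarter] holds. *)
Let j0 (m : nat) : int := Num.ceil (- ((l m)%:R / 2) - w).

Let b0 : 0 < b. Proof. by rewrite sqrtr_gt0 mulr_gt0 ?pi_gt0. Qed.

Let b2 : b ^+ 2 = pi * q.
Proof. by rewrite sqr_sqrtr // mulr_ge0 ?pi_ge0 ?ltW. Qed.

Let l_le m : (l m)%:R <= b * sq m.
Proof. by rewrite truncn_le // mulr_ge0 ?sqrtr_ge0 ?ltW. Qed.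

Let near_m0 := near_sqrt_gt0 R.

Lemma theta_len_lim : (l m)%:R / sq m @[m --> \oo] --> b.
Proof.
have lo : b - (sq m)^-1 @[m --> \oo] --> b.
  by rewrite -[X in _ --> X]subr0; apply: cvgB; [exact: cvg_cst|exact: sqrt_nat_inv0].
apply: squeeze_cvgr lo (cvg_cst b); apply: filterS near_m0 => m m0.
rewrite ler_pdivrMr // l_le andbT ler_pdivlMr // mulrBl mulVf ?gt_eqF //.
by rewrite lerBlDr natr1 /l /theta_len; apply/ltW/truncnS_gt.
Qed.

Let l_lim := theta_len_lim.

Let l_near : \forall m \near \oo, b / 2 <= (l m)%:R / sq m.
Proof.
have : b / 2 < b by rewrite ltr_pdivrMr // ltr_pMr // ltr1n.
by move=> /(cvgr_gt _ l_lim); apply: filterS => m /ltW.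
Qed.

Lemma theta_len_gt0 : \forall m \near \oo, (0 < l m)%N.
Proof.
apply: filterS2 near_m0 l_near => m m0 h; rewrite lt0n; apply/eqP => l0.
by move: h; rewrite l0 mul0r leNgt divr_gt0.
Qed.

Let l_gt0 := theta_len_gt0.

Let r_lim : (r m)%:~R / sq m @[m --> \oo] --> C * b.
Proof.
have hi : C * ((l m)%:R / sq m) @[m --> \oo] --> C * b.
  by apply: cvgM l_lim; exact: cvg_cst.
have lo : C * ((l m)%:R / sq m) - (sq m)^-1 @[m --> \oo] --> C * b.
  by rewrite -[X in _ --> X]subr0; apply: cvgB hi _; exact: sqrt_nat_inv0.
apply: squeeze_cvgr lo hi; apply: filterS near_m0 => m m0.
rewrite mulrA ler_pM2r ?invr_gt0 // ge_floor andbT.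
rewrite -[X in _ - X]mul1r -mulrBl ler_pM2r ?invr_gt0 //.
by rewrite lerBlDr; have /ltW := lt_succ_floor (C * (l m)%:R); rewrite intrD.
Qed.

Let r_near : \forall m \near \oo, `|(r m)%:~R / sq m| <= `|C * b| + 1.
Proof.
have /cvgrPdist_lt/(_ 1 ltr01) := r_lim; apply: filterS => m /ltW h.
by rewrite -lerBlDl; apply: le_trans (lerB_dist _ _) _; rewrite distrC.
Qed.

Let F m (n : int) : R[i] :=
  ((midbin m (n * (l m)%:Z + r m))%:R / ('C(m.*2, m))%:R)%:C * phase (w * n%:~R).

Let G (n : int) : R[i] := (expR (- (pi * q * (n%:~R + C) ^+ 2)))%:C * phase (w * n%:~R).

Let nr_lim (n : int) : (n * (l m)%:Z + r m)%:~R / sq m @[m --> \oo] --> b * (n%:~R + C).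
Proof.
have -> : b * (n%:~R + C) = n%:~R * b + C * b by ring.
apply: (@near_cvg R (fun m => n%:~R * ((l m)%:R / sq m) + (r m)%:~R / sq m)).
  by apply: nearW => m; rewrite intrD intrM mulrDl mulrA.
by apply: cvgD r_lim; apply: cvgM l_lim; exact: cvg_cst.
Qed.

Let F_lim n : ccvg \oo (F^~ n) (G n).
Proof.
apply: ccvgM (ccvg_cst _); apply: ccvg_real.
rewrite -b2 -exprMn.
have h := (@midbin_lim R (fun m => n * (l m)%:Z + r m) _ (@nr_lim n)).
exact: h.
Qed.

(** Trades Gaussian decay for geometric decay, which is enough for domination. *)
Lemma sqr_ge_norm (x : R) : `|x| - 1 <= x ^+ 2.
Proof. by rewrite -real_normK ?num_real //; have := sqr_ge0 (`|x| - 1/2); rewrite expr2; lra. Qed.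

(** With K = m the ratio bound is exp(-h^2/(2m)), and beyond |h| = m the coefficient is 0. Since
    |h|/sqrt m is at least |n| b/2 up to a constant, the decay in |n| is uniform in m. *)
Let F_dom : exists K Q : R, [/\ 0 <= Q, Q < 1 & \forall m \near \oo, forall n,
  cmod (F m n) <= K * Q ^+ `|n|%N].
Proof.
exists (expR ((`|C * b| + 2) / 2)), (expR (- (b / 4))); split.
- exact: expR_ge0.
- by rewrite -expR0 ltr_expR oppr_lt0 divr_gt0.
have m0 : \forall m \near \oo, (0 < m)%N by exists 1%N.
near=> m => n.
rewrite /F cmodM cmod_phase mulr1 cmod_real ger0_norm ?divr_ge0 ?ler0n //.
have sm : 0 < sq m by near: m.
have mp : (0 < m)%N by near: m.
set h := n * _ + _.
have [hm|mh] := leqP `|h|%N m; last first.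
  by rewrite /midbin bin_small ?mul0r ?mulr_ge0 ?expR_ge0 ?exprn_ge0 // -addnn ltn_add2l.
apply: le_trans (midbin_ratio_le R mp hm) _.
rewrite -expRM_natl -expRD ler_expR.
have -> : (`|h|%N)%:R ^+ 2 / (m + m)%:R = (h%:~R / sq m) ^+ 2 / 2 :> R.
  rewrite natr_absz intr_norm real_normK ?num_real // expr_div_n sqr_sqrtr //.
  rewrite natrD; field; rewrite pnatr_eq0 -lt0n mp /=.
  by rewrite -natrD pnatr_eq0 addnn double_eq0 -lt0n.
have h1 := sqr_ge_norm (h%:~R / sq m).
have h2 : `|n%:~R| * (b / 2) - (`|C * b| + 1) <= `|h%:~R / sq m|.
  have hl : b / 2 <= (l m)%:R / sq m by near: m.
  have hr : `|(r m)%:~R / sq m| <= `|C * b| + 1 by near: m.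
  have -> : h%:~R / sq m = n%:~R * ((l m)%:R / sq m) + (r m)%:~R / sq m.
    by rewrite /h intrD intrM mulrDl mulrA.
  apply: le_trans (lerB_normD _ _); apply: lerB => //.
  by rewrite normrM ler_wpM2l // ger0_norm // divr_ge0 // ltW.
rewrite -intr_norm -natr_absz in h2.
by move: h1 h2; lra.
Unshelve. all: by end_near. Qed.

Let G_usum : exists S, usum G S.
Proof.
have [K [Q [Q0 Q1 hK]]] := F_dom.
have [|M hM] := @absum_int_geo R Q K G Q0 Q1.
  move=> n; apply: ccvg_cmod_le (F_lim n) _.
  by apply: filterS hK => m; apply.
by have [S hS _] := absum_usum hM; exists S.
Qed.

Let S_lim (S_ : nat -> R[i]) S : (\forall m \near \oo, usum (F m) (S_ m)) ->
  usum G S -> ccvg \oo S_ S.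
Proof.
move=> hS; have [K [Q [Q0 Q1 hK]]] := F_dom.
have K0 : 0 <= K.
  have [m hm] := filter_ex hK; have := le_trans (cmod_ge0 _) (hm 0).
  by rewrite absz0 expr0 mulr1.
pose h (n : int) : R[i] := (K * Q ^+ `|n|%N)%:C.
have hE n : cmod (h n) = K * Q ^+ `|n|%N.
  by rewrite cmod_real ger0_norm // mulr_ge0 ?exprn_ge0.
have [|M hM] := @absum_int_geo R Q K h Q0 Q1; first by move=> n; rewrite hE.
move=> gS; apply: (@usum_dominated R _ nat \oo _ F G h M S_ S hM _ F_lim hS gS).
by apply: filterS hK => m hm n; rewrite hE.
Qed.

Let E m (j : int) : R[i] :=
  if (j0 m <= j) && (j < j0 m + (l m)%:Z) then
    (cos (pi * ((j%:~R + w) / (l m)%:R)) ^+ m.*2)%:C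
      * phase (- ((j%:~R + w) / (l m)%:R * (r m)%:~R))
  else 0.

Let H (j : int) : R[i] :=
  (expR (- (pi * (j%:~R + w) ^+ 2 / q)))%:C * phase (- ((j%:~R + w) * C)).

Let window m (j : int) : (j0 m <= j) && (j < j0 m + (l m)%:Z) ->
  `|j%:~R + w| <= (l m)%:R / 2.
Proof.
move=> /andP[h1 h2]; rewrite ler_norml; apply/andP; split.
  have : (j0 m)%:~R <= j%:~R :> R by rewrite ler_int.
  have := ceil_ge (- ((l m)%:R / 2) - w); rewrite -/(j0 m); lra.
have : (j + 1)%:~R <= (j0 m + (l m)%:Z)%:~R :> R by rewrite ler_int lezD1.
have := gt_pred_ceil (- ((l m)%:R / 2) - w); rewrite -/(j0 m) !intrD.
by rewrite -[(l m)%:~R]/((l m)%:R); lra.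
Qed.

Let near_window (j : int) :
  \forall m \near \oo, (j0 m <= j) && (j < j0 m + (l m)%:Z).
Proof.
have ly : (l m)%:R @[m --> \oo] --> (+oo : set_system R).
  apply/cvgryPge => A; have /cvgryPge/(_ (2 * A / b)) := @sqrt_nat_cvgy R.
  apply: filterS3 near_m0 l_near => m m0 h1 h2.
  move: h1; rewrite ler_pdivlMr // => h1.
  apply: le_trans h1; rewrite mulrC -ler_pdivrMr ?divr_gt0 //.
  by apply: le_trans h2; rewrite le_eqVlt; apply/orP; left; apply/eqP; field; rewrite gt_eqF.
have /cvgryPge/(_ (2 * (`|j%:~R + w| + 1))) := ly; apply: filterS => m hm.
have h1 := ler_norm (j%:~R + w); have h2 := ler_norm (- (j%:~R + w)); rewrite normrN in h2.
apply/andP; split.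
  by rewrite /j0 ceil_le_int; move: hm h2; lra.
rewrite -lezD1 -(ler_int R) !intrD.
have := ceil_ge (- ((l m)%:R / 2) - w); rewrite -/(j0 m) -[(l m)%:~R]/((l m)%:R).
by move: hm h1; rewrite -[1%:~R]/(1 : R); lra.
Qed.

Let E_lim j : ccvg \oo (E^~ j) (H j).
Proof.
apply: (@near_ccvg _ _ _ _ (fun m =>
    (cos (pi * ((j%:~R + w) / (l m)%:R)) ^+ m.*2)%:C
      * phase (- ((j%:~R + w) / (l m)%:R * (r m)%:~R)))).
  by apply: filterS (near_window j) => m; rewrite /E => ->.
have li : sq m / (l m)%:R @[m --> \oo] --> b^-1.
  apply: near_cvg (cvgV (lt0r_neq0 b0) l_lim); near=> m.
  by rewrite /= invf_div.
apply: ccvgM.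
  apply: ccvg_real.
  have -> : pi * (j%:~R + w) ^+ 2 / q = (pi * (j%:~R + w) / b) ^+ 2.
    rewrite expr_div_n b2 exprMn.
    have E1 (p q1 s : R) : p != 0 -> q1 != 0 -> p * s / q1 = p ^+ 2 * s / (p * q1).
      by move=> p1 q2; field; rewrite p1 q2.
    by apply: E1; rewrite gt_eqF ?pi_gt0.
  apply: cos_pow_lim; apply: near_cvg (cvgM (cvg_cst (pi * (j%:~R + w))) li).
  by near=> m; rewrite /=; ring.
apply: phase_continuous; apply: cvgN.
have -> : (j%:~R + w) * C = (j%:~R + w) * (b^-1 * (C * b)).
  by field; rewrite gt_eqF.
apply: near_cvg (cvgM (cvg_cst (j%:~R + w)) (cvgM li r_lim)).
apply: filterS near_m0 => m m0 /=.
have [->|l0] := eqVneq (l m) 0%N; first by rewrite invr0 !(mulr0, mul0r).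
by field; rewrite pnatr_eq0 l0 gt_eqF.
Unshelve. all: by end_near. Qed.

(** On the window cos(t)^2 <= 1 - t^2/16, so the power is at most exp(-m t^2/16). From l <= b sqrt
    m, |t| sqrt m is at least (pi/b) |j + w|. *)
Let E_dom : exists K Q : R, [/\ 0 <= Q, Q < 1 & \forall m \near \oo, forall j,
  cmod (E m j) <= K * Q ^+ `|j|%N].
Proof.
have pb : 0 < pi / b by rewrite divr_gt0 ?pi_gt0.
exists (expR ((pi / b * `|w| + 1) / 16)), (expR (- (pi / b / 16))); split.
- exact: expR_ge0.
- by rewrite -expR0 ltr_expR oppr_lt0 divr_gt0.
apply: filterS2 near_m0 l_gt0 => m m0 l0 j.
rewrite /E; case: ifP => [/window hj|_]; last first.
  by rewrite cmod0 mulr_ge0 ?expR_ge0 ?exprn_ge0 ?expR_ge0.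
have lR : 0 < (l m)%:R :> R by rewrite ltr0n.
rewrite cmodM cmod_phase mulr1 cmod_real normrX -muln2 mulnC exprM real_normK ?num_real //.
set t := pi * _.
have tb : `|t| <= pi / 2.
  rewrite /t normrM ger0_norm ?pi_ge0 // ler_pM2l ?pi_gt0 // normrM normfV.
  by rewrite (gtr0_norm lR) ler_pdivrMr // [2^-1 * _]mulrC.
have ct : cos t ^+ 2 <= expR (- (t ^+ 2 / 16)).
  apply: le_trans (expR_ge1Dx _); rewrite cos2sin2 lerD2l lerN2.
  have : (`|t| / 4) ^+ 2 <= `|sin t| ^+ 2.
    by rewrite ler_sqr ?nnegrE ?divr_ge0 // sin_ge_quarter.
  by rewrite expr_div_n !real_normK ?num_real //; lra.
apply: (@le_trans _ _ (expR (- (t ^+ 2 / 16)) ^+ m)).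
  by apply: lerXn2r; rewrite ?nnegrE ?sqr_ge0 ?expR_ge0.
rewrite -!expRM_natl -expRD ler_expR.
have h1 := sqr_ge_norm (t * sq m); rewrite exprMn sqr_sqrtr // in h1.
have h2 : pi / b * (`|j%:~R| - `|w|) <= `|t * sq m|.
  have -> : t * sq m = (j%:~R + w) * (pi * (sq m / (l m)%:R)).
    by rewrite /t; ring.
  rewrite normrM [X in _ <= _ * X]ger0_norm; last first.
    by rewrite mulr_ge0 ?pi_ge0 // divr_ge0 // ltW.
  apply: (@le_trans _ _ (`|j%:~R + w| * (pi / b))).
    by rewrite mulrC ler_wpM2r ?(ltW pb) // lerB_normD.
  rewrite ler_wpM2l // ler_pM2l ?pi_gt0 //.
  by rewrite ler_pdivlMr // mulrC ler_pdivrMr // mulrC l_le.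
rewrite -intr_norm -natr_absz in h2.
by move: h1 h2; nra.
Qed.

Let H_usum : exists S, usum H S.
Proof.
have [K [Q [Q0 Q1 hK]]] := E_dom.
have [|M hM] := @absum_int_geo R Q K H Q0 Q1.
  move=> n; apply: ccvg_cmod_le (E_lim n) _.
  by apply: filterS hK => m; apply.
by have [S hS _] := absum_usum hM; exists S.
Qed.

Let T_lim (T_ : nat -> R[i]) S : (\forall m \near \oo, usum (E m) (T_ m)) ->
  usum H S -> ccvg \oo T_ S.
Proof.
move=> hS; have [K [Q [Q0 Q1 hK]]] := E_dom.
have K0 : 0 <= K.
  have [m hm] := filter_ex hK; have := le_trans (cmod_ge0 _) (hm 0).
  by rewrite absz0 expr0 mulr1.
pose h (n : int) : R[i] := (K * Q ^+ `|n|%N)%:C.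
have hE n : cmod (h n) = K * Q ^+ `|n|%N.
  by rewrite cmod_real ger0_norm // mulr_ge0 ?exprn_ge0.
have [|M hM] := @absum_int_geo R Q K h Q0 Q1; first by move=> n; rewrite hE.
move=> gS; apply: (@usum_dominated R _ nat \oo _ E H h M T_ S hM _ E_lim hS gS).
by apply: filterS hK => m hm n; rewrite hE.
Qed.

Let T m : R[i] := \sum_(i < l m) E m (j0 m + i%:Z).

Let E_usum m : usum (E m) (T m).
Proof.
pose e (i : 'I_(l m)) : int := j0 m + i%:Z.
have ei : injective e by move=> i i' /addrI [] /val_inj.
apply/(usum_inj _ ei (f := E m)); last exact: usum_finType.
move=> u hu; rewrite /E; case: ifP => // /andP[h1 h2].
have lt : (`|u - j0 m|%N < l m)%N by lia.
by case: (hu (Ordinal lt)); rewrite /e /=; lia.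
Qed.

(* The finite identity whose limit is the theta function equation. *)
Let F_usum m : (0 < l m)%N ->
  usum (F m) (((2 ^+ m.*2 / ((l m)%:R * ('C(m.*2, m))%:R))%:C) * T m).
Proof.
move=> l0; have lR : (l m)%:R != 0 :> R[i] by rewrite pnatr_eq0 -lt0n.
have lR' : (l m)%:R != 0 :> R by rewrite pnatr_eq0 -lt0n.
have c0 : ('C(m.*2, m))%:R != 0 :> R by rewrite pnatr_eq0 -lt0n bin_gt0 -addnn leq_addl.
have := usumZ (((l m)%:R * ('C(m.*2, m))%:R)^-1)%:C
  (usum_midbin_mod m (r m) ((j0 m)%:~R + w) l0).
set S1 := _ * \sum_(i < _) _.
have -> : S1 = ((2 ^+ m.*2 / ((l m)%:R * ('C(m.*2, m))%:R))%:C) * T m.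
  rewrite /S1 /T [in RHS]mulrC rmorphM /= mulrA [in RHS]mulrC; congr (_ * _).
  rewrite mulrC mulr_sumr; apply: eq_bigr => i _.
  rewrite /E ifT; last by rewrite lerDl ltrD2l; have := ltn_ord i; lia.
  rewrite [RHS]mulrA -rmorphM -exprMn; congr ((_ ^+ _)%:C * phase _).
    by rewrite intrD -[(i%:Z)%:~R]/(i%:R); congr (_ * cos (_ * (_ / _))); ring.
  by rewrite intrD -[(i%:Z)%:~R]/(i%:R); congr (- (_ / _ * _)); ring.
apply: eq_usum => n; rewrite /F.
have -> : phase (((j0 m)%:~R + w) * n%:~R) = phase (w * n%:~R).
  by rewrite mulrDl addrC -intrM phaseDint.
rewrite [LHS]mulrA [LHS]mulrA; apply: (congr1 (fun z => z * phase _)).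
rewrite -(rmorph_nat (real_complex R) (l m)).
rewrite -(rmorph_nat (real_complex R) (midbin _ _)) -!rmorphM.
by congr (_%:C); field; rewrite lR' c0.
Qed.

(* Constant independent of C and w; its limit is found from q = 1, C = w = 0. *)
Let coef m : R := (l m)%:R * ('C(m.*2, m))%:R / 2 ^+ m.*2.

(** Domination makes both sides converge separately; only the limit of [coef] stays open. *)
Lemma theta1_lim : exists (S S' : R[i]) (S_ T_ : nat -> R[i]),
  [/\ usum G S, usum H S', ccvg \oo S_ S, ccvg \oo T_ S' &
   \forall m \near \oo, T_ m = (coef m)%:C * S_ m].
Proof.
have [S hS] := G_usum; have [S' hS'] := H_usum.
pose S_ m := ((2 ^+ m.*2 / ((l m)%:R * ('C(m.*2, m))%:R))%:C) * T m.
exists S, S', S_, T; split => //.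
- by apply: S_lim hS; apply: filterS l_gt0 => m; exact: F_usum.
- by apply: T_lim hS'; apply: nearW => m; exact: E_usum.
apply: filterS l_gt0 => m l0; rewrite /S_ mulrA -rmorphM /coef.
have lR' : (l m)%:R != 0 :> R by rewrite pnatr_eq0 -lt0n.
have c0 : ('C(m.*2, m))%:R != 0 :> R by rewrite pnatr_eq0 -lt0n bin_gt0 -addnn leq_addl.
have -> : (l m)%:R * ('C(m.*2, m))%:R / 2 ^+ m.*2 *
    (2 ^+ m.*2 / ((l m)%:R * ('C(m.*2, m))%:R)) = 1 :> R.
  by field; rewrite lR' c0 expf_neq0 // pnatr_eq0.
by rewrite mul1r.
Qed.

End Theta1.

(** For q = 1 and C = w = 0 both limit series are the same, with a sum at least its term n = 0, so
    [coef] must tend to 1. In general [coef] depends on q only through the modulus l, whose ratio to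
    that of q = 1 tends to sqrt q. *)
Lemma theta1 (R : realType) (q C w : R) : 0 < q ->
  exists S : R[i],
    usum (fun n : int => (expR (- (pi * q * (n%:~R + C) ^+ 2)))%:C * phase (w * n%:~R)) S /\
    usum (fun j : int => (expR (- (pi * (j%:~R + w) ^+ 2 / q)))%:C
                           * phase (- ((j%:~R + w) * C))) ((Num.sqrt q)%:C * S).
Proof.
move=> q0.
have [S [S' [S_ [T_ [hS hS' S_lim T_lim TS]]]]] := theta1_lim C w q0.
have [U [U' [U_ [V_ [hU hU' U_lim V_lim VU]]]]] := theta1_lim 0 0 (@ltr01 R).
have UU' : U' = U.
  apply: usum_unique hU' _; apply: eq_usum hU => n.
  by rewrite !addr0 mulr0 oppr0 mul0r mulr1 divr1.
have U1 : 1 <= complex.Re U.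
  have h : usum (fun n : int => (expR (- (pi * 1 * (n%:~R + 0) ^+ 2)))%:C) U.
    by apply: eq_usum hU => n; rewrite mul0r phase0 mulr1.
  have := usum_ge_fset [fset (0 : int)]%fset (fun n => expR_ge0 _) h.
  by rewrite big_seq_fset1 addr0 expr0n mulr0 oppr0 expR0.
have U0 : 0 < cmod U := lt_le_trans ltr01 (le_trans U1 (le_trans (ler_norm _) (cmod_Re _))).
pose c (p : R) m := (theta_len p m)%:R * ('C(m.*2, m))%:R / 2 ^+ m.*2 : R.
have c1 : c 1 m @[m --> \oo] --> (1 : R).
  have h1 : cmod (V_ m - U_ m) @[m --> \oo] --> (0 : R).
    have h : ccvg \oo (fun m => V_ m - U_ m) 0.
      by rewrite -(subrr U); apply: ccvgB U_lim; rewrite -UU'.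
    by rewrite -(@cmod0 R); exact: ccvg_cmod h.
  have h2 : cmod (V_ m - U_ m) * (cmod (U_ m))^-1 @[m --> \oo] --> (0 : R).
    rewrite -(mul0r (cmod U)^-1).
    by apply: cvgM h1 _; apply: cvgV (ccvg_cmod U_lim); exact: lt0r_neq0.
  have h3 : c 1 m - 1 @[m --> \oo] --> (0 : R).
    apply/norm_cvg0P; apply: near_cvg h2.
    apply: filterS2 VU (cvgr_gt _ (ccvg_cmod U_lim) _ U0) => m -> Um0.
    rewrite -/(c 1 m) -[X in _ - X]mul1r -mulrBl -(rmorph1 (real_complex R)) -rmorphB.
    by rewrite cmodM cmod_real mulfK // gt_eqF.
  rewrite -[X in _ --> X]add0r.
  apply: (@near_cvg R (fun m => (c 1 m - 1) + 1)); first by apply: nearW => m; rewrite subrK.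
  by apply: cvgD h3 _; exact: cvg_cst.
have cq : c q m @[m --> \oo] --> Num.sqrt q.
  have p1 : 0 < Num.sqrt (pi * 1 : R) by rewrite sqrtr_gt0 mulr1 pi_gt0.
  have -> : Num.sqrt q = 1 * (Num.sqrt (pi * q) * (Num.sqrt (pi * 1))^-1).
    rewrite mul1r mulr1 sqrtrM ?pi_ge0 // mulrAC divff ?mul1r //.
    by rewrite gt_eqF // sqrtr_gt0 pi_gt0.
  apply: near_cvg (cvgM c1 (cvgM (@theta_len_lim R q) (cvgV (lt0r_neq0 p1) (@theta_len_lim R 1)))).
  apply: filterS2 (theta_len_gt0 (@ltr01 R)) (near_sqrt_gt0 R) => m l0 m0 /=.
  rewrite /c; field; rewrite pnatr_eq0 -lt0n l0 gt_eqF //=.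
  by rewrite andbT gt_eqF.
exists S; split => //.
suff -> : (Num.sqrt q)%:C * S = S' by [].
apply: ccvg_unique T_lim; apply: near_ccvg (ccvgM (ccvg_real cq) S_lim).
by apply: filterS TS => m ->.
Qed.

(** * The theta function of a positive definite form *)

Section Dot.
Variables (R : realType).

Lemma dotE d (u v : 'cV[R]_d) : dot u v = (u^T *m v) 0 0.
Proof. by rewrite mxE; apply: eq_bigr => j _; rewrite mxE. Qed.

Lemma dotC d (u v : 'cV[R]_d) : dot u v = dot v u.
Proof. by apply: eq_bigr => j _; rewrite mulrC. Qed.

Lemma dotDl d (u v w : 'cV[R]_d) : dot (u + v) w = dot u w + dot v w.
Proof. by rewrite -big_split; apply: eq_bigr => j _; rewrite mxE mulrDl. Qed.

Lemma dotDr d (u v w : 'cV[R]_d) : dot u (v + w) = dot u v + dot u w.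
Proof. by rewrite dotC dotDl !(dotC u). Qed.

Lemma dotZl d (a : R) (u v : 'cV[R]_d) : dot (a *: u) v = a * dot u v.
Proof. by rewrite /dot mulr_sumr; apply: eq_bigr => j _; rewrite mxE mulrA. Qed.

Lemma dotZr d (a : R) (u v : 'cV[R]_d) : dot u (a *: v) = a * dot u v.
Proof. by rewrite dotC dotZl dotC. Qed.

Lemma dotNl d (u v : 'cV[R]_d) : dot (- u) v = - dot u v.
Proof. by rewrite -scaleN1r dotZl mulN1r. Qed.

Lemma dotNr d (u v : 'cV[R]_d) : dot u (- v) = - dot u v.
Proof. by rewrite dotC dotNl dotC. Qed.

Lemma dotBl d (u v w : 'cV[R]_d) : dot (u - v) w = dot u w - dot v w.
Proof. by rewrite dotDl dotNl. Qed.

Lemma dotBr d (u v w : 'cV[R]_d) : dot u (v - w) = dot u v - dot u w.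
Proof. by rewrite dotDr dotNr. Qed.

Lemma dot0l d (v : 'cV[R]_d) : dot 0 v = 0.
Proof. by rewrite -(scale0r v) dotZl mul0r. Qed.

Lemma dot0r d (v : 'cV[R]_d) : dot v 0 = 0.
Proof. by rewrite dotC dot0l. Qed.

Lemma dot_mulmx d e (A : 'M[R]_(d, e)) (u : 'cV[R]_d) (v : 'cV[R]_e) :
  dot u (A *m v) = dot (A^T *m u) v.
Proof. by rewrite !dotE trmx_mul trmxK mulmxA. Qed.

Lemma dot_col d e (a b : 'cV[R]_d) (u v : 'cV[R]_e) :
  dot (col_mx a u) (col_mx b v) = dot a b + dot u v.
Proof. by rewrite !dotE tr_col_mx mul_row_col mxE. Qed.

Lemma dot1 (u v : 'cV[R]_1) : dot u v = u 0 0 * v 0 0.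
Proof. by rewrite /dot big_ord1. Qed.

Lemma dot_ge0 d (u : 'cV[R]_d) : 0 <= dot u u.
Proof. by apply: sumr_ge0 => j _; rewrite -expr2 sqr_ge0. Qed.

Lemma dot_eq0 d (u : 'cV[R]_d) : (dot u u == 0) = (u == 0).
Proof.
apply/eqP/eqP => [h|->]; last exact: dot0l.
apply/matrixP => i j; rewrite (ord1 j) mxE.
have /(_ _ i isT) := psumr_eq0P _ h; move=> /(_ (fun i _ => _)) h1.
have /eqP : u i 0 * u i 0 = 0 by apply: h1 => k; rewrite -expr2 sqr_ge0.
by rewrite mulf_eq0 orbb => /eqP.
Qed.

End Dot.

(** * Schur complement of the first coordinate *)

Section PosDef.
Variables (R : realType).

Definition posdef d (Q : 'M[R]_d) :=
  Q^T = Q /\ forall v : 'cV[R]_d, v != 0 -> 0 < dot v (Q *m v).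

Lemma posdef_unit d (Q : 'M[R]_d) : posdef Q -> Q \in unitmx.
Proof.
move=> [Qs Qp]; rewrite unitmxE unitfE; apply/negP => /det0P[v v0 vQ].
have := Qp v^T; rewrite trmx_eq0 v0 => /(_ isT).
by rewrite -[Q in Q *m _]Qs -trmx_mul vQ trmx0 dot0r ltxx.
Qed.

Lemma posdef_inv d (Q : 'M[R]_d) : posdef Q -> posdef (invmx Q).
Proof.
move=> Qpd; have Qu := posdef_unit Qpd; case: Qpd => Qs Qp.
split=> [|v v0]; first by rewrite trmx_inv Qs.
have -> : dot v (invmx Q *m v) = dot (invmx Q *m v) (Q *m (invmx Q *m v)).
  by rewrite mulKVmx // dotC.
apply: Qp; apply/eqP => h; move/eqP: v0; apply.
by rewrite -(mulKVmx Qu v) h mulmx0.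
Qed.

Section Schur.
Variables (d : nat) (Q : 'M[R]_(1 + d)).
Hypothesis Qpd : posdef Q.

Let q : R := Q 0 0.
Let b : 'cV[R]_d := dlsubmx Q.
Definition schur : 'M[R]_d := drsubmx Q - (Q 0 0)^-1 *: (dlsubmx Q *m (dlsubmx Q)^T).
Let S := schur.

Let Qblock : Q = block_mx q%:M b^T b (drsubmx Q).
Proof.
have ur : ursubmx Q = b^T by rewrite /b trmx_dlsub Qpd.1.
rewrite -{1}(submxK Q) ur; congr block_mx.
by rewrite [LHS]mx11_scalar; congr (_%:M); rewrite !mxE /q; congr (Q _ _); apply/val_inj.
Qed.

Let QcolE (x : R) (v : 'cV[R]_d) :
  Q *m col_mx x%:M v = col_mx (q * x + dot b v)%:M (x *: b + drsubmx Q *m v).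
Proof.
rewrite {1}Qblock mul_block_col; congr col_mx.
  rewrite -scalar_mxM; apply/matrixP => i j; rewrite !ord1 !mxE eqxx mulr1n.
  by rewrite dotE !mxE.
by rewrite mul_mx_scalar.
Qed.

Lemma schur_diag_gt0 : 0 < q.
Proof.
have := Qpd.2 (col_mx 1%:M 0); rewrite QcolE dot0r addr0 mulr1 mulmx0 addr0.
rewrite dot_col dot0l addr0 dot1 !mxE eqxx !mulr1n mul1r; apply.
by rewrite col_mx_eq0 negb_and; apply/orP; left; apply/eqP => /matrixP/(_ 0 0);
  rewrite !mxE eqxx => /eqP; rewrite oner_eq0.
Qed.

(** Completion of the square in the first coordinate. *)
Lemma schur_quad (x : R) (v : 'cV[R]_d) :
  dot (col_mx x%:M v) (Q *m col_mx x%:M v) =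
  q * (x + dot b v / q) ^+ 2 + dot v (S *m v).
Proof.
have q0 := schur_diag_gt0.
rewrite QcolE dot_col dot1 !mxE eqxx !mulr1n.
rewrite /S /schur mulmxBl dotBr -scalemxAl dotZr -mulmxA.
have -> : dot v (dlsubmx Q *m ((dlsubmx Q)^T *m v)) = dot b v ^+ 2.
  by rewrite dot_mulmx dot1 -!dotE -/b expr2.
by rewrite dotDr dotZr (dotC v b) -/q; field; rewrite gt_eqF.
Qed.

Lemma schur_posdef : posdef S.
Proof.
split=> [|v v0].
  rewrite /S /schur linearB linearZ /= trmx_mul trmxK; congr (_ - _).
  by rewrite trmx_drsub Qpd.1.
have := schur_quad (- (dot b v / q)) v; rewrite addNr expr0n mulr0 add0r => <-.
by apply: Qpd.2; rewrite col_mx_eq0 negb_and v0 orbT.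
Qed.

(** Dual counterpart of [schur_quad]: the first coordinate enters as a plain square and shifts the
    others by a multiple of [b]. The system with right-hand side (x, v) is solved explicitly in
    [hz]. *)
Lemma schur_inv (x : R) (v : 'cV[R]_d) :
  dot (col_mx x%:M v) (invmx Q *m col_mx x%:M v) =
  x ^+ 2 / q + dot (v - (x / q) *: b) (invmx S *m (v - (x / q) *: b)).
Proof.
have q0 := schur_diag_gt0; have Qu := posdef_unit Qpd.
have Su := posdef_unit schur_posdef.
set u := v - _; pose y := invmx S *m u.
have hz : invmx Q *m col_mx x%:M v = col_mx (x / q - dot b y / q)%:M y.
  apply: (can_inj (mulKmx Qu)); rewrite mulKVmx // QcolE; congr col_mx.
    by congr (_%:M); field; rewrite gt_eqF.
  have Sy : S *m y = u by rewrite /y mulKVmx.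
  have -> : drsubmx Q *m y = u + (dot b y / q) *: b.
    rewrite -Sy /S /schur mulmxBl -scalemxAl -mulmxA.
    have -> : dlsubmx Q *m ((dlsubmx Q)^T *m y) = dot b y *: b.
      by rewrite [X in _ *m X]mx11_scalar -dotE mul_mx_scalar.
    by rewrite scalerA -/q [_ / q]mulrC subrK.
  by rewrite scalerBl addrACA addNr addr0 /u addrC subrK.
have eu : dot u y = dot v y - x / q * dot b y by rewrite /u dotBl dotZl.
rewrite hz dot_col dot1 !mxE eqxx !mulr1n -/y eu.
by field; rewrite gt_eqF.
Qed.

Lemma schur_det : \det Q = q * \det S.
Proof.
have q0 := schur_diag_gt0.
have -> : Q = block_mx 1%:M 0 (q^-1 *: b) 1%:M *m block_mx q%:M b^T 0 S.
  rewrite mulmx_block !mul1mx !mul0mx !addr0 {1}Qblock; congr block_mx.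
    by rewrite mul_mx_scalar scalerA mulfV ?gt_eqF // scale1r.
  by rewrite /S /schur -scalemxAl addrC subrK.
by rewrite det_mulmx det_lblock det_ublock !det1 !mul1r det_scalar1.
Qed.

End Schur.
End PosDef.

(** * Poisson summation for Gaussians in dimension d *)

Section ThetaD.
Variable R : realType.

Definition intv d (n : 'cV[int]_d) : 'cV[R]_d := map_mx intr n.

Definition gauss d (Q : 'M[R]_d) (v : 'cV[R]_d) : R := expR (- (pi * dot v (Q *m v))).

Lemma usum_absum (T : choiceType) (x : T -> R) (b : R[i]) :
  (forall i, 0 <= x i) -> usum (fun i => (x i)%:C) b ->
  absum (fun i => (x i)%:C) (complex.Re b).
Proof.
move=> x0 xb K; under eq_bigr => i _ do rewrite cmod_real ger0_norm //.
exact: usum_ge_fset.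
Qed.

(** On the dual side of [theta1] the shift [C] occurs only in a phase; bounding the phases by 1
    leaves a constant valid for all shifts. *)
Lemma gauss1_absum (q : R) : 0 < q -> exists2 K : R, 0 <= K & forall C : R,
  absum (fun n : int => (expR (- (pi * q * (n%:~R + C) ^+ 2)))%:C : R[i]) K.
Proof.
move=> q0; have sq0 : 0 < Num.sqrt q by rewrite sqrtr_gt0.
have [S [_ hS]] := theta1 0 0 q0.
have hS' : usum (fun j : int => (expR (- (pi * (j%:~R) ^+ 2 / q)))%:C) ((Num.sqrt q)%:C * S).
  by apply: eq_usum hS => j; rewrite mulr0 oppr0 phase0 mulr1 addr0.
have aS := usum_absum (fun j => expR_ge0 _) hS'.
set M := complex.Re _ in aS.
have M0 := absum_ge0 aS.
exists (M / Num.sqrt q); first by rewrite divr_ge0 // ltW.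
move=> C; have [U [hU hU']] := theta1 C 0 q0.
have hU1 : usum (fun n : int => (expR (- (pi * q * (n%:~R + C) ^+ 2)))%:C) U.
  by apply: eq_usum hU => n; rewrite mul0r phase0 mulr1.
have UM : cmod U <= M / Num.sqrt q.
  rewrite ler_pdivlMr // mulrC -[X in X * _](gtr0_norm sq0) -cmod_real -cmodM.
  apply: (usum_cmod_le hU'); apply: absum_le aS => j.
  by rewrite cmodM cmod_phase mulr1 addr0.
move=> K; apply: le_trans (usum_absum (fun j => expR_ge0 _) hU1 K) _.
exact: le_trans (le_trans (ler_norm _) (cmod_Re _)) UM.
Qed.

Definition cons_col d (p : 'cV[int]_d * int) : 'cV[int]_(1 + d) := col_mx p.2%:M p.1.

Lemma cons_col_bij d : bijective (@cons_col d).
Proof.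
exists (fun v : 'cV[int]_(1 + d) => (dsubmx v, v 0 0)) => [[v a]|v]; rewrite /cons_col /=.
  rewrite col_mxKd; congr (_, _).
  have -> : 0 = lshift d 0 :> 'I_(1 + d) by apply/val_inj.
  by rewrite col_mxEu mxE eqxx.
rewrite -[RHS]vsubmxK; congr col_mx.
rewrite [RHS]mx11_scalar; congr (_%:M); rewrite mxE; congr (v _ _); exact/val_inj.
Qed.

Lemma intv_cons d (p : 'cV[int]_d * int) (c : 'cV[R]_(1 + d)) :
  intv (cons_col p) + c = col_mx (p.2%:~R + c 0 0)%:M (intv p.1 + dsubmx c).
Proof.
rewrite /intv /cons_col map_col_mx -{1}[c]vsubmxK add_col_mx; congr col_mx.
rewrite [usubmx c]mx11_scalar map_scalar_mx -raddfD; congr (_%:M); rewrite !mxE.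
by congr (_ + c _ _); apply/val_inj.
Qed.

Lemma gauss_cons d (Q : 'M[R]_(1 + d)) (x : R) (v : 'cV[R]_d) : posdef Q ->
  gauss Q (col_mx x%:M v) =
  expR (- (pi * Q 0 0 * (x + dot (dlsubmx Q) v / Q 0 0) ^+ 2)) * gauss (schur Q) v.
Proof. by move=> Qp; rewrite /gauss schur_quad // mulrDr opprD expRD mulrA. Qed.

(** The square in [schur_quad] is shifted by an amount depending on the other coordinates;
    uniformity in the shift lets its sum be bounded first. *)
Lemma gauss_absum d (Q : 'M[R]_d) : posdef Q -> exists M : R, forall c : 'cV[R]_d,
  absum (fun n : 'cV[int]_d => (gauss Q (intv n + c))%:C) M.
Proof.
elim: d Q => [|d IH]; last rewrite -[d.+1]/(1 + d)%N; move=> Q Qp.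
  exists 1 => c; have h (i : 'cV[int]_0) :
      i \notin [fset (0 : 'cV[int]_0)]%fset -> (gauss Q (intv i + c))%:C = 0 :> R[i].
    by rewrite inE (flatmx0 i) eqxx.
  have := absum_fin h; rewrite big_seq_fset1 cmod_real ger0_norm ?expR_ge0 //.
  by rewrite /gauss /dot big_ord0 mulr0 oppr0 expR0.
have [K K0 hK] := gauss1_absum (schur_diag_gt0 Qp).
have [M hM] := IH _ (schur_posdef Qp).
exists (K * M) => c; apply: (absum_bij (cons_col_bij d)).
apply: (@absum_prod R 'cV[int]_d int
  ((fun n : 'cV[int]_(1 + d) => (gauss Q (intv n + c))%:C) \o cons_col (d:=d)) (fun n' => K * gauss (schur Q) (intv n' + dsubmx c))).
  move=> n'; rewrite mulrC.
  have := absumZ (gauss (schur Q) (intv n' + dsubmx c))%:C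
    (hK (c 0 0 + dot (dlsubmx Q) (intv n' + dsubmx c) / Q 0 0)).
  rewrite cmod_real ger0_norm ?expR_ge0 //; apply: absum_le => n0.
  rewrite /= (intv_cons (n', n0)) gauss_cons //= -rmorphM !cmod_real.
  by rewrite mulrC addrA.
move=> L; rewrite -mulr_sumr ler_wpM2l //.
apply: le_trans (hM (dsubmx c) L); apply: ler_sum => i _.
by rewrite cmod_real ler_norm.
Qed.

Definition theta_term d (Q : 'M[R]_d) (c w : 'cV[R]_d) (n : 'cV[int]_d) : R[i] :=
  (gauss Q (intv n + c))%:C * phase (dot w (intv n)).

Definition theta_dual d (Q : 'M[R]_d) (c w : 'cV[R]_d) (k : 'cV[int]_d) : R[i] :=
  (gauss (invmx Q) (intv k + w))%:C * phase (- dot (intv k + w) c).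

Lemma theta_term_absum d (Q : 'M[R]_d) (c w : 'cV[R]_d) : posdef Q ->
  exists M, absum (theta_term Q c w) M.
Proof.
move=> /gauss_absum[M hM]; exists M; apply: absum_le (hM c) => n.
by rewrite cmodM cmod_phase mulr1.
Qed.

Lemma theta_dual_absum d (Q : 'M[R]_d) (c w : 'cV[R]_d) : posdef Q ->
  exists M, absum (theta_dual Q c w) M.
Proof.
move=> /posdef_inv/gauss_absum[M hM]; exists M; apply: absum_le (hM w) => n.
by rewrite cmodM cmod_phase mulr1.
Qed.

Lemma mulrACA_eq (a b p r s t : R[i]) : p * r = s * t ->
  a * p * (b * r) = b * s * (a * t).
Proof. by move=> h; rewrite mulrACA h; ring. Qed.

Section Step.
Variables (d : nat) (Q : 'M[R]_(1 + d)) (c w : 'cV[R]_(1 + d)).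
Hypothesis Qp : posdef Q.

Let q := Q 0 0.
Let b := dlsubmx Q.
Let x (z : R) := w 0 0 + z.
Let shift (n' : 'cV[int]_d) := c 0 0 + dot b (intv n' + dsubmx c) / q.
Let w2 (k0 : int) := dsubmx w - ((k0%:~R + w 0 0) / q) *: b.
Let D (k0 : int) : R[i] := (expR (- (pi * (k0%:~R + w 0 0) ^+ 2 / q)))%:C *
  phase (- ((k0%:~R + w 0 0) * (c 0 0 + dot b (dsubmx c) / q))).

Lemma dot_cons (p : 'cV[int]_d * int) (u : 'cV[R]_(1 + d)) :
  dot u (intv (cons_col p)) = u 0 0 * p.2%:~R + dot (dsubmx u) (intv p.1).
Proof.
have := intv_cons p 0; rewrite addr0 mxE addr0 linear0 addr0 => ->.
rewrite -{1}[u]vsubmxK dot_col dot1 !mxE eqxx mulr1n; congr (u _ _ * _ + _).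
exact/val_inj.
Qed.

Lemma theta_term_cons (n' : 'cV[int]_d) (n0 : int) :
  theta_term Q c w (cons_col (n', n0)) =
  theta_term (schur Q) (dsubmx c) (dsubmx w) n' *
  ((expR (- (pi * q * (n0%:~R + shift n') ^+ 2)))%:C * phase (w 0 0 * n0%:~R)).
Proof.
rewrite /theta_term (intv_cons (n', n0)) gauss_cons // dot_cons /= phaseD rmorphM.
by rewrite /shift addrA; ring.
Qed.

(** After Poisson summation in the first coordinate the coupling [shift n'] sits in a phase. Being
    affine in n', it splits into a constant and a change of the character to [w2 k0]. *)
Lemma theta_term_poisson (n' : 'cV[int]_d) (k0 : int) :
  theta_term (schur Q) (dsubmx c) (dsubmx w) n' *
  ((expR (- (pi * (k0%:~R + w 0 0) ^+ 2 / q)))%:C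
    * phase (- ((k0%:~R + w 0 0) * shift n'))) =
  D k0 * theta_term (schur Q) (dsubmx c) (w2 k0) n'.
Proof.
rewrite /theta_term /D.
have ph : phase (dot (dsubmx w) (intv n')) * phase (- ((k0%:~R + w 0 0) * shift n')) =
    phase (- ((k0%:~R + w 0 0) * (c 0 0 + dot b (dsubmx c) / q))) *
    phase (dot (w2 k0) (intv n')) :> R[i].
  rewrite -(phaseD (dot _ _)) -(phaseD (- _)); apply: congr1.
  by rewrite /shift /w2 dotBl dotZl dotDr; ring.
exact: mulrACA_eq ph.
Qed.

(** The shift by a multiple of [b] in [schur_inv] is the same [w2 k0]; this is where the two sides
    meet. *)
Lemma theta_dual_cons (k' : 'cV[int]_d) (k0 : int) :
  theta_dual Q c w (cons_col (k', k0)) =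
  D k0 * theta_dual (schur Q) (dsubmx c) (w2 k0) k'.
Proof.
rewrite /theta_dual (intv_cons (k', k0)) /= /gauss schur_inv // -/q -/b.
have -> : intv k' + w2 k0 = intv k' + dsubmx w - ((k0%:~R + w 0 0) / q) *: b.
  by rewrite /w2 addrA.
set v := intv k' + dsubmx w; set xx := k0%:~R + w 0 0.
set u := v - _.
rewrite mulrDr opprD expRD rmorphM /= /D -/xx mulrA.
have du : dot u (dsubmx c) = dot v (dsubmx c) - xx / q * dot b (dsubmx c).
  by rewrite /u dotBl dotZl.
have dv : dot (col_mx xx%:M v) c = xx * c 0 0 + dot v (dsubmx c).
  rewrite -{1}[c]vsubmxK dot_col dot1 !mxE eqxx mulr1n; congr (_ * c _ _ + _).
  exact/val_inj.
have ph : phase (- dot (col_mx xx%:M v) c) =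
    phase (- (xx * (c 0 0 + dot b (dsubmx c) / q))) * phase (- dot u (dsubmx c)) :> R[i].
  rewrite -(phaseD (- (xx * _))); apply: congr1; rewrite du dv; ring.
by rewrite ph mulrACA.
Qed.

End Step.

(** The first coordinate is transformed by [theta1], the others by induction for each fixed dual
    index k0. Positivity of the determinant is proved along, because the square root must be
    multiplicative in [schur_det]. *)
Theorem theta_transform d (Q : 'M[R]_d) (c w : 'cV[R]_d) : posdef Q ->
  0 < \det Q /\ exists S : R[i], usum (theta_term Q c w) S /\
    usum (theta_dual Q c w) ((Num.sqrt (\det Q))%:C * S).
Proof.
elim: d Q c w => [|d IH]; last rewrite -[d.+1]/(1 + d)%N; move=> Q c w Qp.
  rewrite det_mx00 sqrtr1; split; first exact: ltr01.
  exists 1; rewrite mulr1.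
  have z (i : 'cV[int]_0) : i \notin [fset (0 : 'cV[int]_0)]%fset = false.
    by rewrite inE (flatmx0 i) eqxx.
  have e (u v : 'cV[R]_0) : dot u v = 0 by rewrite /dot big_ord0.
  split.
    have := @usum_fin R _ (theta_term Q c w) [fset (0 : 'cV[int]_0)]%fset.
    rewrite big_seq_fset1 /theta_term /gauss !e mulr0 oppr0 expR0 phase0 mulr1.
    by apply=> i; rewrite z.
  have := @usum_fin R _ (theta_dual Q c w) [fset (0 : 'cV[int]_0)]%fset.
  rewrite big_seq_fset1 /theta_dual /gauss !e mulr0 oppr0 expR0 phase0 mulr1.
  by apply=> i; rewrite z.
have q0 := schur_diag_gt0 Qp; have Sp := schur_posdef Qp.
have dS : 0 < \det (schur Q) by have [] := IH _ 0 0 Sp.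
have sq0 : 0 <= Num.sqrt (Q 0 0) by exact: sqrtr_ge0.
split; first by rewrite schur_det // mulr_gt0.
have [M aG] := theta_term_absum c w Qp.
have [S uG _] := absum_usum aG; exists S; split => //.
pose shift (n' : 'cV[int]_d) := c 0 0 + dot (dlsubmx Q) (intv n' + dsubmx c) / Q 0 0.
pose g := theta_term (schur Q) (dsubmx c) (dsubmx w).
pose E n' (k0 : int) : R[i] := (expR (- (pi * (k0%:~R + w 0 0) ^+ 2 / Q 0 0)))%:C
    * phase (- ((k0%:~R + w 0 0) * shift n')).
have /choice[A hA] : forall n', exists A : R[i],
   usum (fun n0 : int => (expR (- (pi * Q 0 0 * (n0%:~R + shift n') ^+ 2)))%:C
      * phase (w 0 0 * n0%:~R)) A /\
   usum (E n') ((Num.sqrt (Q 0 0))%:C * A).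
  by move=> n'; exact: theta1.
have uG' : usum (fun n' => g n' * A n') S.
  have cb := cons_col_bij d.
  apply: (usum_fubini (absum_inj (bij_inj cb) aG)); first exact/(usum_bij _ _ cb).
  move=> n'; apply: eq_usum (usumZ (g n') (hA n').1) => n0.
  by rewrite /= theta_term_cons.
(* The half-transformed series, in n' and the dual k0. Its coupling is a pure phase, so a product of
   two Gaussian series dominates it and it can be summed in either order. *)
pose f (p : 'cV[int]_d * int) := g p.1 * E p.1 p.2.
have [Mf af] : exists Mf, absum f Mf.
  have [M1 aM1] := theta_term_absum (dsubmx c) (dsubmx w) Sp.
  have qi0 : 0 < (Q 0 0)^-1 by rewrite invr_gt0.
  have [K _ hK] := gauss1_absum qi0.
  exists (M1 * K); apply: absum_le (absum_mul aM1 (hK (w 0 0))) => -[n' k0] /=.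
  rewrite /f /= cmodM [X in _ <= X]cmodM; apply: ler_wpM2l; first exact: cmod_ge0.
  rewrite /E cmodM cmod_phase mulr1.
  by rewrite [pi * (k0%:~R + w 0 0) ^+ 2 / Q 0 0]mulrAC.
have [S2 uf _] := absum_usum af.
have S2E : S2 = (Num.sqrt (Q 0 0))%:C * S.
  apply: usum_unique (usumZ (Num.sqrt (Q 0 0))%:C uG').
  have h : usum (fun n' => g n' * ((Num.sqrt (Q 0 0))%:C * A n')) S2.
    by apply: (usum_fubini af uf) => n'; exact: (usumZ (g n') (hA n').2).
  by apply: eq_usum h => n'; rewrite mulrCA.
pose sw (p : int * 'cV[int]_d) := (p.2, p.1).
have swb : bijective sw by exists (fun p : 'cV[int]_d * int => (p.2, p.1)) => -[].
pose w2 (k0 : int) := dsubmx w - ((k0%:~R + w 0 0) / Q 0 0) *: dlsubmx Q.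
pose D (k0 : int) : R[i] := (expR (- (pi * (k0%:~R + w 0 0) ^+ 2 / Q 0 0)))%:C *
  phase (- ((k0%:~R + w 0 0) * (c 0 0 + dot (dlsubmx Q) (dsubmx c) / Q 0 0))).
have /choice[B hB] : forall k0, exists B : R[i],
   usum (theta_term (schur Q) (dsubmx c) (w2 k0)) B /\
   usum (theta_dual (schur Q) (dsubmx c) (w2 k0)) ((Num.sqrt (\det (schur Q)))%:C * B).
  by move=> k0; have [_] := IH (schur Q) (dsubmx c) (w2 k0) Sp.
have uDB : usum (fun k0 => D k0 * B k0) S2.
  apply: (usum_fubini (absum_inj (bij_inj swb) af)); first exact/(usum_bij _ _ swb).
  move=> k0; apply: eq_usum (usumZ (D k0) (hB k0).1) => n'.
  by rewrite /f /= -theta_term_poisson.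
have [MH aH] := theta_dual_absum c w Qp.
have [S3 uH _] := absum_usum aH.
suff <- : S3 = (Num.sqrt (\det Q))%:C * S by [].
have cb : bijective (cons_col (d := d) \o sw) by exact: bij_comp (cons_col_bij d) swb.
have h : usum (fun k0 => D k0 * ((Num.sqrt (\det (schur Q)))%:C * B k0)) S3.
  apply: (usum_fubini (absum_inj (bij_inj cb) aH)); first exact/(usum_bij _ _ cb).
  move=> k0; apply: eq_usum (usumZ (D k0) (hB k0).2) => k'.
  by rewrite /= theta_dual_cons.
have -> : (Num.sqrt (\det Q))%:C * S = (Num.sqrt (\det (schur Q)))%:C * S2.
  by rewrite S2E schur_det // sqrtrM ?ltW // rmorphM /= -mulrA mulrCA.
apply: usum_unique h _; apply: eq_usum (usumZ (Num.sqrt (\det (schur Q)))%:C uDB) => k0.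
by rewrite mulrCA.
Qed.

End ThetaD.

(** * Integrals of complex functions *)

Section CIntegral.
Variable R : realType.
Notation mu := (@lebesgue_measure R).
Implicit Type D : set R.

Definition cmeas D (f : R -> R[i]) :=
  measurable_fun D (fun u => complex.Re (f u)) /\
  measurable_fun D (fun u => complex.Im (f u)).

Definition rint D (f : R -> R) := mu.-integrable D (EFin \o f).

Definition cint D (f : R -> R[i]) :=
  rint D (fun u => complex.Re (f u)) /\ rint D (fun u => complex.Im (f u)).

Lemma eq_rint D (f g : R -> R) : measurable D -> (forall u, D u -> f u = g u) ->
  rint D f -> rint D g.
Proof.
move=> mD fg; apply: (@eq_integrable _ _ R mu D mD (EFin \o f) (EFin \o g)) => u.
by move=> /set_mem Du /=; rewrite fg.
Qed.

Lemma rintD D (f g : R -> R) : measurable D -> rint D f -> rint D g ->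
  rint D (fun u => f u + g u).
Proof.
by move=> mD hf hg; exact: (@integrableD _ _ R mu D mD (EFin \o f) (EFin \o g) hf hg).
Qed.

Lemma rintZ D (c : R) (f : R -> R) : measurable D -> rint D f ->
  rint D (fun u => c * f u).
Proof.
by move=> mD hf; exact: (@integrableZl _ _ R mu D mD c (EFin \o f) hf).
Qed.

Lemma rint_fin D (f : R -> R) : measurable D -> rint D f ->
  (\int[mu]_(u in D) (f u)%:E)%E = (\int[mu]_(u in D) f u)%:E.
Proof.
move=> mD hf; rewrite /Rintegral fineK //.
exact: (@integrable_fin_num _ _ R mu D mD (EFin \o f) hf).
Qed.

Lemma rint0 D : rint D (fun=> 0).
Proof. exact: (@integrable0 _ _ R mu D). Qed.

Lemma rint_norm D (f : R -> R) : rint D f -> rint D (fun u => `|f u|).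
Proof. exact: (@integrable_norm _ _ R mu D f). Qed.

Lemma rint_meas D (f : R -> R) : rint D f -> measurable_fun D f.
Proof. by move=> /integrableP[/measurable_EFinP]. Qed.

Lemma rintegralD D (f g : R -> R) : measurable D -> rint D f -> rint D g ->
  \int[mu]_(u in D) (f u + g u) = \int[mu]_(u in D) f u + \int[mu]_(u in D) g u.
Proof. by move=> mD hf hg; exact: (@RintegralD _ _ R mu D f g). Qed.

Lemma rintegralZ D (c : R) (f : R -> R) : measurable D -> rint D f ->
  \int[mu]_(u in D) (c * f u) = c * \int[mu]_(u in D) f u.
Proof. by move=> mD hf; exact: (@RintegralZl _ _ R mu D f c). Qed.

Lemma ReD (a b : R[i]) : complex.Re (a + b) = complex.Re a + complex.Re b.
Proof. by case: a b => [? ?] []. Qed.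

Lemma ImD (a b : R[i]) : complex.Im (a + b) = complex.Im a + complex.Im b.
Proof. by case: a b => [? ?] []. Qed.

Lemma cReM (a b : R[i]) :
  complex.Re (a * b) = complex.Re a * complex.Re b - complex.Im a * complex.Im b.
Proof. by case: a b => [? ?] []. Qed.

Lemma cImM (a b : R[i]) :
  complex.Im (a * b) = complex.Re a * complex.Im b + complex.Im a * complex.Re b.
Proof. by case: a b => [? ?] []. Qed.

Lemma RI_eq (a b : R[i]) : complex.Re a = complex.Re b ->
  complex.Im a = complex.Im b -> a = b.
Proof. by case: a b => [? ?] [? ?] /= -> ->. Qed.

Lemma cmeas_cst D c : cmeas D (fun=> c).
Proof. by split; exact: measurable_cst. Qed.

Lemma cmeasD D f g : cmeas D f -> cmeas D g -> cmeas D (fun u => f u + g u).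
Proof.
move=> [f1 f2] [g1 g2]; split.
  by under eq_fun do rewrite ReD; exact: measurable_funD.
by under eq_fun do rewrite ImD; exact: measurable_funD.
Qed.

Lemma cmeasM D f g : cmeas D f -> cmeas D g -> cmeas D (fun u => f u * g u).
Proof.
move=> [f1 f2] [g1 g2]; split.
  under eq_fun do rewrite cReM.
  by apply: measurable_funB; apply: measurable_funM.
under eq_fun do rewrite cImM.
by apply: measurable_funD; apply: measurable_funM.
Qed.

Lemma cmeas_sum D (I : Type) (r : seq I) (f : I -> R -> R[i]) :
  (forall i, cmeas D (f i)) -> cmeas D (fun u => \sum_(i <- r) f i u).
Proof.
move=> h; elim: r => [|i r IH].
  by under eq_fun do rewrite big_nil; exact: cmeas_cst.
by under eq_fun do rewrite big_cons; exact: cmeasD.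
Qed.

Lemma cmeas_cvg D (f : nat -> R -> R[i]) (g : R -> R[i]) :
  (forall n, cmeas D (f n)) -> (forall u, D u -> ccvg \oo (f^~ u) (g u)) ->
  cmeas D g.
Proof.
move=> mf fg; split.
  apply: (measurable_fun_cvg (h := fun n u => complex.Re (f n u))) => [n|u Du].
    exact: (mf n).1.
  exact: (ccvg_Re (fg u Du)).
apply: (measurable_fun_cvg (h := fun n u => complex.Im (f n u))) => [n|u Du].
  exact: (mf n).2.
exact: (ccvg_Im (fg u Du)).
Qed.

Lemma integrable_le D (f h : R -> R) : measurable D -> measurable_fun D f ->
  (forall u, D u -> `|f u| <= h u) -> rint D h ->
  rint D f.
Proof.
move=> mD mf fh ih; apply: (@le_integrable _ _ R mu D mD (EFin \o f) (EFin \o h) _ _ ih).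
  exact/measurable_EFinP.
by move=> u Du /=; rewrite lee_fin (le_trans (fh u Du)) // ler_norm.
Qed.

Lemma cint_dom D f (h : R -> R) : measurable D -> cmeas D f ->
  (forall u, D u -> cmod (f u) <= h u) -> rint D h ->
  cint D f.
Proof.
move=> mD [f1 f2] fh ih; split; apply: (integrable_le mD _ _ ih) => // u Du.
  exact: le_trans (cmod_Re _) (fh u Du).
exact: le_trans (cmod_Im _) (fh u Du).
Qed.

Lemma eq_cintegral D f g : (forall u, D u -> f u = g u) ->
  cintegral D f = cintegral D g.
Proof.
by move=> fg; congr (_ +i* _); apply: eq_Rintegral => u /set_mem Du; rewrite fg.
Qed.

Lemma eq_cint D f g : measurable D -> (forall u, D u -> f u = g u) -> cint D f -> cint D g.
Proof.
move=> mD fg [h1 h2]; split.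
  by apply: eq_rint h1 => // u Du; rewrite fg.
by apply: eq_rint h2 => // u Du; rewrite fg.
Qed.

Lemma cintD D f g : measurable D -> cint D f -> cint D g ->
  cint D (fun u => f u + g u).
Proof.
move=> mD [f1 f2] [g1 g2]; split.
  under eq_fun do rewrite ReD; exact: rintD.
by under eq_fun do rewrite ImD; exact: rintD.
Qed.

Lemma cintegralD D f g : measurable D -> cint D f -> cint D g ->
  cintegral D (fun u => f u + g u) = cintegral D f + cintegral D g.
Proof.
move=> mD [f1 f2] [g1 g2]; apply: RI_eq; rewrite ?ReD ?ImD /=.
  by rewrite -rintegralD //; apply: eq_Rintegral => u _; rewrite ReD.
by rewrite -rintegralD //; apply: eq_Rintegral => u _; rewrite ImD.
Qed.

Lemma rint_lin D (f g : R -> R) (a b : R) : measurable D ->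
  rint D f -> rint D g -> rint D (fun u => a * f u + b * g u).
Proof. by move=> mD hf hg; apply: rintD => //; apply: rintZ. Qed.

Lemma rintegral_lin D (f g : R -> R) (a b : R) : measurable D ->
  rint D f -> rint D g ->
  \int[mu]_(u in D) (a * f u + b * g u) =
  a * \int[mu]_(u in D) f u + b * \int[mu]_(u in D) g u.
Proof. by move=> mD hf hg; rewrite rintegralD ?rintegralZ //; exact: rintZ. Qed.

Lemma cintZ D c f : measurable D -> cint D f -> cint D (fun u => c * f u).
Proof.
move=> mD [f1 f2]; split.
  under eq_fun do rewrite cReM -mulNr; exact: rint_lin.
by under eq_fun do rewrite cImM; exact: rint_lin.
Qed.

Lemma cintegralZ D c f : measurable D -> cint D f ->
  cintegral D (fun u => c * f u) = c * cintegral D f.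
Proof.
move=> mD [f1 f2]; apply: RI_eq; rewrite ?cReM ?cImM /=.
  rewrite -mulNr -rintegral_lin //; apply: eq_Rintegral => u _.
  by rewrite cReM mulNr.
by rewrite -rintegral_lin //; apply: eq_Rintegral => u _; rewrite cImM.
Qed.

Lemma cint0 D : cint D (fun=> 0).
Proof. by split; exact: rint0. Qed.

Lemma cintegral0 D : cintegral D (fun=> 0) = 0.
Proof. by apply: RI_eq; rewrite /= /Rintegral integral0. Qed.

Lemma cint_sum D (I : Type) (r : seq I) (f : I -> R -> R[i]) : measurable D ->
  (forall i, cint D (f i)) -> cint D (fun u => \sum_(i <- r) f i u).
Proof.
move=> mD h; elim: r => [|i r IH].
  by under eq_fun do rewrite big_nil; exact: cint0.
by under eq_fun do rewrite big_cons; exact: cintD.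
Qed.

Lemma cintegral_sum D (I : Type) (r : seq I) (f : I -> R -> R[i]) :
  measurable D -> (forall i, cint D (f i)) ->
  cintegral D (fun u => \sum_(i <- r) f i u) = \sum_(i <- r) cintegral D (f i).
Proof.
move=> mD h; elim: r => [|i r IH].
  rewrite big_nil -[RHS](cintegral0 D); apply: eq_cintegral => u _.
  by rewrite big_nil.
rewrite big_cons -IH -cintegralD //; last exact: cint_sum.
by apply: eq_cintegral => u _; rewrite big_cons.
Qed.

Lemma Rintegral_dominated D (f : nat -> R -> R) (g h : R -> R) :
  measurable D -> (forall n, measurable_fun D (f n)) ->
  (forall u, D u -> f^~ u @ \oo --> g u) ->
  (forall n u, D u -> `|f n u| <= h u) -> rint D h ->
  \int[mu]_(u in D) f n u @[n --> \oo] --> \int[mu]_(u in D) g u.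
Proof.
move=> mD mf fg fh ih.
have mg : measurable_fun D g by exact: measurable_fun_cvg mf fg.
have [] := @dominated_convergence _ _ R mu D mD (fun n => EFin \o f n) (EFin \o g)
   (EFin \o h).
- by move=> n; apply/measurable_EFinP; exact: mf.
- by apply/measurable_EFinP.
- apply: aeW => u Du /=.
  by apply: cvg_EFin; [exact: nearW|exact: fg].
- exact: ih.
- by apply: aeW => u n Du /=; rewrite lee_fin fh.
move=> ig _ hc.
apply: (fine_cvg (f := fun n => (\int[mu]_(u in D) (f n u)%:E)%E)).
exact: eq_ind _ (fun z => _ @ \oo --> z) hc _ (rint_fin mD ig).
Qed.

Lemma cintegral_dominated D (f : nat -> R -> R[i]) (g : R -> R[i]) (h : R -> R) :
  measurable D -> (forall n, cmeas D (f n)) ->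
  (forall u, D u -> ccvg \oo (f^~ u) (g u)) ->
  (forall n u, D u -> cmod (f n u) <= h u) -> rint D h ->
  ccvg \oo (fun n => cintegral D (f n)) (cintegral D g).
Proof.
move=> mD mf fg fh ih; apply: ccvgRI => /=.
  apply: (@Rintegral_dominated D (fun n u => complex.Re (f n u)) _ h) => //.
  - by move=> n; exact: (mf n).1.
  - by move=> u Du; exact: (ccvg_Re (fg u Du)).
  - by move=> n u Du; exact: le_trans (cmod_Re _) (fh n u Du).
apply: (@Rintegral_dominated D (fun n u => complex.Im (f n u)) _ h) => //.
- by move=> n; exact: (mf n).2.
- by move=> u Du; exact: (ccvg_Im (fg u Du)).
- by move=> n u Du; exact: le_trans (cmod_Im _) (fh n u Du).
Qed.

Lemma cmod_RI (z : R[i]) : `|complex.Re z| + `|complex.Im z| <= 2 * cmod z.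
Proof. by rewrite mulr_natl mulr2n lerD // ?cmod_Re ?cmod_Im. Qed.

(** A complex integral is bounded through the integrals of |Re| and |Im|; the resulting factor 2 is
    harmless where only finiteness counts. *)
Lemma sum_cmod_cintegral D (I : Type) (r : seq I) (f : I -> R -> R[i]) (h : R -> R) :
  measurable D -> (forall i, cint D (f i)) ->
  (forall u, D u -> \sum_(i <- r) cmod (f i u) <= h u) ->
  rint D h ->
  \sum_(i <- r) cmod (cintegral D (f i)) <= 2 * \int[mu]_(u in D) h u.
Proof.
move=> mD fi fh ih.
pose F i u : R := `|complex.Re (f i u)| + `|complex.Im (f i u)|.
have i1 i : rint D (fun u => `|complex.Re (f i u)|) by exact: rint_norm (fi i).1.
have i2 i : rint D (fun u => `|complex.Im (f i u)|) by exact: rint_norm (fi i).2.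
have iF i : rint D (F i) by exact: rintD.
have hF i : cmod (cintegral D (f i)) <= \int[mu]_(u in D) F i u.
  apply: le_trans (cmod_le _) _; rewrite /F rintegralD //.
  by apply: lerD; apply: le_normr_Rintegral => //; [exact: (fi i).1|exact: (fi i).2].
have [iS eS] : rint D (fun u => \sum_(i <- r) F i u) /\
   \sum_(i <- r) \int[mu]_(u in D) F i u = \int[mu]_(u in D) \sum_(i <- r) F i u.
  elim: r {fh} => [|i r [IH1 IH2]].
    split; first by under eq_fun do rewrite big_nil; exact: rint0.
    rewrite big_nil; under eq_Rintegral do rewrite big_nil.
    by rewrite /Rintegral integral0.
  split; first by under eq_fun do rewrite big_cons; exact: rintD.
  rewrite big_cons IH2; under [RHS]eq_Rintegral do rewrite big_cons.
  by rewrite rintegralD.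
apply: le_trans (ler_sum _ (fun i _ => hF i)) _; rewrite eS -rintegralZ //.
apply: le_Rintegral => //; first exact: rintZ.
move=> u Du; apply: le_trans (_ : 2 * \sum_(i <- r) cmod (f i u) <= _).
  by rewrite mulr_sumr; apply: ler_sum => i _; exact: cmod_RI.
by apply: ler_wpM2l => //; exact: fh.
Qed.

(** * Termwise integration of unordered series *)

Section Exchange.
Variables (T : countType) (D : set R) (f : T -> R -> R[i]) (g : R -> R[i]).
Variable h : R -> R.
Hypotheses (mD : measurable D) (mf : forall n, cmeas D (f n)).
Hypothesis fh : forall u, D u -> absum (f^~ u) (h u).
Hypothesis ih : rint D h.
Hypothesis fg : forall u, D u -> usum (f^~ u) (g u).

(** Dominated convergence concerns sequences, [usum] a net. These finite sets exhaust the countable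
    type and eventually contain any given one. *)
Let K N : {fset T} := seq_fset tt (pmap choice.unpickle (iota 0 N)).

Let K_near (J : {fset T}) : \forall N \near \oo, fsubset J (K N).
Proof.
exists (\max_(i <- J) choice.pickle i).+1 => // N /= hN; apply/fsubsetP => i iJ.
rewrite seq_fsetE mem_pmap; apply/mapP; exists (choice.pickle i); last by rewrite choice.pickleK.
rewrite mem_iota /= add0n; apply: leq_trans hN; rewrite ltnS.
exact: leq_bigmax_seq.
Qed.

Let usum_K (a : T -> R[i]) S : usum a S -> ccvg \oo (fun N => \sum_(i <- K N) a i) S.
Proof.
move=> /usumP aS e /aS[J hJ].
by have := K_near J; apply: filterS => N; exact: hJ.
Qed.

Let fi n : cint D (f n).
Proof.
apply: (cint_dom mD (mf n) _ ih) => u Du.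
by have := fh Du [fset n]%fset; rewrite big_seq_fset1.
Qed.

Lemma cmeas_usum : cmeas D g.
Proof.
apply: (@cmeas_cvg D (fun N u => \sum_(i <- K N) f i u)).
  by move=> N; exact: cmeas_sum.
by move=> u Du; exact: (usum_K (fg Du)).
Qed.

Lemma absum_cintegral :
  absum (fun n => cintegral D (f n)) (2 * \int[mu]_(u in D) h u).
Proof. by move=> L; apply: sum_cmod_cintegral => // u Du; exact: fh. Qed.

(** [absum_cintegral] provides some sum of the integrals; dominated convergence along [K] identifies
    it. *)
Lemma usum_cintegral : usum (fun n => cintegral D (f n)) (cintegral D g).
Proof.
have [S uS _] := absum_usum absum_cintegral.
suff -> : cintegral D g = S by [].
apply: ccvg_unique (usum_K uS).
have : ccvg \oo (fun N => cintegral D (fun u => \sum_(i <- K N) f i u)) (cintegral D g).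
  apply: (@cintegral_dominated D _ g h) => // [N|u Du|N u Du].
  - exact: cmeas_sum.
  - exact: (usum_K (fg Du)).
  - exact: le_trans (cmod_sum _ _) (fh Du _).
by apply: near_ccvg; apply: nearW => N; rewrite cintegral_sum.
Qed.

End Exchange.

End CIntegral.

(** * Integrals over exhausting compact intervals *)

Section Calculus.
Variable R : realType.
Notation mu := (@lebesgue_measure R).
Implicit Type D : set R.

Lemma pos_within (f : R -> R) (a b : R) : 0 < a ->
  (forall u : R, 0 < u -> {for u, continuous f}) -> {within `[a, b], continuous f}.
Proof.
move=> a0 cf; apply: continuous_in_subspaceT => u /set_mem /=.
by rewrite in_itv /= => /andP[au _]; apply: cf; exact: lt_le_trans a0 au.
Qed.

Lemma pos_LR (F f : R -> R) (a b : R) : 0 < a -> a < b ->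
  (forall u : R, 0 < u -> is_derive u 1 F (f u)) -> derivable_oo_LRcontinuous F a b.
Proof.
move=> a0 ab dF.
have cF (u : R) : 0 < u -> {for u, continuous F}.
  by move=> u0; apply/differentiable_continuous/derivable1_diffP; have := dF u u0; case.
have [] := (continuous_within_itvP F ab).1 (@pos_within _ a b a0 cF) => _ h1 h2.
split => // u; rewrite in_itv /= => /andP[au _].
by have := dF u (lt_trans a0 au); case.
Qed.

Lemma ftc_pos (F f : R -> R) (a b : R) : 0 < a -> a < b ->
  (forall u : R, 0 < u -> is_derive u 1 F (f u)) ->
  (forall u : R, 0 < u -> {for u, continuous f}) ->
  (\int[mu]_(u in `[a, b]) (f u)%:E = (F b - F a)%:E)%E.
Proof.
move=> a0 ab dF cf; rewrite EFinB; apply: continuous_FTC2 => //.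
- exact: pos_within.
- exact: pos_LR dF.
move=> u; rewrite in_itv /= => /andP[au _].
by rewrite derive1E; have := dF u (lt_trans a0 au) => -[_ ->].
Qed.

Lemma subst_incr (F w f : R -> R) (a b : R) : 0 < a -> a < b ->
  (forall u : R, 0 < u -> is_derive u 1 F (w u)) ->
  (forall u : R, 0 < u -> {for u, continuous w}) ->
  (forall u v : R, 0 < u -> u < v -> F u < F v) ->
  (forall u : R, 0 < u -> 0 < F u) ->
  (forall u : R, 0 < u -> {for u, continuous f}) ->
  (\int[mu]_(v in `[F a, F b]) (f v)%:E = \int[mu]_(u in `[a, b]) (w u * f (F u))%:E)%E.
Proof.
move=> a0 ab dF cw iF F0 cf.
have eF (u : R) : 0 < u -> derive1 F u = w u.
  by move=> u0; rewrite derive1E; have := dF u u0 => -[_ ->].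
have cF (u : R) : 0 < u -> {for u, continuous (derive1 F)}.
  move=> u0; rewrite /prop_for /continuous_at eF //; apply: cvg_trans (cw u u0).
  apply: near_eq_cvg; have : \forall v \near u, 0 < v by exact: lt_nbhsr.
  by apply: filterS => v v0; rewrite eF.
have [_ h1 h2] := (continuous_within_itvP _ ab).1 (@pos_within _ a b a0 cF).
rewrite integration_by_substitution_increasing.
- apply: eq_integral => u /set_mem; rewrite /= in_itv /= => /andP[au _].
  by congr (_%:E); rewrite /= -eF ?(lt_le_trans a0) // mulrC.
- exact: ltW.
- move=> u v; rewrite !in_itv /= => /andP[au _] _; apply: iF; exact: lt_le_trans a0 au.
- by move=> u; rewrite in_itv /= => /andP[au _]; apply: cF; exact: lt_trans a0 au.
- by apply/cvg_ex; exists (derive1 F a).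
- by apply/cvg_ex; exists (derive1 F b).
- exact: pos_LR dF.
- exact: pos_within (F0 _ a0) cf.
Qed.

Lemma subst_decr (F w f : R -> R) (a b : R) : 0 < a -> a < b ->
  (forall u : R, 0 < u -> is_derive u 1 F (- w u)) ->
  (forall u : R, 0 < u -> {for u, continuous w}) ->
  (forall u v : R, 0 < u -> u < v -> F v < F u) ->
  (forall u : R, 0 < u -> 0 < F u) ->
  (forall u : R, 0 < u -> {for u, continuous f}) ->
  (\int[mu]_(v in `[F b, F a]) (f v)%:E = \int[mu]_(u in `[a, b]) (w u * f (F u))%:E)%E.
Proof.
move=> a0 ab dF cw iF F0 cf.
have eF (u : R) : 0 < u -> derive1 F u = - w u.
  by move=> u0; rewrite derive1E; have := dF u u0 => -[_ ->].
have cF (u : R) : 0 < u -> {for u, continuous (derive1 F)}.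
  move=> u0; rewrite /prop_for /continuous_at eF //.
  apply: cvg_trans (cvgN (cw u u0)).
  apply: near_eq_cvg; have : \forall v \near u, 0 < v by exact: lt_nbhsr.
  by apply: filterS => v v0; rewrite eF.
have [_ h1 h2] := (continuous_within_itvP _ ab).1 (@pos_within _ a b a0 cF).
rewrite integration_by_substitution_decreasing.
- apply: eq_integral => u /set_mem; rewrite /= in_itv /= => /andP[au _].
  congr (_%:E); rewrite mulrC /= -[w u]opprK -eF //; exact: lt_le_trans a0 au.
- exact: ltW.
- move=> u v; rewrite !in_itv /= => _ /andP[au _]; apply: iF; exact: lt_le_trans a0 au.
- by move=> u; rewrite in_itv /= => /andP[au _]; apply: cF; exact: lt_trans a0 au.
- by apply/cvg_ex; exists (derive1 F a).
- by apply/cvg_ex; exists (derive1 F b).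
- exact: pos_LR dF.
- exact: pos_within (F0 _ (lt_trans a0 ab)) cf.
Qed.

Section Exhaust.
Variables (D : set R) (E : nat -> set R).
Hypotheses (mE : forall n, measurable (E n)) (EE : forall n, E n `<=` E n.+1).
Hypothesis ED : \bigcup_n E n = D.

Let EH : {homo E : n m / (n <= m)%N >-> (n <= m)%O}.
Proof.
by apply: homo_leq => [A|A B C|n]; [exact: le_refl|exact: le_trans|apply/subsetPset; exact: EE].
Qed.

Let mD : measurable D. Proof. by rewrite -ED; exact: bigcup_measurable. Qed.

Lemma integral_exhaust (f : R -> R) : measurable_fun D f ->
  (forall u, D u -> 0 <= f u) ->
  (\int[mu]_(u in E n) (f u)%:E @[n --> \oo] --> \int[mu]_(u in D) (f u)%:E)%E.
Proof.
move=> mf f0; rewrite -ED; apply: ge0_nondecreasing_set_cvg_integral => //.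
  move=> n; apply/measurable_EFinP; apply: measurable_funS mf => //.
  by rewrite -ED; exact: bigcup_sup.
by move=> n u Eu; rewrite lee_fin f0 // -ED; exists n.
Qed.

Lemma rint_exhaust (f : R -> R) (M : R) : measurable_fun D f ->
  (forall u, D u -> 0 <= f u) ->
  (forall n, (\int[mu]_(u in E n) (f u)%:E <= M%:E)%E) -> rint D f.
Proof.
move=> mf f0 hM; apply/integrableP; split; first exact/measurable_EFinP.
apply: (@le_lt_trans _ _ M%:E); last exact: ltry.
under eq_integral => u /set_mem Du do rewrite /= ger0_norm ?f0 //.
have h := integral_exhaust mf f0.
rewrite -(cvg_lim _ h) //; apply: lime_le; first by apply/cvg_ex; eexists; exact: h.
exact: nearW.
Qed.

Lemma Rintegral_exhaust (f : R -> R) : rint D f ->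
  \int[mu]_(u in E n) f u @[n --> \oo] --> \int[mu]_(u in D) f u.
Proof.
move=> fi; have ES n : E n `<=` D by rewrite -ED; exact: bigcup_sup.
have h n : \int[mu]_(u in E n) f u = \int[mu]_(u in D) (f \_ (E n)) u.
  by rewrite -Rintegral_mkcondr setIidr.
under eq_fun do rewrite h.
apply: (Rintegral_dominated (h := fun u => `|f u|)) => //.
- move=> n; apply/(measurable_restrict _ (mE n) mD); rewrite setIidr //.
  exact: measurable_funS (rint_meas fi).
- move=> u; rewrite -ED => -[n _ En]; apply: cvg_near_cst.
  exists n => // m /= nm; rewrite patchE mem_set //.
  by have /subsetPset := EH nm; apply.
- by move=> n u Du; rewrite patchE; case: ifP; rewrite ?normr0 ?normr_ge0.
- exact: rint_norm.
Qed.

End Exhaust.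

(** Carries a substitution rule from compact intervals to their unions by monotone convergence on
    both sides. *)
Lemma subst_limit (D D' : set R) (E E' : nat -> set R) (f g : R -> R) :
  (forall n, measurable (E n)) -> (forall n, E n `<=` E n.+1) -> \bigcup_n E n = D ->
  (forall n, measurable (E' n)) -> (forall n, E' n `<=` E' n.+1) -> \bigcup_n E' n = D' ->
  measurable_fun D' f -> measurable_fun D g ->
  (forall u, D' u -> 0 <= f u) -> (forall u, D u -> 0 <= g u) ->
  (forall n, \int[mu]_(u in E' n) (f u)%:E = \int[mu]_(u in E n) (g u)%:E)%E ->
  (\int[mu]_(u in D') (f u)%:E = \int[mu]_(u in D) (g u)%:E)%E.
Proof.
move=> mE EE ED mE' EE' ED' mf mg f0 g0 fg.
have h := integral_exhaust mE EE ED mg g0.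
have h' := integral_exhaust mE' EE' ED' mf f0.
apply: (cvg_unique _ h'); first exact: ereal_hausdorff.
by apply: cvg_trans h; apply: near_eq_cvg; apply: nearW => n /=; rewrite fg.
Qed.

End Calculus.

Section Substitution.
Variable R : realType.
Notation mu := (@lebesgue_measure R).
Implicit Type D : set R.

(** Continuity on the positive half-line only, the domain of the powers and logarithms to be
    integrated. *)
Definition pcont (f : R -> R) := forall u : R, 0 < u -> {for u, continuous f}.

Definition cpcont (f : R -> R[i]) := forall u : R, 0 < u -> ccvg (nbhs u) f (f u).

Lemma archi_pair (x y : R) : 0 < x -> exists n : nat, n.+1%:R^-1 <= x /\ y <= n.+1%:R.
Proof.
move=> x0; exists (Num.truncn (Num.max x^-1 y)).
have := truncnS_gt (Num.max x^-1 y); rewrite gt_max => /andP[h1 h2].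
split; last exact: ltW.
by rewrite invf_ple ?posrE // ltW.
Qed.

Lemma pcont_meas (f : R -> R) D : D `<=` `]0, +oo[ -> measurable D -> pcont f ->
  measurable_fun D f.
Proof.
move=> D0 mD cf; have h : measurable_fun (`]0, +oo[%classic : set R) f.
  apply: open_continuous_measurable_fun; first exact: interval_open.
  by move=> u /set_mem /=; rewrite in_itv /= andbT; exact: cf.
by apply: measurable_funS h => //; exact: measurable_itv.
Qed.

Lemma cpcont_meas (f : R -> R[i]) D : D `<=` `]0, +oo[ -> measurable D -> cpcont f ->
  cmeas D f.
Proof.
move=> D0 mD cf; split; apply: pcont_meas => // u u0.
  exact: (ccvg_Re (cf u u0)).
exact: (ccvg_Im (cf u u0)).
Qed.

Definition ray (m : R) (n : nat) : set R := `[m + n.+1%:R^-1, m + n.+1%:R].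

Lemma natSinv_le (n : nat) : n.+2%:R^-1 <= n.+1%:R^-1 :> R.
Proof. by rewrite lef_pV2 ?posrE ?ltr0n // ler_nat. Qed.

Lemma natSinv_gt0 (n : nat) : 0 < n.+1%:R^-1 :> R.
Proof. by rewrite invr_gt0 ltr0n. Qed.

Lemma ray_sub m n : ray m n `<=` ray m n.+1.
Proof.
move=> u; rewrite /ray /= !in_itv /= => /andP[h1 h2]; apply/andP; split.
  by apply: le_trans h1; rewrite lerD2l natSinv_le.
by apply: le_trans h2 _; rewrite lerD2l ler_nat.
Qed.

Lemma ray_bigcup m : \bigcup_n ray m n = `]m, +oo[%classic.
Proof.
apply/seteqP; split=> u /=.
  move=> [n _]; rewrite /ray /= !in_itv /= andbT => /andP[h _].
  by apply: lt_le_trans h; rewrite ltrDl natSinv_gt0.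
rewrite in_itv /= andbT => mu0; have [n [h1 h2]] := @archi_pair (u - m) (u - m) ltac:(by rewrite subr_gt0).
by exists n => //; rewrite /ray /= in_itv /= -lerBrDl h1 -lerBlDl.
Qed.

Lemma ray_measurable m n : measurable (ray m n).
Proof. exact: measurable_itv. Qed.

(** The offset 3 gives 1/(n + 3) < 1 - 1/(n + 3), so no interval is degenerate. *)
Definition segm (n : nat) : set R := `[n.+3%:R^-1, 1 - n.+3%:R^-1].

Lemma natS3_le (n : nat) : n.+3%:R^-1 <= 3^-1 :> R.
Proof. by rewrite lef_pV2 ?posrE ?ltr0n // ler_nat. Qed.

Lemma segm_sub n : segm n `<=` segm n.+1.
Proof.
move=> u; rewrite /segm /= !in_itv /= => /andP[h1 h2].
by move: (n.+3%:R^-1) (n.+4%:R^-1) (natSinv_le n.+2) h1 h2 => v w; lra.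
Qed.

Lemma segm_bigcup : \bigcup_n segm n = `]0, 1[%classic.
Proof.
apply/seteqP; split=> u /=.
  move=> [n _]; rewrite /segm /= !in_itv /=.
  by move: (n.+3%:R^-1) (natSinv_gt0 n.+2) => v; lra.
rewrite in_itv /= => /andP[u0 u1].
have [n [h1 _]] : exists n : nat, n.+1%:R^-1 <= Num.min u (1 - u) /\ 0 <= n.+1%:R :> R.
  by apply: archi_pair; rewrite lt_min u0 subr_gt0.
exists n => //; rewrite /segm /= in_itv /=; move: h1; rewrite le_min => /andP[].
by move: (n.+1%:R^-1) (n.+2%:R^-1) (n.+3%:R^-1) (natSinv_le n) (natSinv_le n.+1) => v w z; lra.
Qed.

Lemma scale_ge0 (a m : R) (f : R -> R) : 0 < a -> 0 <= m -> pcont f ->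
  (forall u : R, 0 <= f u) ->
  (\int[mu]_(u in `](a * m)%R, +oo[) (f u)%:E)%E =
   (\int[mu]_(u in `]m, +oo[) (a * f (a * u))%:E)%E.
Proof.
move=> a0 m0 cf f0.
have ca : continuous (fun u : R => a * u) by move=> u; exact: mulrl_continuous.
have cg : pcont (fun u => a * f (a * u)).
  move=> u u0; apply: cvgM; first exact: cvg_cst.
  apply: (@continuous_comp _ _ _ ( *%R a) f); first exact: ca.
  by apply: cf; rewrite mulr_gt0.
apply: (subst_limit (E := ray m)
   (E' := fun n => `[a * (m + n.+1%:R^-1), a * (m + n.+1%:R)]%classic)).
- exact: ray_measurable.
- exact: ray_sub.
- exact: ray_bigcup.
- by move=> n; exact: measurable_itv.
- move=> n u /=; rewrite !in_itv /= => /andP[h1 h2]; apply/andP; split.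
    by apply: le_trans h1; rewrite ler_pM2l // lerD2l natSinv_le.
  by apply: le_trans h2 _; rewrite ler_pM2l // lerD2l ler_nat.
- have -> : `]a * m, +oo[%classic = [set u | `]m, +oo[%classic (u / a)].
    by apply/seteqP; split => u /=; rewrite !in_itv /= !andbT ltr_pdivlMr // mulrC.
  rewrite -ray_bigcup; apply/seteqP; split => u [n _ h]; exists n => //.
    by move: h; rewrite /ray /= !in_itv /= ler_pdivlMr // ler_pdivrMr // ![_ * a]mulrC.
  by move: h; rewrite /ray /= !in_itv /= ler_pdivlMr // ler_pdivrMr // ![_ * a]mulrC.
- apply: pcont_meas => // u /=; rewrite !in_itv /= !andbT; apply: le_lt_trans.
  by rewrite mulr_ge0 // ltW.
- apply: pcont_meas => // u /=; rewrite !in_itv /= !andbT; exact: le_lt_trans.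
- by move=> u _; exact: f0.
- by move=> u _; rewrite mulr_ge0 // ltW.
move=> n; have n0 := natSinv_gt0 n.
(* For n = 0 the interval is the single point m + 1, outside the scope of [subst_incr]; both
   integrals are 0. *)
case: n n0 => [|n] n0.
  by rewrite /ray invr1 !set_itv1 !integral_set1.
apply: (@subst_incr R ( *%R a) (fun=> a)) => //.
- by rewrite ltr_wpDl.
- rewrite ltrD2l (@lt_trans _ _ 1) //; first by rewrite invf_lt1 ?ltr0n ?ltr1n.
  by rewrite ltr1n.
- move=> u u0; have := is_deriveZ a (is_derive_id u 1); rewrite [a *: 1]mulr1; exact.
- by move=> u _; exact: cvg_cst.
- by move=> u v _ uv; rewrite ltr_pM2l.
- by move=> u u0; rewrite mulr_gt0.
Qed.

Lemma inv_ge0 (f : R -> R) : pcont f -> (forall u : R, 0 <= f u) ->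
  (\int[mu]_(u in `](1 : R)%R, +oo[) (f u)%:E)%E =
   (\int[mu]_(u in `](0 : R)%R, 1%R[) (u ^- 2 * f u^-1)%:E)%E.
Proof.
move=> cf f0.
have ci (u : R) : 0 < u -> {for u, continuous (@GRing.inv R)}.
  by move=> u0; apply: inv_continuous; rewrite gt_eqF.
have cw : pcont (fun u => u ^- 2).
  move=> u u0; apply: cvgV; first by rewrite expf_neq0 // gt_eqF.
  exact: exprn_continuous.
have cg : pcont (fun u => u ^- 2 * f u^-1).
  move=> u u0; apply: cvgM; first exact: cw.
  apply: (@continuous_comp _ _ _ (@GRing.inv R) f); first exact: ci.
  by apply: cf; rewrite invr_gt0.
have s0 n : 0 < 1 - n.+3%:R^-1 :> R by move: (n.+3%:R^-1) (natS3_le n) => v; lra.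
apply: (subst_limit (E := segm) (E' := fun n => `[(1 - n.+3%:R^-1)^-1, n.+3%:R^-1^-1]%classic)).
- by move=> n; exact: measurable_itv.
- exact: segm_sub.
- exact: segm_bigcup.
- by move=> n; exact: measurable_itv.
- move=> n u /=; rewrite !in_itv /= => /andP[h1 h2]; apply/andP; split.
    apply: le_trans h1; rewrite lef_pV2 ?posrE //.
    by move: (n.+3%:R^-1) (n.+4%:R^-1) (natSinv_le n.+2) => v w; lra.
  by apply: le_trans h2 _; rewrite !invrK ler_nat.
- have -> : `]1, +oo[%classic = [set u : R | `]0, 1[%classic u^-1].
    apply/seteqP; split => u /=; rewrite !in_itv /= !andbT => h.
      by have u0 : 0 < u by [exact: lt_trans h]; rewrite invr_gt0 u0 invf_lt1.
    by case/andP: h; rewrite invr_gt0 => u0; rewrite invf_lt1.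
  rewrite -segm_bigcup; apply/seteqP; split => u [n _ h]; exists n => //.
    move: h; rewrite /segm /= !in_itv /= => /andP[h1 h2].
    have u0 : 0 < u by apply: lt_le_trans h1; rewrite invr_gt0.
    by rewrite -[X in X <= u^-1]invrK lef_pV2 ?posrE ?invr_gt0 // h2 /= invf_ple ?posrE.
  move: h; rewrite /segm /= !in_itv /= => /andP[h1 h2].
  have u0 : 0 < u by rewrite -invr_gt0; apply: lt_le_trans h1; exact: natSinv_gt0.
  by rewrite invf_ple ?posrE // h2 /= -[u]invrK lef_pV2 ?posrE ?invr_gt0.
- apply: pcont_meas => // u /=; rewrite !in_itv /= !andbT; exact: lt_trans.
- by apply: pcont_meas => // u /=; rewrite !in_itv /= !andbT => /andP[].
- by move=> u _; exact: f0.
- by move=> u _; rewrite mulr_ge0 // -exprVn sqr_ge0.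
move=> n; apply: (@subst_decr R (@GRing.inv R) (fun u => u ^- 2)) => //.
- by move: (n.+3%:R^-1) (natS3_le n) => v; lra.
- move=> u u0; have u1 : u != 0 by rewrite gt_eqF.
  have := is_deriveV u1 (is_derive_id u 1).
  by rewrite /GRing.scale /= mulr1.
- by move=> u v u0 uv; rewrite ltf_pV2 ?posrE // (lt_trans u0).
- by move=> u u0; rewrite invr_gt0.
Qed.

Lemma pcont_max0 (f : R -> R) : pcont f -> pcont (fun u => Num.max (f u) 0).
Proof.
move=> cf u u0; rewrite /prop_for /continuous_at.
have e x : Num.max x 0 = (x + `|x|) / 2 :> R.
  by case: (lerP x 0) => h; [rewrite ler0_norm // subrr mul0r|rewrite gtr0_norm //; lra].
rewrite e; under eq_fun do rewrite e.
apply: cvgM; last exact: cvg_cst.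
apply: cvgD; first exact: cf.
by apply: cvg_norm; exact: cf.
Qed.

Lemma pcontN (f : R -> R) : pcont f -> pcont (fun u => - f u).
Proof. by move=> cf u u0; apply: cvgN; exact: cf. Qed.

(** The nonnegative rule is applied to positive and negative parts, with which the weight,
    nonnegative on [D], commutes. *)
Lemma subst_signed (D D' : set R) (w F : R -> R) :
  (forall u, D u -> 0 <= w u) ->
  (forall g, pcont g -> (forall u, 0 <= g u) ->
    (\int[mu]_(u in D') (g u)%:E)%E = (\int[mu]_(u in D) (w u * g (F u))%:E)%E) ->
  forall f, pcont f ->
  \int[mu]_(u in D') f u = \int[mu]_(u in D) (w u * f (F u)).
Proof.
move=> w0 H f cf; rewrite /Rintegral; congr fine.
rewrite integralE [RHS]integralE.
have m0 (x : R) : 0 <= Num.max x 0 by rewrite le_max lexx orbT.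
have wm u x : D u -> w u * Num.max x 0 = Num.max (w u * x) 0.
  by move=> Du; rewrite maxr_pMr ?w0 // mulr0.
have := H _ (pcont_max0 cf) (fun u => m0 _).
have := H _ (pcont_max0 (pcontN cf)) (fun u => m0 _).
move=> h1 h2; congr (_ - _)%E.
  transitivity (\int[mu]_(u in D') (Num.max (f u) 0)%:E)%E.
    by apply: eq_integral => u _; rewrite funeposE EFin_max.
  rewrite h2; apply: eq_integral => u /set_mem Du.
  by rewrite funeposE wm // EFin_max.
transitivity (\int[mu]_(u in D') (Num.max (- f u) 0)%:E)%E.
  by apply: eq_integral => u _; rewrite funenegE EFin_max.
rewrite h1; apply: eq_integral => u /set_mem Du.
by rewrite funenegE wm // EFin_max mulrN.
Qed.

Lemma ReZ (a : R) (z : R[i]) : complex.Re (a%:C * z) = a * complex.Re z.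
Proof. by case: z => x y /=; rewrite mul0r subr0. Qed.

Lemma ImZ (a : R) (z : R[i]) : complex.Im (a%:C * z) = a * complex.Im z.
Proof. by case: z => x y /=; rewrite mul0r addr0. Qed.

Lemma csubst (D D' : set R) (w F : R -> R) :
  (forall f, pcont f ->
    \int[mu]_(u in D') f u = \int[mu]_(u in D) (w u * f (F u))) ->
  forall f, cpcont f ->
  cintegral D' f = cintegral D (fun u => (w u)%:C * f (F u)).
Proof.
move=> H f cf; apply: RI_eq => /=; rewrite H.
- by apply: eq_Rintegral => u _; exact/esym/ReZ.
- by move=> u u0; exact: (ccvg_Re (cf u u0)).
- by apply: eq_Rintegral => u _; exact/esym/ImZ.
- by move=> u u0; exact: (ccvg_Im (cf u u0)).
Qed.

Lemma cintegral_scale (a m : R) f : 0 < a -> 0 <= m -> cpcont f ->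
  cintegral `]a * m, +oo[ f = cintegral `]m, +oo[ (fun u => a%:C * f (a * u)).
Proof.
move=> a0 m0; apply: (csubst (w := fun=> a)); apply: subst_signed => [u _|g cg g0].
  exact: ltW.
exact: scale_ge0.
Qed.

Lemma cintegral_inv f : cpcont f ->
  cintegral `]1, +oo[ f = cintegral `]0, 1[ (fun u => (u ^- 2)%:C * f u^-1).
Proof.
apply: (csubst (w := fun u => u ^- 2)); apply: subst_signed => [u _|g cg g0].
  by rewrite -exprVn sqr_ge0.
exact: inv_ge0.
Qed.

End Substitution.

(** * Complex powers and Mellin integrals *)

Section Cpow.
Variable R : realType.
Notation mu := (@lebesgue_measure R).

Lemma natC n : n%:R = (n%:R)%:C :> R[i].
Proof. by rewrite rmorph_nat. Qed.

Definition exp_term (w : R[i]) (k : nat) : R[i] := w ^+ k / k`!%:R.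

Lemma cmod_exp_term w k : cmod (exp_term w k) = exp_coeff (cmod w) k.
Proof.
by rewrite /exp_term /exp_coeff /= cmodM cmodX cmodV natC cmod_real normr_nat.
Qed.

Lemma series_exp_le (x : R) n : 0 <= x -> series (exp_coeff x) n <= expR x.
Proof.
move=> x0; apply: nondecreasing_cvgn_le; last exact: is_cvg_series_exp_coeff.
apply: nondecreasing_series => k _ _; exact: exp_coeff_ge0.
Qed.

Lemma absum_exp_term w : absum (exp_term w) (expR (cmod w)).
Proof.
move=> K; pose N := (\max_(i <- K) i).+1.
apply: le_trans (series_exp_le N (cmod_ge0 w)).
under eq_bigr do rewrite cmod_exp_term.
have p := perm_fset_iota N.
rewrite /series /= /index_iota subn0 -(perm_big _ p) /=.
have KN : fsubset K (seq_fset tt (iota 0 N)).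
  apply/fsubsetP => i iK; rewrite seq_fsetE mem_iota /= add0n ltnS.
  exact: leq_bigmax_seq.
rewrite (big_fset_subset _ KN) lerDl; apply: sumr_ge0 => i _.
by apply: exp_coeff_ge0; exact: cmod_ge0.
Qed.

Lemma usum_exp_real (x : R) : usum (exp_term x%:C) (expR x)%:C.
Proof.
apply: (series_usum (absum_exp_term _)).
have h : ccvg \oo (fun n => (series (exp_coeff x) n)%:C) (expR x)%:C.
  by apply: ccvg_real; exact: is_cvg_series_exp_coeff.
apply: near_ccvg h; apply: nearW => n; rewrite /series /= rmorph_sum /=.
by apply: eq_bigr => k _; rewrite rmorphM rmorphXn fmorphV /= rmorph_nat.
Qed.

(** Shaped after [cos_coeff] and [sin_coeff]. At k = 0 the truncated predecessor is harmless because
    its factor [odd k] vanishes. *)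
Lemma expIm (y : R) k : (0 +i* y) ^+ k =
  ((~~ odd k)%:R * (-1) ^+ k./2 * y ^+ k) +i* ((odd k)%:R * (-1) ^+ k.-1./2 * y ^+ k).
Proof.
elim/ltn_ind: k => -[_|[_|k IH]].
- by rewrite !expr0; apply: RI_eq; rewrite /= ?mul0r ?mulr1.
- by rewrite !expr1 !expr0; apply: RI_eq; rewrite /= ?mul0r ?mul1r.
rewrite -[k.+2]addn2 exprD IH ?leqnSn // addn2 /= negbK.
have -> : (0 +i* y) ^+ 2 = - (y ^+ 2) +i* 0 :> R[i].
  by rewrite expr2 /GRing.mul /= !(mul0r, mulr0, add0r, addr0) expr2.
have -> : k./2.+1 = (1 + k./2)%N by [].
apply: RI_eq; rewrite /= mulr0 ?subr0 ?add0r ?addr0.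
  by rewrite [(-1) ^+ (1 + _)]exprS -[k.+2]addn2 [y ^+ (_ + _)]exprD; ring.
case: k {IH} => [|k] /=; first by rewrite !mul0r.
by rewrite negbK !exprS; ring.
Qed.

Lemma usum_exp_imag (y : R) : usum (exp_term (0 +i* y)) (cos y +i* sin y).
Proof.
apply: (series_usum (absum_exp_term _)).
have e k : exp_term (0 +i* y) k = cos_coeff y k +i* sin_coeff y k.
  rewrite /exp_term expIm natC -fmorphV mulrC /=.
  by apply: RI_eq; rewrite ?ReZ ?ImZ /= mulrC.
apply: ccvgRI => /=.
  have h : series (cos_coeff y) @ \oo --> cos y.
    by rewrite unlock; exact: is_cvg_series_cos_coeff.
  apply: cvg_trans h; apply: near_eq_cvg; apply: nearW => n.
  by rewrite /series /= Re_sum; apply: eq_bigr => k _; rewrite e.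
have h : series (sin_coeff y) @ \oo --> sin y.
  by rewrite unlock; exact: is_cvg_series_sin_coeff.
apply: cvg_trans h; apply: near_eq_cvg; apply: nearW => n.
by rewrite /series /= Im_sum; apply: eq_bigr => k _; rewrite e.
Qed.

Lemma fact_neq0 k : k`!%:R != 0 :> R[i].
Proof. by rewrite pnatr_eq0 -lt0n fact_gt0. Qed.

(** [cexp] is built from real functions; by the binomial theorem the Cauchy product of their series
    is the exponential series at w. *)
Lemma usum_exp (w : R[i]) : usum (exp_term w) (cexp w).
Proof.
have -> : cexp w = (expR (complex.Re w))%:C * (cos (complex.Im w) +i* sin (complex.Im w)) by [].
set x := complex.Re w; set y := complex.Im w.
have [h _] := usum_cauchy_prod (absum_exp_term x%:C) (absum_exp_term (0 +i* y))
  (usum_exp_real x) (usum_exp_imag y).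
apply: eq_usum h => n; rewrite /cauchy_prod /exp_term.
have -> : w = 0 +i* y + x%:C.
  by apply: RI_eq; rewrite ?ReD ?ImD /= ?add0r ?addr0.
rewrite exprDn mulr_suml; apply: eq_bigr => i _.
have ni : (i <= n)%N by rewrite -ltnS.
have := bin_fact ni => /(congr1 (fun k => k%:R : R[i])).
rewrite !natrM => hb.
rewrite -[in RHS]mulr_natr.
have f1 := fact_neq0 i; have f2 := fact_neq0 (n - i); have f3 := fact_neq0 n.
rewrite -[n`!%:R]hb in f3 *.
have f4 : 'C(n, i)%:R != 0 :> R[i] by rewrite pnatr_eq0 -lt0n bin_gt0.
by field; rewrite f1 f2 f4.
Qed.

Lemma cmod_cpow (u : R) s : cmod (cpow u s) = expR (complex.Re s * ln u).
Proof. by rewrite /cpow cmod_cexp mulrC ReZ mulrC. Qed.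

Lemma cpow_neq0 (u : R) s : cpow u s != 0.
Proof. exact: cexp_neq0. Qed.

Lemma cpowD (u : R) s t : cpow u (s + t) = cpow u s * cpow u t.
Proof. by rewrite /cpow mulrDl cexpD. Qed.

Lemma cpow0 (u : R) : cpow u 0 = 1.
Proof. by rewrite /cpow mul0r cexp0. Qed.

Lemma cpowN (u : R) s : cpow u (- s) = (cpow u s)^-1.
Proof.
by apply: (mulfI (cpow_neq0 u s)); rewrite -cpowD subrr cpow0 divff // cpow_neq0.
Qed.

Lemma cpow_real (u a : R) : cpow u a%:C = (expR (a * ln u))%:C.
Proof. by rewrite /cpow -rmorphM cexp_real. Qed.

Lemma cpow_1 (u : R) : 0 < u -> cpow u 1 = u%:C.
Proof. by move=> u0; rewrite -[1]/(1%:C) cpow_real mul1r lnK. Qed.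

Lemma cpow_1l s : cpow (1 : R) s = 1.
Proof. by rewrite /cpow ln1 mulr0 cexp0. Qed.

Lemma cpowMl (u v : R) s : 0 < u -> 0 < v -> cpow (u * v) s = cpow u s * cpow v s.
Proof. by move=> u0 v0; rewrite /cpow lnM ?posrE // rmorphD mulrDr cexpD. Qed.

Lemma cpowVl (u : R) s : 0 < u -> cpow u^-1 s = (cpow u s)^-1.
Proof.
by move=> u0; rewrite -cpowN /cpow lnV ?posrE // rmorphN mulrN mulNr.
Qed.

Lemma cpow_usum (u : R) s s0 :
  usum (fun k => cpow u s0 * ((ln u)%:C ^+ k / k`!%:R) * (s - s0) ^+ k) (cpow u s).
Proof.
have -> : cpow u s = cpow u s0 * cexp ((s - s0) * (ln u)%:C).
  by rewrite -[X in _ * X]/(cpow u (s - s0)) -cpowD addrC subrK.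
apply: eq_usum (usumZ _ (usum_exp _)) => k.
by rewrite /exp_term exprMn -!mulrA; congr (_ * _); rewrite mulrCA mulrC -!mulrA mulrCA.
Qed.

Lemma expR_abs_le (r l : R) : 0 <= r -> expR (r * `|l|) <= expR (r * l) + expR (- r * l).
Proof.
move=> r0; case: (lerP 0 l) => h; [rewrite ger0_norm // lerDl|rewrite ltr0_norm // mulrN -mulNr lerDr]; exact: expR_ge0.
Qed.

(* u^s is expanded in powers of (s - s0) ln u; the two majorants bound
   |u^s0| exp(r |ln u|). *)
Lemma mellin_pan (D : set R) (W : R -> R[i]) (V : R -> R) s0 (r : R) :
  measurable D -> cmeas D (fun u => cpow u s0) -> cmeas D (fun u => (ln u)%:C) ->
  cmeas D W -> 0 < r -> (forall u, D u -> cmod (W u) <= V u) ->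
  rint D (fun u => V u * expR ((complex.Re s0 + r) * ln u)) ->
  rint D (fun u => V u * expR ((complex.Re s0 - r) * ln u)) ->
  pan (fun s => cintegral D (fun u => cpow u s * W u)) s0.
Proof.
move=> mD mc ml mW r0 WV i1 i2.
pose f k u : R[i] := cpow u s0 * ((ln u)%:C ^+ k / k`!%:R) * W u.
pose h u := V u * expR ((complex.Re s0 + r) * ln u) +
            V u * expR ((complex.Re s0 - r) * ln u).
have ih : rint D h by exact: rintD.
have mf k : cmeas D (f k).
  apply: cmeasM => //; apply: cmeasM => //; apply: cmeasM; last exact: cmeas_cst.
  elim: k => [|k IH]; first exact: cmeas_cst.
  by under eq_fun do rewrite exprS; exact: cmeasM.
have bound z u : D u -> cmod z <= r -> absum (fun k => f k u * z ^+ k) (h u).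
  move=> Du zr; have := absumZ (cpow u s0 * W u) (absum_exp_term ((ln u)%:C * z)).
  rewrite cmodM cmodM cmod_real cmod_cpow => ha.
  move=> K; apply: le_trans (_ : expR (complex.Re s0 * ln u) * cmod (W u) * expR (`|ln u| * cmod z) <= _).
    apply: le_trans (ha K); apply: ler_sum => k _.
    rewrite le_eqVlt; apply/orP; left; apply/eqP; congr cmod.
    by rewrite /f /exp_term exprMn; ring.
  rewrite /h -mulrDr [X in X * _]mulrC -mulrA.
  apply: ler_pM; [exact: cmod_ge0|by rewrite mulr_ge0 ?expR_ge0|exact: WV|].
  rewrite !mulrDl !expRD -mulrDr; apply: ler_wpM2l; first exact: expR_ge0.
  apply: le_trans (expR_abs_le (ln u) (ltW r0)); rewrite ler_expR mulrC.
  exact: ler_wpM2r.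
pose a k := cintegral D (f k).
have fi k : cint D (f k).
  (* The estimate [bound] at z = r, restricted to the single index k, controls [f k] by h / r^k. *)
  apply: (cint_dom mD (mf k) (h := fun u => (r ^- k) * h u)); last exact: rintZ.
  move=> u Du; have rk : 0 < r ^+ k by rewrite exprn_gt0.
  rewrite -ler_pdivrMl ?invr_gt0 // invrK.
  have := bound r%:C u Du; rewrite cmod_real gtr0_norm // lexx => /(_ isT) hb.
  have := hb [fset k]%fset; by rewrite big_seq_fset1 cmodM cmodX cmod_real gtr0_norm // mulrC.
have mfz z k : cmeas D (fun u => f k u * z ^+ k) by apply: cmeasM => //; exact: cmeas_cst.
have az z k : cintegral D (fun u => f k u * z ^+ k) = a k * z ^+ k.
  rewrite mulrC -cintegralZ //; apply: eq_cintegral => u _; exact: mulrC.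
exists a, r, (2 * \int[mu]_(u in D) h u); split => //.
- have hb u : D u -> absum (fun k => f k u * r%:C ^+ k) (h u).
    by move=> Du; apply: bound => //; rewrite cmod_real gtr0_norm.
  have := absum_cintegral mD (mfz r%:C) hb ih.
  by apply: absum_le => k; rewrite az.
- move=> z zr; have hb u : D u -> absum (fun k => f k u * (z - s0) ^+ k) (h u).
    by move=> Du; exact: bound.
  have := @usum_cintegral _ _ D _ (fun u => cpow u z * W u) h mD (mfz (z - s0)) hb ih.
  move=> hu; apply: eq_usum (hu _) => [k|u _]; first exact: az.
  have := usumZ (W u) (cpow_usum u z s0); rewrite mulrC; apply: eq_usum => k.
  by rewrite /f; ring.
Qed.

End Cpow.

(** * The kernel u^(s-1) exp(-b u) and its primitives *)

Section GammaKernel.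
Variable R : realType.
Notation mu := (@lebesgue_measure R).

Lemma cpowE (u : R) s : cpow u s =
  (expR (complex.Re s * ln u) * cos (complex.Im s * ln u)) +i*
  (expR (complex.Re s * ln u) * sin (complex.Im s * ln u)).
Proof.
rewrite /cpow (mulrC s) /cexp ReZ ImZ ![ln u * _]mulrC.
by apply: RI_eq; rewrite ?ReZ ?ImZ.
Qed.

Lemma pcontM (f g : R -> R) : pcont f -> pcont g -> pcont (fun u => f u * g u).
Proof. by move=> cf cg u u0; apply: cvgM; [exact: cf|exact: cg]. Qed.

Lemma pcont_cst (c : R) : pcont (fun=> c).
Proof. by move=> u u0; exact: cvg_cst. Qed.

Lemma pcont_id : pcont (@id R).
Proof. by move=> u u0; exact: cvg_id. Qed.

Lemma pcont_ln : pcont (@ln R).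
Proof. by move=> u u0; exact: continuous_ln. Qed.

Lemma pcont_comp (g f : R -> R) : continuous g -> pcont f -> pcont (fun u => g (f u)).
Proof.
move=> cg cf u u0; apply: (@continuous_comp _ _ _ f g); first exact: cf.
exact: cg.
Qed.

Lemma pcont_inv : pcont (fun u : R => u^-1).
Proof. by move=> u u0; apply: inv_continuous; rewrite gt_eqF. Qed.

Lemma cpcontM (f g : R -> R[i]) : cpcont f -> cpcont g -> cpcont (fun u => f u * g u).
Proof. by move=> cf cg u u0; apply: ccvgM; [exact: cf|exact: cg]. Qed.

Lemma cpcont_cst (c : R[i]) : cpcont (fun _ : R => c).
Proof. by move=> u u0; exact: ccvg_cst. Qed.

Lemma cpcont_real (f : R -> R) : pcont f -> cpcont (fun u => (f u)%:C).
Proof. by move=> cf u u0; apply: ccvg_real; exact: cf. Qed.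

Lemma cpcont_cpow s : cpcont (fun u : R => cpow u s).
Proof.
have cl (c : R) : pcont (fun u => c * ln u) by apply: pcontM; [exact: pcont_cst|exact: pcont_ln].
have ce : pcont (fun u => expR (complex.Re s * ln u)).
  by apply: pcont_comp (cl _); exact: continuous_expR.
move=> u u0; rewrite [in X in ccvg _ _ X]cpowE.
have h : ccvg (nbhs u) (fun u => (expR (complex.Re s * ln u) * cos (complex.Im s * ln u)) +i*
  (expR (complex.Re s * ln u) * sin (complex.Im s * ln u)))
  ((expR (complex.Re s * ln u) * cos (complex.Im s * ln u)) +i*
  (expR (complex.Re s * ln u) * sin (complex.Im s * ln u))).
  apply: ccvgRI => /=.
    apply: (pcontM ce (g := fun u => cos (complex.Im s * ln u))) => //.
    by apply: pcont_comp (cl _); exact: continuous_cos.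
  apply: (pcontM ce (g := fun u => sin (complex.Im s * ln u))) => //.
  by apply: pcont_comp (cl _); exact: continuous_sin.
by apply: near_ccvg h; apply: nearW => v; rewrite -cpowE.
Qed.

Definition gker (s : R[i]) (b u : R) : R[i] := cpow u (s - 1) * (expR (- (b * u)))%:C.

Lemma cpcont_gker s b : cpcont (gker s b).
Proof.
apply: cpcontM; first exact: cpcont_cpow.
apply: cpcont_real; apply: pcont_comp; first exact: continuous_expR.
by apply: pcontN; apply: pcontM; [exact: pcont_cst|exact: pcont_id].
Qed.

Lemma ReN (z : R[i]) : complex.Re (- z) = - complex.Re z.
Proof. by case: z. Qed.

Lemma Re1 : complex.Re (1 : R[i]) = 1.
Proof. by []. Qed.

Lemma cmod_gker s b u : cmod (gker s b u) = expR ((complex.Re s - 1) * ln u - b * u).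
Proof.
rewrite cmodM cmod_cpow cmod_real ger0_norm ?expR_ge0 // -expRD.
by rewrite ReD ReN Re1.
Qed.

Lemma sub0y_01 : `]0, 1[%classic `<=` (`]0, +oo[%classic : set R).
Proof. by move=> u /=; rewrite !in_itv /= andbT => /andP[]. Qed.

Lemma sub0y_1y : `]1, +oo[%classic `<=` (`]0, +oo[%classic : set R).
Proof. by move=> u /=; rewrite !in_itv /= !andbT; exact: lt_trans. Qed.

Lemma is_derive_ln_scale (c u : R) : 0 < u -> is_derive u 1 (fun v => c * ln v) (c / u).
Proof. by move=> u0; have := is_deriveZ c (is_derive1_ln u0). Qed.

Lemma is_derive_expln (c u : R) : 0 < u ->
  is_derive u 1 (fun v => expR (c * ln v)) (expR (c * ln u) * (c / u)).
Proof.
by move=> u0; exact: (is_derive1_comp (is_derive_expR _) (is_derive_ln_scale c u0)).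
Qed.

Lemma is_derive_expN (b u : R) :
  is_derive u 1 (fun v => expR (- (b * v))) (expR (- (b * u)) * - b).
Proof.
apply: (is_derive1_comp (is_derive_expR _) (g := fun v => - (b * v))).
have := is_deriveN (is_deriveZ b (is_derive_id u 1)).
by rewrite [b *: 1]mulr1.
Qed.

Lemma is_derive_prod (f g : R -> R) (u df dg : R) :
  is_derive u 1 f df -> is_derive u 1 g dg ->
  is_derive u 1 (fun v => f v * g v) (f u * dg + g u * df).
Proof. by move=> hf hg; exact: (is_deriveM hf hg). Qed.

Definition gprim (s : R[i]) (b u : R) : R[i] := cpow u s * (expR (- (b * u)))%:C.

Lemma gprimE s b u : gprim s b u = gker (s + 1) b u.
Proof. by rewrite /gker addrK. Qed.

(** Derivative of [gprim], written with kernels so that for b = 1 its integral over the half-line is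
    the recurrence of Gamma. *)
Definition gder (s : R[i]) (b u : R) : R[i] := s * gker s b u - b%:C * gker (s + 1) b u.

Lemma gderE s b u : 0 < u -> gder s b u =
  (expR (- (b * u)))%:C * (cpow u s * (s * u^-1%:C - b%:C)).
Proof.
move=> u0; rewrite /gder /gker addrK cpowD cpowN cpow_1 // fmorphV /=; ring.
Qed.

Lemma Re_lin (z s : R[i]) (v b : R) : complex.Re (z * (s * v%:C - b%:C)) =
  complex.Re z * (complex.Re s * v - b) - complex.Im z * (complex.Im s * v).
Proof. by case: z s => x y [c d] /=; ring. Qed.

Lemma Im_lin (z s : R[i]) (v b : R) : complex.Im (z * (s * v%:C - b%:C)) =
  complex.Re z * (complex.Im s * v) + complex.Im z * (complex.Re s * v - b).
Proof. by case: z s => x y [c d] /=; ring. Qed.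

Lemma is_derive_gprim s b (u : R) : 0 < u ->
  is_derive u 1 (fun v => complex.Re (gprim s b v)) (complex.Re (gder s b u)) /\
  is_derive u 1 (fun v => complex.Im (gprim s b v)) (complex.Im (gder s b u)).
Proof.
move=> u0.
have dc := is_derive1_comp (is_derive_cos _) (is_derive_ln_scale (complex.Im s) u0).
have ds := is_derive1_comp (is_derive_sin _) (is_derive_ln_scale (complex.Im s) u0).
have dr := is_derive_prod (is_derive_prod (is_derive_expln (complex.Re s) u0) dc) (is_derive_expN b u).
have di := is_derive_prod (is_derive_prod (is_derive_expln (complex.Re s) u0) ds) (is_derive_expN b u).
split.
  have -> : (fun v => complex.Re (gprim s b v)) = (fun v =>
    expR (complex.Re s * ln v) * (cos \o (fun v => complex.Im s * ln v)) v * expR (- (b * v))).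
    by apply/funext => v; rewrite /gprim mulrC ReZ cpowE mulrC.
  apply: (is_derive_eq dr) => /=; rewrite gderE // ReZ Re_lin cpowE /=; ring.
have -> : (fun v => complex.Im (gprim s b v)) = (fun v =>
  expR (complex.Re s * ln v) * (sin \o (fun v => complex.Im s * ln v)) v * expR (- (b * v))).
  by apply/funext => v; rewrite /gprim mulrC ImZ cpowE mulrC.
apply: (is_derive_eq di) => /=; rewrite gderE // ImZ Im_lin cpowE /=; ring.
Qed.

Lemma cpcont_gder s b : cpcont (gder s b).
Proof.
move=> u u0; apply: ccvgB.
  by apply: ccvgZ; exact: cpcont_gker.
by apply: ccvgZ; exact: cpcont_gker.
Qed.

Lemma ftc_limit (D : set R) (p q : nat -> R) (F f : R -> R) (A B : R) :
  (forall n, `[p n, q n] `<=` `[p n.+1, q n.+1]) ->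
  \bigcup_n `[p n, q n]%classic = D ->
  (forall n, 0 < p n) -> (forall n, p n <= q n) ->
  (forall u : R, 0 < u -> is_derive u 1 F (f u)) -> pcont f -> rint D f ->
  F (p n) @[n --> \oo] --> A -> F (q n) @[n --> \oo] --> B ->
  \int[mu]_(u in D) f u = B - A.
Proof.
move=> sE ED p0 pq dF cf fi pA qB.
have h := Rintegral_exhaust (fun n => measurable_itv `[p n, q n]) sE ED fi.
apply: (cvg_unique _ h); first exact: Rhausdorff.
have h' : F (q n) - F (p n) @[n --> \oo] --> B - A by exact: cvgB.
apply: cvg_trans h'; apply: near_eq_cvg; apply: nearW => n.
rewrite /Rintegral; have := pq n; rewrite le_eqVlt => /predU1P[->|lt].
  by rewrite set_itv1 integral_set1 /= subrr.
by rewrite (ftc_pos (p0 n) lt dF cf).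
Qed.

Lemma gder_integral (D : set R) (p q : nat -> R) s b (A B : R[i]) :
  (forall n, `[p n, q n] `<=` `[p n.+1, q n.+1]) ->
  \bigcup_n `[p n, q n]%classic = D ->
  (forall n, 0 < p n) -> (forall n, p n <= q n) -> cint D (gder s b) ->
  ccvg \oo (fun n => gprim s b (p n)) A -> ccvg \oo (fun n => gprim s b (q n)) B ->
  cintegral D (gder s b) = B - A.
Proof.
move=> sE ED p0 pq [i1 i2] pA qB.
apply: RI_eq => /=.
  rewrite (ftc_limit sE ED p0 pq (fun u u0 => (@is_derive_gprim s b u u0).1) _ i1
    (ccvg_Re pA) (ccvg_Re qB)); first by case: A B {pA qB} => ? ? [].
  by move=> u u0; exact: (ccvg_Re (cpcont_gder s b u0)).
rewrite (ftc_limit sE ED p0 pq (fun u u0 => (@is_derive_gprim s b u u0).2) _ i2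
    (ccvg_Im pA) (ccvg_Im qB)); first by case: A B {pA qB} => ? ? [].
by move=> u u0; exact: (ccvg_Im (cpcont_gder s b u0)).
Qed.

(** The primitive u^c/c stays between 0 and 1/c on the unit interval. *)
Lemma rint_pow01 (c : R) : 0 < c -> rint (`]0, 1[%classic : set R) (fun u => expR ((c - 1) * ln u)).
Proof.
move=> c0; have ce : pcont (fun u => expR ((c - 1) * ln u)).
  apply: pcont_comp; first exact: continuous_expR.
  by apply: pcontM; [exact: pcont_cst|exact: pcont_ln].
apply: (rint_exhaust (fun n => measurable_itv _) (@segm_sub R) (@segm_bigcup R) (M := c^-1)).
- by apply: pcont_meas => //; exact: sub0y_01.
- by move=> u _; exact: expR_ge0.
have dF (u : R) : 0 < u ->
    is_derive u 1 (fun u => c^-1 * expR (c * ln u)) (expR ((c - 1) * ln u)).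
  move=> u0; apply: (is_derive_eq (is_deriveZ c^-1 (is_derive_expln c u0))).
  rewrite /GRing.scale /= mulrBl mul1r expRD expRN lnK ?posrE //; field.
  by rewrite !gt_eqF.
have ab n : n.+3%:R^-1 < 1 - n.+3%:R^-1 :> R.
  by move: (n.+3%:R^-1) (natS3_le R n) => v; lra.
move=> n; rewrite (ftc_pos (natSinv_gt0 R n.+2) (ab n) dF ce) lee_fin.
apply: (@le_trans _ _ (c^-1 * expR (c * ln (1 - n.+3%:R^-1)))).
  by rewrite gerBl mulr_ge0 ?expR_ge0 // invr_ge0 ltW.
rewrite ler_piMr ?invr_ge0 ?(ltW c0) // -[leRHS]expR0 ler_expR pmulr_rle0 //.
by apply: ln_le0; rewrite gerBl.
Qed.

Lemma rint_exp1y (b : R) : 0 < b -> rint (`]1, +oo[%classic : set R) (fun u => expR (- (b * u))).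
Proof.
move=> b0; have ce : pcont (fun u => expR (- (b * u))).
  apply: pcont_comp; first exact: continuous_expR.
  by apply: pcontN; apply: pcontM; [exact: pcont_cst|exact: pcont_id].
apply: (rint_exhaust (@ray_measurable R 1) (@ray_sub R 1) (@ray_bigcup R 1) (M := b^-1)).
- by apply: pcont_meas => //; exact: sub0y_1y.
- by move=> u _; exact: expR_ge0.
case=> [|n].
  by rewrite /ray invr1 set_itv1 integral_set1 lee_fin invr_ge0 ltW.
have n0 := natSinv_gt0 R n.+1; have n1 : n.+2%:R^-1 < 1 :> R.
  by rewrite invf_lt1 ?ltr0n ?ltr1n.
have dF (u : R) : 0 < u ->
    is_derive u 1 (fun u => - b^-1 * expR (- (b * u))) (expR (- (b * u))).
  move=> u0; apply: (is_derive_eq (is_deriveZ (- b^-1) (is_derive_expN b u))).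
  by rewrite /GRing.scale /=; field; rewrite gt_eqF.
have p0 : 0 < 1 + n.+2%:R^-1 :> R by rewrite ltr_wpDl.
have pq : 1 + n.+2%:R^-1 < 1 + n.+2%:R :> R by rewrite ltrD2l (lt_trans n1) // ltr1n.
rewrite (ftc_pos p0 pq dF ce) lee_fin !mulNr opprK addrC.
apply: (@le_trans _ _ (b^-1 * expR (- (b * (1 + n.+2%:R^-1))))).
  by rewrite gerBl mulr_ge0 ?expR_ge0 // invr_ge0 ltW.
rewrite ler_piMr ?invr_ge0 ?(ltW b0) // -[leRHS]expR0 ler_expR oppr_le0.
by rewrite mulr_ge0 ?(ltW b0) // ltW.
Qed.

(** The inequality ln v <= v - 1 at v = e u bounds ln u by e u plus a constant; [e] is chosen with
    (|c| + 1) e = b/2, so half of the decay is left. *)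
Lemma expln_bound (c b : R) : 0 < b -> exists2 C : R, 0 <= C & forall u, 1 <= u ->
  expR (c * ln u - b * u) <= C * expR (- ((b / 2) * u)).
Proof.
move=> b0; pose e := b / 2 / (`|c| + 1).
have c1 : 0 < `|c| + 1 by rewrite ltr_wpDl.
have e0 : 0 < e by rewrite !divr_gt0.
exists (expR ((`|c| + 1) * (-1 - ln e))); first exact: expR_ge0.
move=> u u1; have u0 : 0 < u by exact: lt_le_trans u1.
rewrite -expRD ler_expR.
have lu : 0 <= ln u by exact: ln_ge0.
have h : ln u <= e * u - 1 - ln e.
  have := le_ln1Dx (x := e * u - 1) _; rewrite ltrBrDr addNr mulr_gt0 // => /(_ isT).
  by rewrite addrC subrK lnM ?posrE //; lra.
have h2 : c * ln u <= (`|c| + 1) * (e * u - 1 - ln e).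
  apply: (@le_trans _ _ ((`|c| + 1) * ln u)); last by rewrite ler_pM2l.
  by rewrite ler_wpM2r // (le_trans (ler_norm _)) // lerDl.
have h3 : (`|c| + 1) * (e * u) = b / 2 * u.
  by rewrite /e mulrA [_ * (_ / _)]mulrC mulfVK // gt_eqF.
by move: h2; rewrite -addrA mulrDr h3; lra.
Qed.

Lemma rint_gker01 s b : 0 < complex.Re s -> 0 <= b -> cint `]0, 1[%classic (gker s b).
Proof.
move=> s0 b0; apply: (cint_dom _ _ _ (rint_pow01 s0)) => //.
- by apply: cpcont_meas (cpcont_gker s b) => //; exact: sub0y_01.
move=> u /=; rewrite in_itv /= => /andP[u0 _].
by rewrite cmod_gker ler_expR gerBl mulr_ge0 // ltW.
Qed.

Lemma rint_gker1y s b : 0 < b -> cint `]1, +oo[%classic (gker s b).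
Proof.
move=> b0; have [C C0 hC] := expln_bound (complex.Re s - 1) b0.
have b20 : 0 < b / 2 by rewrite divr_gt0.
apply: (cint_dom _ _ _ (rintZ C _ (rint_exp1y b20))) => //.
- by apply: cpcont_meas (cpcont_gker s b) => //; exact: sub0y_1y.
move=> u /=; rewrite in_itv /= andbT => /ltW u1.
by rewrite cmod_gker hC.
Qed.

End GammaKernel.

(** * The gamma function and its reciprocal *)

Section Gamma.
Variable R : realType.
Notation mu := (@lebesgue_measure R).
Notation I01 := (`]0, 1[%classic : set R).
Notation I1y := (`]1, +oo[%classic : set R).
Notation I0y := (`]0, +oo[%classic : set R).

Lemma I0y_split : I0y = (`]0, 1]%classic : set R) `|` I1y.
Proof.
apply/seteqP; split => u /=; rewrite !in_itv /= ?andbT.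
  by move=> u0; case: (lerP u 1) => h; [left; rewrite u0|right].
by case=> [/andP[]//|]; exact: lt_trans.
Qed.

Lemma I0y_disj : [disjoint (`]0, 1]%classic : set R) & I1y].
Proof.
apply/disj_setPS => u /= []; rewrite !in_itv /= andbT => /andP[_ h1] h2.
by move: (lt_le_trans h2 h1); rewrite ltxx.
Qed.

Lemma rint_glue (f : R -> R) : rint I01 f -> rint I1y f -> rint I0y f.
Proof.
move=> /integrableP[/measurable_EFinP m1 i1] /integrableP[/measurable_EFinP m2 i2].
have m1' : measurable_fun (`]0, 1]%classic : set R) f by apply/measurable_fun_itv_bndo_bndcP.
have mf : measurable_fun I0y f.
  by rewrite I0y_split; apply/measurable_funU.
apply/integrableP; split; first exact/measurable_EFinP.
rewrite I0y_split ge0_integral_setU //=; last 2 first.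
- by rewrite -I0y_split; apply/measurable_EFinP; exact: measurableT_comp.
- exact: I0y_disj.
rewrite -integral_itv_bndo_bndc; last first.
  by apply/measurable_EFinP; exact: measurableT_comp.
by rewrite lte_add_pinfty.
Qed.

Lemma rintegral_glue (f : R -> R) : rint I01 f -> rint I1y f ->
  \int[mu]_(u in I0y) f u = \int[mu]_(u in I01) f u + \int[mu]_(u in I1y) f u.
Proof.
move=> i1 i2; have i := rint_glue i1 i2.
rewrite Rintegral_itv_bndo_bndc // {1}I0y_split Rintegral_setU //.
- by rewrite -I0y_split.
- exact: I0y_disj.
Qed.

Lemma cint_glue (f : R -> R[i]) : cint I01 f -> cint I1y f -> cint I0y f.
Proof. by move=> [a b] [c d]; split; apply: rint_glue. Qed.

Lemma cintegral_glue (f : R -> R[i]) : cint I01 f -> cint I1y f ->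
  cintegral I0y f = cintegral I01 f + cintegral I1y f.
Proof.
move=> [a b] [c d]; apply: RI_eq; rewrite ?ReD ?ImD /=.
  exact: (rintegral_glue a c).
exact: (rintegral_glue b d).
Qed.

Lemma cint_gker0y s b : 0 < complex.Re s -> 0 < b -> cint I0y (gker s b).
Proof. by move=> s0 b0; apply: cint_glue; [apply: rint_gker01 => //; exact: ltW|exact: rint_gker1y]. Qed.

Lemma eventually_inv_lt (e : R) : 0 < e -> \forall n \near \oo, n.+1%:R^-1 < e.
Proof. by move=> e0; exact: near_infty_natSinv_lt (PosNum e0). Qed.

Lemma gprim_cvg0 s b (p : nat -> R) : 0 < complex.Re s -> 0 <= b ->
  (forall n, 0 < p n) -> (forall e : R, 0 < e -> \forall n \near \oo, p n < e) ->
  ccvg \oo (fun n => gprim s b (p n)) 0.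
Proof.
move=> s0 b0 p0 hp e e0.
have := hp (expR (ln e / complex.Re s)) (expR_gt0 _); apply: filterS => n pn.
rewrite subr0 gprimE cmod_gker ReD Re1 addrK.
rewrite -[ltRHS](@lnK _ e) // ltr_expR.
apply: (@le_lt_trans _ _ (complex.Re s * ln (p n))).
  by rewrite gerBl mulr_ge0 // ltW.
by rewrite mulrC -ltr_pdivlMr // -ltr_expR lnK ?posrE.
Qed.

Lemma gprim_cvgy s b (q : nat -> R) : 0 < b -> (forall n, 1 <= q n) ->
  (forall e : R, 0 < e -> \forall n \near \oo, e < q n) ->
  ccvg \oo (fun n => gprim s b (q n)) 0.
Proof.
move=> b0 q1 hq e e0; have [C C0 hC] := expln_bound (complex.Re s) b0.
pose M := 2 * C / (b * e) + 1.
have be : 0 < b * e by rewrite mulr_gt0.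
have M0 : 0 < M by rewrite ltr_wpDl // divr_ge0 ?mulr_ge0 // ltW.
have := hq M M0; apply: filterS => n qn.
rewrite subr0 gprimE cmod_gker ReD Re1 addrK.
apply: le_lt_trans (hC _ (q1 n)) _.
have q0 : 0 < q n by exact: lt_le_trans (q1 n).
have h : b / 2 * q n < expR (b / 2 * q n).
  by apply: lt_le_trans (expR_ge1Dx _); rewrite ltrDr.
have bq : 0 < b / 2 * q n by rewrite !mulr_gt0 // invr_gt0.
apply: (@le_lt_trans _ _ (C / (b / 2 * q n))).
  by rewrite expRN ler_wpM2l // lef_pV2 ?posrE ?expR_gt0 // ltW.
rewrite ltr_pdivrMr //.
have : 2 * C / (b * e) < q n by apply: lt_trans qn; rewrite ltrDl.
rewrite ltr_pdivrMr //; set x := q n * _; set y := e * _.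
have -> : x = 2 * y by rewrite /x /y; field.
by rewrite ltr_pM2l.
Qed.

(** At b = 0 the kernel is the bare power, and s times it is the derivative of u^s. *)
Lemma cpow_int01 s : 0 < complex.Re s -> cintegral I01 (fun u => cpow u (s - 1)) = s^-1.
Proof.
move=> s0.
have e1 z u : I01 u -> gker z 0 u = cpow u (z - 1) :> R[i].
  by move=> _; rewrite /gker mul0r oppr0 expR0 mulr1.
have s00 : s != 0 by apply/eqP => s0'; move: s0; rewrite s0' ltxx.
have i1 : cint I01 (gker s 0) by exact: rint_gker01.
have e2 u : I01 u -> s * gker s 0 u = gder s 0 u.
  by move=> _; rewrite /gder mul0r subr0.
have i2 : cint I01 (gder s 0) by apply: eq_cint e2 _ => //; exact: cintZ.
apply: (mulfI s00); rewrite divff // -(eq_cintegral (e1 s)) -cintegralZ //.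
rewrite (eq_cintegral e2).
rewrite (gder_integral (@segm_sub R) (@segm_bigcup R) (fun n => natSinv_gt0 R n.+2) _ i2
  (A := 0) (B := 1)) ?subr0 //.
- by move=> n; move: (n.+3%:R^-1) (natS3_le R n) => v; lra.
- apply: gprim_cvg0 => // e e0.
  have := eventually_inv_lt e0; apply: filterS => n; apply: le_lt_trans.
  by rewrite (le_trans (natSinv_le R n.+1)) // natSinv_le.
have h1 : ccvg (nbhs (1 : R)) (gprim s 0) 1.
  have := @cpcont_gker R (s + 1) 0 1 ltr01; rewrite -gprimE.
  have -> : gprim s 0 (1 : R) = 1 by rewrite /gprim cpow_1l mul0r oppr0 expR0 mulr1.
  apply: near_ccvg.
  by apply: nearW => u; rewrite gprimE.
move=> e /h1 /nbhs_ballP[r /= r0 hr].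
have := eventually_inv_lt r0; apply: filterS => n nr; apply: hr.
rewrite /ball /= opprB addrC subrK gtr0_norm ?natSinv_gt0 //.
by apply: le_lt_trans nr; rewrite (le_trans (natSinv_le R n.+1)) // natSinv_le.
Qed.

Definition Gam (s : R[i]) : R[i] := upper_gamma s 0.

Lemma GamE s : Gam s = cintegral I0y (gker s 1).
Proof. by apply: eq_cintegral => u _; rewrite /gker mul1r. Qed.

(** The function u^s exp(-u) vanishes at both ends of the half-line, so its derivative has integral
    0. *)
Lemma Gam_rec s : 0 < complex.Re s -> Gam (s + 1) = s * Gam s.
Proof.
move=> s0; have s1 : 0 < complex.Re (s + 1) by rewrite ReD addr_gt0.
have i1 := cint_gker0y s0 ltr01; have i2 := cint_gker0y s1 ltr01.
have i2' : cint I0y (fun u => - (1 : R)%:C * gker (s + 1) 1 u) by exact: cintZ.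
have i1' : cint I0y (fun u => s * gker s 1 u) by exact: cintZ.
have e u : I0y u -> s * gker s 1 u + - (1 : R)%:C * gker (s + 1) 1 u = gder s 1 u.
  by move=> _; rewrite /gder mulNr.
have i : cint I0y (gder s 1) by apply: eq_cint e _ => //; exact: cintD.
have := gder_integral (@ray_sub R 0) (@ray_bigcup R 0) _ _ i (A := 0) (B := 0).
rewrite subrr -(eq_cintegral e) cintegralD // !cintegralZ // -!GamE mulN1r => h.
apply/esym/eqP; rewrite -subr_eq0 h //.
- by move=> n; rewrite lerD2l (@le_trans _ _ 1) ?ler1n // invf_le1 ?ltr0n ?ler1n.
- apply: gprim_cvg0 => // r r0.
  by have := eventually_inv_lt r0; apply: filterS => n; rewrite add0r.
apply: gprim_cvgy => // [n|r r0]; first by rewrite add0r ler1n.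
have := eventually_inv_lt (e := r^-1) _; rewrite invr_gt0 => /(_ r0).
by apply: filterS => n; rewrite add0r ltf_pV2 ?posrE ?ltr0n.
Qed.

(** Rescaling by [b] moves the lower limit to 1, so all terms of a lattice sum become integrals over
    one domain. *)
Lemma upper_gammaE s b : 0 < b -> upper_gamma s b = cpow b s * cintegral I1y (gker s b).
Proof.
move=> b0; rewrite -cintegralZ //; last exact: rint_gker1y.
have -> : upper_gamma s b = cintegral `]b * 1, +oo[ (gker s 1).
  by rewrite mulr1; apply: eq_cintegral => u _; rewrite /gker mul1r.
rewrite (cintegral_scale b0 ler01 (cpcont_gker s 1)).
apply: eq_cintegral => u; rewrite /= in_itv /= andbT => u1.
have u0 : 0 < u by exact: lt_trans u1.
rewrite /gker cpowMl // mul1r cpowD cpowN cpow_1 //.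
have b1 : b%:C != 0 by rewrite (inj_eq (@complexI R)) gt_eqF.
by field.
Qed.

Lemma Gam_split s b : 0 < b -> 0 < complex.Re s ->
  cintegral I01 (gker s b) + cintegral I1y (gker s b) = Gam s / cpow b s.
Proof.
move=> b0 s0; rewrite -cintegral_glue; last 2 first.
- by apply: rint_gker01 => //; exact: ltW.
- exact: rint_gker1y.
apply: (canRL (mulfK (cpow_neq0 b s))); rewrite mulrC.
rewrite -cintegralZ //; last exact: cint_gker0y.
have -> : Gam s = cintegral `]b * 0, +oo[ (gker s 1) by rewrite mulr0 GamE.
rewrite (cintegral_scale b0 (lexx 0) (cpcont_gker s 1)).
apply: eq_cintegral => u; rewrite /= in_itv /= andbT => u0.
rewrite /gker cpowMl // mul1r [cpow b (s - 1)]cpowD cpowN cpow_1 //.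
have b1 : b%:C != 0 by rewrite (inj_eq (@complexI R)) gt_eqF.
by field.
Qed.

(** The inversion u -> 1/u. Applied with s - d/2, it turns the dual theta terms into Crandall terms
    of index d - nu. *)
Lemma gker_inv s b :
  cintegral I01 (fun u => cpow u (s - 1) * (expR (- (b / u)))%:C) =
  cintegral I1y (gker (- s) b).
Proof.
rewrite cintegral_inv; last exact: cpcont_gker.
apply: eq_cintegral => u; rewrite /= in_itv /= => /andP[u0 _].
rewrite /gker cpowVl // -cpowN opprD !opprK (cpowD _ s 1) (cpowD _ s (-1)) cpowN cpow_1 //.
have u1 : u%:C != 0 by rewrite (inj_eq (@complexI R)) gt_eqF.
rewrite fmorphV rmorphXn /=.
by field.
Qed.

End Gamma.

(** * Nonvanishing of Gamma and analyticity of its reciprocal *)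

Section Rgamma.
Variable R : realType.
Notation mu := (@lebesgue_measure R).
Notation I01 := (`]0, 1[%classic : set R).
Notation I1y := (`]1, +oo[%classic : set R).
Notation I0y := (`]0, +oo[%classic : set R).

Lemma mellin_pan_pos (D : set R) (W : R -> R[i]) (V : R -> R) s0 (r : R) :
  D `<=` I0y -> measurable D -> cmeas D W -> 0 < r ->
  (forall u, D u -> cmod (W u) <= V u) ->
  rint D (fun u => V u * expR ((complex.Re s0 - 1 + r) * ln u)) ->
  rint D (fun u => V u * expR ((complex.Re s0 - 1 - r) * ln u)) ->
  pan (fun s => cintegral D (fun u => cpow u (s - 1) * W u)) s0.
Proof.
move=> D0 mD mW r0 WV i1 i2.
have h : pan (fun s => cintegral D (fun u => cpow u s * W u)) (1 * s0 + -1).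
  apply: (mellin_pan (V := V) (r := r)) => //.
  - by apply: cpcont_meas => //; exact: cpcont_cpow.
  - by apply: cpcont_meas => //; apply: cpcont_real; exact: pcont_ln.
  - by rewrite mul1r ReD ReN Re1.
  - by rewrite mul1r ReD ReN Re1.
by apply: (pan_ext ltr01 _ (pan_comp h)) => z _; rewrite mul1r.
Qed.

Lemma gker_real (c b u : R) : gker c%:C b u = (expR ((c - 1) * ln u - b * u))%:C.
Proof. by rewrite /gker -[1]/(1%:C) -rmorphB cpow_real -rmorphM -expRD. Qed.

Lemma rint_expln0y (c b : R) : 0 < c -> 0 < b ->
  rint I0y (fun u => expR ((c - 1) * ln u - b * u)).
Proof.
move=> c0 b0; have [h _] := cint_gker0y (s := c%:C) c0 b0.
by apply: eq_rint h => // u _; rewrite gker_real.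
Qed.

Lemma rint_expln1y (c b : R) : 0 < b ->
  rint I1y (fun u => expR ((c - 1) * ln u - b * u)).
Proof.
move=> b0; have [h _] := rint_gker1y c%:C b0.
by apply: eq_rint h => // u _; rewrite gker_real.
Qed.

Lemma Gam_pan s : 0 < complex.Re s -> pan (@Gam R) s.
Proof.
move=> s0; have r0 : 0 < complex.Re s / 2 by rewrite divr_gt0.
apply: (@pan_ext _ (fun s => cintegral I0y (fun u => cpow u (s - 1) * (expR (- u))%:C)) _ s 1) => //.
apply: (mellin_pan_pos (V := fun u => expR (- u)) (r := complex.Re s / 2)) => //.
- apply: cpcont_meas => //; apply: cpcont_real; apply: pcont_comp; first exact: continuous_expR.
  by apply: pcontN; exact: pcont_id.
- by move=> u _; rewrite cmod_real ger0_norm ?expR_ge0.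
- apply: eq_rint (rint_expln0y (c := complex.Re s + complex.Re s / 2) (addr_gt0 s0 r0) ltr01) => // u _.
  rewrite -expRD; congr expR.
  by move: (complex.Re s) (ln u) => x y; ring.
- apply: eq_rint (rint_expln0y r0 ltr01) => // u _.
  rewrite -expRD; congr expR.
  by move: (complex.Re s) (ln u) => x y; field.
Qed.

Definition rGam (c : R) : R := \int[mu]_(u in I0y) expR ((c - 1) * ln u - u).

Lemma Re_cintegral (D : set R) f :
  complex.Re (cintegral D f) = \int[mu]_(u in D) complex.Re (f u).
Proof. by []. Qed.

Lemma Im_cintegral (D : set R) f :
  complex.Im (cintegral D f) = \int[mu]_(u in D) complex.Im (f u).
Proof. by []. Qed.

Lemma Gam_real (c : R) : Gam c%:C = (rGam c)%:C.
Proof.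
rewrite GamE; apply: RI_eq; rewrite ?Re_cintegral ?Im_cintegral.
  by apply: eq_Rintegral => u _; rewrite gker_real mul1r.
rewrite /Rintegral [X in fine X](_ : _ = (\int[mu]_(u in I0y) cst 0%E u)%E).
  by rewrite integral0.
by apply: eq_integral => u _; rewrite gker_real.
Qed.

Lemma rGam_rec (c : R) : 0 < c -> rGam (c + 1) = c * rGam c.
Proof.
move=> c0; apply: (@complexI R).
by rewrite -Gam_real rmorphD /= Gam_rec // Gam_real rmorphM.
Qed.

(** On the unit interval exp(-u) >= exp(-1), and u^(c-1) has integral 1/c there. *)
Lemma rGam_gt0 (c : R) : 0 < c -> 0 < rGam c.
Proof.
move=> c0.
have i01 : rint I01 (fun u => expR ((c - 1) * ln u - u)).
  have [h _] := rint_gker01 (s := c%:C) c0 ler01.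
  by apply: eq_rint h => // u _; rewrite gker_real mul1r.
have i1y : rint I1y (fun u => expR ((c - 1) * ln u - u)).
  by apply: eq_rint (rint_expln1y c ltr01) => // u _; rewrite mul1r.
rewrite /rGam rintegral_glue //; apply: ltr_pwDl; last first.
  by apply: Rintegral_ge0 => u _; exact: expR_ge0.
have := cpow_int01 (s := c%:C) c0 => /(congr1 (fun z => complex.Re z)).
rewrite Re_cintegral -fmorphV => h.
have h' : \int[mu]_(u in I01) expR ((c - 1) * ln u) = c^-1.
  rewrite -[RHS]/(complex.Re c^-1%:C) -h; apply: eq_Rintegral => u _.
  by rewrite -[1 in RHS]/(1%:C) -rmorphB cpow_real.
apply: (@lt_le_trans _ _ (expR (-1) * c^-1)).
  by rewrite mulr_gt0 ?expR_gt0 // invr_gt0.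
rewrite -h' -rintegralZ //; last exact: rint_pow01.
apply: le_Rintegral => //; first by apply: rintZ => //; exact: rint_pow01.
move=> u /=; rewrite in_itv /= => /andP[u0 u1].
by rewrite -expRD ler_expR addrC lerD2l lerN2 ltW.
Qed.

(** For h >= 0, h <= exp(h) - exp(-h); this is squared at h = x/2. *)
Lemma sqr_le_cosh (x : R) : x ^+ 2 <= 4 * (expR x - 2 + expR (- x)).
Proof.
have hp (h : R) : 0 <= h -> h ^+ 2 <= (expR h - expR (- h)) ^+ 2.
  move=> h0; rewrite ler_sqr ?nnegrE //; last by rewrite subr_ge0 ler_expR; lra.
  have := expR_ge1Dx h; have : expR (- h) <= 1 by rewrite -[leRHS]expR0 ler_expR; lra.
  lra.
have hh (h : R) : h ^+ 2 <= (expR h - expR (- h)) ^+ 2.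
  case: (lerP 0 h) => h0; first exact: hp.
  have : 0 <= - h by lra.
  by move=> /hp; rewrite sqrrN opprK => /le_trans; apply; rewrite -sqrrN opprB.
have := hh (x / 2).
have -> : (x / 2) ^+ 2 = x ^+ 2 / 4 by field.
have e1 : expR x = expR (x / 2) ^+ 2 by rewrite expr2 -expRD; congr expR; field.
have e2 : expR (- x) = expR (- (x / 2)) ^+ 2 by rewrite expr2 -expRD; congr expR; field.
have e3 : expR (x / 2) * expR (- (x / 2)) = 1 by rewrite -expRD subrr expR0.
rewrite e1 e2; move: (expR _) (expR _) e3 => p q e3.
have -> : (q - p) ^+ 2 = q ^+ 2 - 2 * (q * p) + p ^+ 2 by ring.
by rewrite e3 mulr1; lra.
Qed.

Lemma cos_ge_ratio (t x : R) :
  1 - 2 * t ^+ 2 * (expR x - 2 + expR (- x)) <= cos (t * x).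
Proof.
have h := cos_ge (t * x); have h2 := sqr_le_cosh x.
have h3 : (t * x) ^+ 2 <= t ^+ 2 * (4 * (expR x - 2 + expR (- x))).
  by rewrite exprMn ler_wpM2l // sqr_ge0.
by move: h h3; set c := cos _; set E := (expR x - _ + _); lra.
Qed.

(* N^(-it) Gamma(N + it) has real part the integral of
   u^(N-1) e^(-u) cos(t ln(u/N)), and 1 - cos is bounded by a multiple of
   u/N - 2 + N/u, whose integral is computed by the recurrence. *)
Lemma Gam_large_neq0 (N t : R) : 1 + 2 * t ^+ 2 < N -> Gam (N +i* t) != 0.
Proof.
move=> Nt; have t2 : 0 <= t ^+ 2 by exact: sqr_ge0.
have N1 : 0 < N - 1 by lra.
have N0 : 0 < N by lra.
pose z := cpow N (0 +i* (- t)).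
suff h : 0 < complex.Re (z * Gam (N +i* t)).
  by apply/eqP => g0; move: h; rewrite g0 mulr0 ltxx.
pose k c u := expR ((c - 1) * ln u - u) : R.
have ik c : 0 < c -> rint I0y (k c).
  by move=> c0; apply: eq_rint (rint_expln0y c0 ltr01) => // u _; rewrite /k mul1r.
have ig : cint I0y (gker (N +i* t) 1) by exact: cint_gker0y.
have iz : cint I0y (fun u => z * gker (N +i* t) 1 u) by exact: cintZ.
pose low u := (1 + 4 * t ^+ 2) * k N u +
   ((- 2 * t ^+ 2 / N) * k (N + 1) u + (- 2 * t ^+ 2 * N) * k (N - 1) u).
have N10 : 0 < N + 1 by lra.
have i1 := ik N N0; have i2 := ik _ N10; have i3 := ik _ N1.
have il : rint I0y low by apply: rintD => //; [exact: rintZ|exact: rint_lin].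
apply: (@lt_le_trans _ _ (\int[mu]_(u in I0y) low u)).
  rewrite rintegralD ?rintegralZ ?rintegral_lin //; [|exact: rintZ|exact: rint_lin].
  rewrite -!/(rGam _) rGam_rec //.
  have eN : rGam N = (N - 1) * rGam (N - 1) by rewrite -(rGam_rec N1) subrK.
  have gp := rGam_gt0 N1; rewrite eN; set g := rGam (N - 1).
  have -> : (1 + 4 * t ^+ 2) * ((N - 1) * g) +
      (- 2 * t ^+ 2 / N * (N * ((N - 1) * g)) + - 2 * t ^+ 2 * N * g) =
      g * (N - 1 - 2 * t ^+ 2).
    by field; rewrite gt_eqF.
  by rewrite mulr_gt0 //; lra.
rewrite GamE -cintegralZ // Re_cintegral.
apply: le_Rintegral => //; first exact: iz.1.
move=> u Du; have u0 : 0 < u by move: Du; rewrite /= in_itv /= andbT.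
have -> : complex.Re (z * gker (N +i* t) 1 u) = k N u * cos (t * (ln u - ln N)).
  rewrite /gker mulrA mulrC ReZ /z !cpowE cReM /= mul0r expR0 !mul1r subr0.
  rewrite !mulNr cosN sinN /k expRD [t * (_ - _)]mulrBr (cosD (t * ln u)) cosN sinN; ring.
have := cos_ge_ratio t (ln u - ln N).
have -> : expR (ln u - ln N) = u / N by rewrite expRD expRN !lnK ?posrE.
have -> : expR (- (ln u - ln N)) = N / u by rewrite opprB expRD expRN !lnK ?posrE.
move=> hc.
have lu : u = expR (ln u) by rewrite lnK ?posrE.
have e1 : k (N + 1) u = k N u * u.
  transitivity (k N u * expR (ln u)); last by rewrite -lu.
  by rewrite /k addrK -expRD; congr expR; ring.
have e2 : k (N - 1) u = k N u / u.
  transitivity (k N u / expR (ln u)); last by rewrite -lu.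
  by rewrite /k -expRN -expRD; congr expR; ring.
rewrite /low e1 e2.
have -> : (1 + 4 * t ^+ 2) * k N u +
  (-2 * t ^+ 2 / N * (k N u * u) + -2 * t ^+ 2 * N * (k N u / u)) =
  k N u * (1 - 2 * t ^+ 2 * (u / N - 2 + N / u)).
  by field; rewrite !gt_eqF.
by apply: ler_wpM2l => //; exact: expR_ge0.
Qed.

(** [Gam_large_neq0] covers s + n once n is large against Im(s)^2. The recurrence descends to s,
    since a zero at s + n would force one at s + n + 1. *)
Lemma Gam_neq0 (s : R[i]) : 0 < complex.Re s -> Gam s != 0.
Proof.
move=> s0; pose n := (Num.truncn (1 + 2 * complex.Im s ^+ 2)).+1.
have : Gam (s + n%:R) != 0.
  have -> : s + n%:R = (complex.Re s + n%:R) +i* complex.Im s.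
    by rewrite natC; case: (s) => x y; apply: RI_eq; rewrite ?ReD ?ImD /= ?addr0.
  apply: Gam_large_neq0; apply: lt_le_trans (truncnS_gt _) _.
  by rewrite lerDr ltW.
elim: n => [|n IH]; first by rewrite addr0.
rewrite -addn1 natrD addrA Gam_rec ?mulf_eq0 ?negb_or => [/andP[_ /IH]//|].
by rewrite ReD natC /= ltr_pwDl.
Qed.

(** The shift inside [rgamma] jumps with Re s, while analyticity needs one shift on a whole disc;
    [rgammaE] allows any admissible one. *)
Definition rgam_at (m : nat) (s : R[i]) : R[i] :=
  (\prod_(i < m) (s + i%:R)) / Gam (s + m%:R).

Lemma rgam_atS m s : 0 < complex.Re s + m%:R -> rgam_at m.+1 s = rgam_at m s.
Proof.
move=> sm; have sm' : 0 < complex.Re (s + m%:R) by rewrite ReD natC.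
have n0 : s + m%:R != 0 by apply/eqP => e; move: sm'; rewrite e ltxx.
rewrite /rgam_at big_ord_recr /= -addn1 natrD addrA Gam_rec //.
by rewrite invfM mulrA mulfK.
Qed.

Lemma rgammaE m s : 0 < complex.Re s + m%:R -> rgamma s = rgam_at m s.
Proof.
move=> sm; pose n := (Num.truncn `|complex.Re s|).+1.
have sn : 0 < complex.Re s + n%:R.
  have := truncnS_gt `|complex.Re s|; have := ler_norm (- complex.Re s).
  by rewrite normrN -/n; lra.
rewrite -[LHS]/(rgam_at n s).
have stab p j : 0 < complex.Re s + p%:R -> rgam_at (p + j)%N s = rgam_at p s.
  move=> sp; elim: j => [|j IH]; first by rewrite addn0.
  rewrite addnS rgam_atS // natrD addrA.
  by rewrite ltr_pwDl.
case: (leqP m n) => [mn|/ltnW nm]; first by rewrite -(subnKC mn) stab.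
by rewrite -(subnKC nm) stab.
Qed.

Lemma rgamma_pan s : pan (@rgamma R) s.
Proof.
(* One more than the shift in [rgamma], so that Re z + m stays positive on the unit disc around
   s. *)
pose m := (Num.truncn `|complex.Re s|).+2.
have sm : 1 < complex.Re s + m%:R.
  have := truncnS_gt `|complex.Re s|; have := ler_norm (- complex.Re s).
  by rewrite normrN /m -[_.+2]addn1 natrD; move: (_%:R) => v; lra.
have sm0 : 0 < complex.Re (s + m%:R) by rewrite ReD natC /=; lra.
apply: (@pan_ext R (rgam_at m) (@rgamma R) s 1 ltr01).
  move=> z zs; apply/esym/rgammaE.
  have := le_lt_trans (cmod_Re _) zs; rewrite ReD ReN ltr_norml => /andP[h _].
  lra.
apply: panM.
  apply: pan_prod => i; exact: panD (pan_id s) (pan_cst s _).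
apply: (@panV _ (fun z => Gam (z + m%:R))); last exact: Gam_neq0.
have h : pan (@Gam R) (1 * s + m%:R) by rewrite mul1r; exact: Gam_pan.
by apply: (pan_ext ltr01 _ (pan_comp h)) => z _; rewrite mul1r.
Qed.

(** With shift m + 1 at s and m at s + 1 the denominators agree and the products differ by the
    factor s. *)
Lemma rgamma_rec (s : R[i]) : rgamma s = s * rgamma (s + 1).
Proof.
pose m := (Num.truncn `|complex.Re s|).+1.
have sm : 0 < complex.Re s + m%:R.
  have := truncnS_gt `|complex.Re s|; have := ler_norm (- complex.Re s).
  by rewrite normrN -/m; lra.
rewrite (rgammaE (m := m.+1)); last by rewrite -addn1 natrD addrA; lra.
rewrite (rgammaE (s := s + 1) (m := m)); last by rewrite ReD Re1; lra.
rewrite /rgam_at big_ord_recl addr0 -mulrA; congr (_ * (_ / Gam _)).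
  by apply: eq_bigr => i _; rewrite -addrA -natr1 [1 + _]addrC.
by rewrite -addrA -natr1 [1 + _]addrC.
Qed.

Lemma rgamma0 : rgamma (0 : R[i]) = 0.
Proof. by rewrite rgamma_rec mul0r. Qed.

Lemma rgamma_Gam (s : R[i]) : 0 < complex.Re s -> rgamma s * Gam s = 1.
Proof.
move=> s0; rewrite (rgammaE (m := 0)) ?addr0 // /rgam_at big_ord0 addr0 mul1r.
by rewrite mulVf // Gam_neq0.
Qed.

End Rgamma.

(** * Mellin transform of a pair of dual theta series *)

Section ThetaPair.
Variable R : realType.
Notation mu := (@lebesgue_measure R).
Notation I01 := (`]0, 1[%classic : set R).
Notation I1y := (`]1, +oo[%classic : set R).

Definition heat (a u : R) : R[i] := (expR (- (a * u)))%:C.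

Lemma cmod_heat a u : cmod (heat a u) = expR (- (a * u)).
Proof. by rewrite cmod_real ger0_norm ?expR_ge0. Qed.

Lemma gkerE s a u : gker s a u = cpow u (s - 1) * heat a u.
Proof. by []. Qed.

(** Outside a finite set exp(-a v) <= exp(-v), so a >= 1; the finitely many other positive values
    have a minimum. This gap is what gives decay as u grows. *)
Lemma heat_gap (T : choiceType) (a : T -> R) (v M : R) : 0 < v -> absum (heat^~ v \o a) M ->
  exists2 d : R, 0 < d & forall n, 0 < a n -> d <= a n.
Proof.
move=> v0 aM; have [J hJ] := absum_tail0 aM (expR_gt0 (- v)).
pose d := \big[Num.min/1]_(i <- J | 0 < a i) a i.
have d0 : 0 < d.
  by rewrite /d; elim/big_rec: _ => [|i x ai x0]; [exact: ltr01|rewrite lt_min ai].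
have d1 : d <= 1.
  by rewrite /d; elim/big_rec: _ => [//|i x ai x0]; rewrite ge_min x0 orbT.
exists d => // n an; case: (boolP (n \in J)) => nJ.
  have hs (r : seq T) : n \in r -> \big[Num.min/1]_(i <- r | 0 < a i) a i <= a n.
    elim: r => [//|x r IH]; rewrite in_cons big_cons.
    case/orP => [/eqP <-|/IH h]; first by rewrite an ge_min lexx.
    by case: ifP => // _; rewrite ge_min h orbT.
  exact: hs.
apply: le_trans d1 _.
have := hJ [fset n]%fset; rewrite big_seq_fset1 (negPf nJ) /= cmod_heat ler_expR lerN2.
by rewrite ler_pMl.
Qed.

(** Terms with a n = 0 do not decay and are collected apart, hence masked here. *)
Definition posterm (T : Type) (a : T -> R) (f : T -> R[i]) (g : R -> R[i]) (n : T) : R[i] :=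
  if 0 < a n then f n * g (a n) else 0.

(** The sum is the Mellin integral over (1, oo) of the masked theta series, which decays like exp(-d
    u/2); that suffices for every s. *)
Lemma ray_mellin (T : countType) (a : T -> R) (f : T -> R[i]) (M : R) :
  (forall n, 0 <= a n) -> (forall n, cmod (f n) <= 1) ->
  absum (heat^~ 2^-1 \o a) M ->
  exists I : R[i] -> R[i], (forall s, pan I s) /\
    forall s, usum (posterm a f (fun x => cintegral I1y (gker s x))) (I s).
Proof.
move=> a0 f1 aM; have h20 : 0 < 2^-1 :> R by rewrite invr_gt0.
have [d d0 hd] := heat_gap h20 aM; have d20 : 0 < d / 2 by rewrite divr_gt0.
have M0 := absum_ge0 aM.
pose t u n : R[i] := posterm a f (heat^~ u) n.
pose V u := M * expR (- (d / 2 * u)).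
have tV u : I1y u -> absum (t u) (V u).
  rewrite /= in_itv /= andbT => u1 K.
  apply: (@le_trans _ _ (\sum_(i <- K) cmod (heat (a i) 2^-1) * expR (- (d / 2 * u)))).
    apply: ler_sum => n _; rewrite /t /posterm; case: ifP => an; last first.
      by rewrite cmod0 mulr_ge0 ?cmod_ge0 ?expR_ge0.
    rewrite cmodM; apply: (@le_trans _ _ (1 * cmod (heat (a n) u))).
      by apply: ler_wpM2r; [exact: cmod_ge0|exact: f1].
    rewrite mul1r !cmod_heat -expRD ler_expR.
    have dn := hd n an.
    (* Half of a n u gives the summable value at u = 1/2, the other half the decay through the
       gap. *)
    have h1 : a n / 2 <= a n / 2 * u by rewrite ler_pMr ?divr_gt0 // ltW.
    have h2 : d / 2 * u <= a n / 2 * u.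
      by apply: ler_wpM2r; [apply: ltW; exact: lt_trans u1|lra].
    have h3 : a n * u = a n / 2 * u + a n / 2 * u by field.
    by rewrite h3; lra.
  by rewrite -mulr_suml; apply: ler_wpM2r; [exact: expR_ge0|exact: aM].
have /choice[W hW] : forall u, exists W, I1y u -> usum (t u) W.
  move=> u; case: (pselect (I1y u)) => [h|h]; last by exists 0.
  by have [W hW _] := absum_usum (tV u h); exists W.
have mI : measurable I1y by exact: measurable_itv.
have mt s n : cmeas I1y (fun u => cpow u s * t u n).
  apply: (cpcont_meas (@sub0y_1y R) mI); apply: cpcontM; first exact: cpcont_cpow.
  rewrite /t /posterm; case: (0 < a n); last exact: cpcont_cst.
  apply: cpcontM; first exact: cpcont_cst.
  apply: cpcont_real; apply: pcont_comp; first exact: continuous_expR.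
  by apply: pcontN; apply: pcontM; [exact: pcont_cst|exact: pcont_id].
have rV c : rint I1y (fun u => V u * expR (c * ln u)).
  have := rintZ M mI (rint_expln1y (c + 1) d20); apply: eq_rint => // u _.
  by rewrite /V addrK expRD; ring.
have mW : cmeas I1y W.
  apply: (@cmeas_usum R T I1y (fun n u => cpow u 0 * t u n) W) => // u Du.
  by apply: eq_usum (hW u Du) => n; rewrite cpow0 mul1r.
exists (fun s => cintegral I1y (fun u => cpow u (s - 1) * W u)); split=> s.
  apply: (@mellin_pan_pos R I1y W V s 1) => //; first exact: sub0y_1y.
  by move=> u Du; exact: usum_cmod_le (hW u Du) (tV u Du).
have hh u : I1y u -> absum (fun n => cpow u (s - 1) * t u n) (V u * expR ((complex.Re s - 1) * ln u)).
  by move=> Du; have := absumZ (cpow u (s - 1)) (tV u Du);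
    rewrite cmod_cpow mulrC ReD ReN Re1.
have hg u : I1y u -> usum (fun n => cpow u (s - 1) * t u n) (cpow u (s - 1) * W u).
  by move=> Du; exact: usumZ (hW u Du).
have := usum_cintegral mI (mt (s - 1)) hh (rV _) hg.
apply: eq_usum => n; rewrite /t /posterm; case: ifP => an.
  rewrite -cintegralZ //; last exact: rint_gker1y.
  by apply: eq_cintegral => u _; rewrite mulrCA.
rewrite -[RHS](cintegral0 I1y); apply: eq_cintegral => u _; exact: mulr0.
Qed.

Section Pair.
Variables (T1 T2 : countType) (a : T1 -> R) (b : T2 -> R).
Variables (f : T1 -> R[i]) (g : T2 -> R[i]) (c : R[i]) (h : R).
Hypotheses (a0 : forall n, 0 <= a n) (b0 : forall k, 0 <= b k) (h0 : 0 < h).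
Hypotheses (f1 : forall n, cmod (f n) <= 1) (g1 : forall k, cmod (g k) <= 1).
Hypothesis theta : forall u : R, 0 < u -> exists S,
  usum (fun k => heat (b k) u^-1 * g k) S /\
  usum (fun n => heat (a n) u * f n) (c * cpow u (- h%:C) * S).
Variables (A B : R).
Hypothesis Aa : forall u : R, 0 < u -> u < 1 ->
  absum (heat^~ u \o a) (A * expR (- h * ln u)).
Hypothesis Bb : forall u : R, 0 < u -> u < 1 ->
  absum (heat^~ u \o b) (B * expR (- h * ln u)).

Let half0 : 0 < 2^-1 :> R. Proof. by rewrite invr_gt0. Qed.
Let half1 : 2^-1 < 1 :> R. Proof. by rewrite invf_lt1 ?ltr1n. Qed.

Lemma absum_zero (T : choiceType) (x : T -> R) (y : T -> R[i]) (M : R) :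
  (forall n, 0 <= x n) -> (forall n, cmod (y n) <= 1) -> absum (heat^~ 2^-1 \o x) M ->
  absum (fun n => if x n == 0 then y n else 0) M.
Proof.
move=> x0 y1; apply: absum_le => n /=; case: eqP => [->|_]; last by rewrite cmod0 cmod_ge0.
by rewrite cmod_heat mul0r oppr0 expR0.
Qed.

(** Reassembles a full sum from the masked part and the zero terms, which receive a prescribed value
    [z], as the Crandall function does at 0. *)
Lemma usum_split (T : choiceType) (x : T -> R) (y : T -> R[i]) (Y S : R[i])
    (G : R -> R[i]) (z : R[i]) : (forall n, 0 <= x n) ->
  usum (fun n => if x n == 0 then y n else 0) Y ->
  usum (posterm x y G) S ->
  usum (fun n => y n * (if x n == 0 then z else G (x n))) (S + z * Y).
Proof.
move=> x0 hY hS; apply: eq_usum (usumD hS (usumZ z hY)) => n.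
rewrite /posterm lt_def x0 andbT; case: eqP => _ /=; first by rewrite add0r mulrC.
by rewrite mulr0 addr0.
Qed.

Lemma theta_zeta (F0 G0 : R[i]) (I1 I2 : R[i] -> R[i]) :
  usum (fun n => if a n == 0 then f n else 0) F0 ->
  usum (fun k => if b k == 0 then g k else 0) G0 ->
  (forall s, usum (posterm a f (fun x => cintegral I1y (gker s x))) (I1 s)) ->
  (forall s, usum (posterm b g (fun x => cintegral I1y (gker s x))) (I2 s)) ->
  forall s, h < complex.Re s ->
  usum (posterm a f (fun x => (cpow x s)^-1))
    (rgamma s * (I1 s + c * (I2 (h%:C - s) + G0 / (s - h%:C))) - F0 * rgamma (s + 1)).
Proof.
move=> hF hG h1 h2 s sh; have s0 : 0 < complex.Re s by exact: lt_trans h0 sh.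
have mI : measurable I01 by exact: measurable_itv.
have /choice[S hS] : forall u : R, exists S, 0 < u ->
  usum (fun k => heat (b k) u^-1 * g k) S /\
  usum (fun n => heat (a n) u * f n) (c * cpow u (- h%:C) * S).
  move=> u; case: (ltrP 0 u) => hu; last by exists 0.
  by have [S hS] := theta hu; exists S.
pose W u := cpow u (s - 1) * (c * cpow u (- h%:C) * S u).
pose J := cintegral I01 W.
have I01P u : I01 u -> 0 < u /\ u < 1 by rewrite /= in_itv /= => /andP[].
have cheat x : cpcont (heat x).
  apply: cpcont_real; apply: pcont_comp; first exact: continuous_expR.
  by apply: pcontN; apply: pcontM; [exact: pcont_cst|exact: pcont_id].
have rh : rint I01 (fun u => expR ((complex.Re s - h - 1) * ln u)).
  by apply: rint_pow01; rewrite subr_gt0.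
(* [Aa] gives the majorant u^(Re s - h - 1), integrable on the unit interval because h < Re s. *)
have J1 : usum (fun n => f n * cintegral I01 (gker s (a n))) J.
  have mt n : cmeas I01 (fun u => f n * gker s (a n) u).
    apply: (cpcont_meas (@sub0y_01 R) mI); apply: cpcontM; first exact: cpcont_cst.
    exact: cpcont_gker.
  have hh u : I01 u -> absum (fun n => f n * gker s (a n) u)
      (A * expR ((complex.Re s - h - 1) * ln u)).
    move=> /I01P[u0 u1]; have := absumZ (cpow u (s - 1)) (Aa u0 u1).
    rewrite cmod_cpow mulrCA -expRD -mulrDl ReD ReN Re1.
    rewrite [complex.Re s - 1 + _]addrAC; apply: absum_le => n.
    by rewrite cmodM -[leRHS]mul1r; apply: ler_pM; rewrite ?cmod_ge0.
  have hg u : I01 u -> usum (fun n => f n * gker s (a n) u) (W u).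
    move=> /I01P[u0 u1]; have [_ hn] := hS u u0.
    apply: eq_usum (usumZ (cpow u (s - 1)) hn) => n.
    by rewrite gkerE; ring.
  have := usum_cintegral mI mt hh (rintZ A mI rh) hg; apply: eq_usum => n.
  by rewrite cintegralZ //; exact: rint_gker01.
have J2 : usum (fun k => c * (g k * cintegral I01 (fun u => cpow u (s - h%:C - 1) * heat (b k) u^-1))) J.
  pose q k u : R[i] := c * (g k * (cpow u (s - h%:C - 1) * heat (b k) u^-1)).
  have mt0 k : cmeas I01 (fun u => cpow u (s - h%:C - 1) * heat (b k) u^-1).
    apply: (cpcont_meas (@sub0y_01 R) mI); apply: cpcontM; first exact: cpcont_cpow.
    apply: cpcont_real; apply: pcont_comp; first exact: continuous_expR.
    by apply: pcontN; apply: pcontM; [exact: pcont_cst|exact: pcont_inv].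
  have mt k : cmeas I01 (q k) by do 2 (apply: cmeasM; first exact: cmeas_cst).
  have cp u : cmod (cpow u (s - h%:C - 1)) = expR ((complex.Re s - h - 1) * ln u).
    by rewrite cmod_cpow !ReD !ReN Re1.
  (* The dual terms are taken at 1/u > 1, so their values at 1/2 dominate them uniformly in u. *)
  pose B1 := B * expR (- h * ln 2^-1).
  have hh u : I01 u -> absum (q^~ u) (cmod c * B1 * expR ((complex.Re s - h - 1) * ln u)).
    move=> /I01P[u0 u1]; have := absumZ (c * cpow u (s - h%:C - 1)) (Bb half0 half1).
    rewrite cmodM cp -/B1 mulrAC; apply: absum_le => k /=.
    have -> : q k u = g k * (c * cpow u (s - h%:C - 1) * heat (b k) u^-1).
      by rewrite /q; ring.
    rewrite cmodM -[leRHS]mul1r; apply: ler_pM; rewrite ?cmod_ge0 //.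
    rewrite (cmodM (c * _)) (cmodM (c * _)); apply: ler_wpM2l; first exact: cmod_ge0.
    rewrite !cmod_heat ler_expR lerN2; apply: ler_wpM2l => //.
    by rewrite (le_trans (ltW half1)) // ltW // invf_gt1.
  have hg u : I01 u -> usum (q^~ u) (W u).
    move=> /I01P[u0 u1]; have [hk _] := hS u u0.
    have := usumZ (c * (cpow u (s - 1) * cpow u (- h%:C))) hk.
    rewrite -cpowD addrAC.
    have -> : c * cpow u (s - h%:C - 1) * S u = W u.
      by rewrite /W addrAC cpowD; ring.
    by apply: eq_usum => k; rewrite /q; ring.
  have := usum_cintegral mI mt hh (rintZ _ mI rh) hg; apply: eq_usum => k.
  have ik : cint I01 (fun u => cpow u (s - h%:C - 1) * heat (b k) u^-1).
    apply: (cint_dom mI (mt0 k) _ rh) => u /I01P[u0 u1].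
    rewrite cmodM cp cmod_heat -[leRHS]mulr1; apply: ler_wpM2l; first exact: expR_ge0.
    by rewrite -[leRHS]expR0 ler_expR oppr_le0 mulr_ge0 // invr_ge0 ltW.
  by rewrite !cintegralZ //; exact: cintZ.
have sh0 : 0 < complex.Re (s - h%:C) by rewrite ReD ReN subr_gt0.
(* Terms with b k = 0 integrate to 1/(s - h); the others become integrals over (1, oo) by
   inversion. *)
have J2' : J = c * (I2 (h%:C - s) + G0 / (s - h%:C)).
  apply: usum_unique J2 _; apply: usumZ; rewrite [G0 / _]mulrC.
  apply: eq_usum (usum_split (s - h%:C)^-1 b0 hG (h2 (h%:C - s))) => k.
  congr (_ * _); case: eqP => [->|_].
    rewrite -cpow_int01 //; apply: eq_cintegral => u _.
    by rewrite /heat mul0r oppr0 expR0 mulr1.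
  by rewrite (gker_inv (s - h%:C)) opprB.
have J1' := usumD J1 (h1 s).
have s1 : s != 0 by apply/eqP => s0'; move: s0; rewrite s0' ltxx.
(* For a n = 0 the integral 1/s cancels against the subtracted term; for a n > 0 the two pieces make
   up Gamma(s) / a^s. *)
have J3 : usum (posterm a f (fun x => Gam s / cpow x s)) (J + I1 s - s^-1 * F0).
  apply: eq_usum (usumB J1' (usumZ s^-1 hF)) => n.
  rewrite /posterm lt_def a0 andbT; case: eqP => [->|/eqP an] /=.
    rewrite addr0 mulrC [X in X * _](_ : _ = s^-1) ?subrr //.
    rewrite -cpow_int01 //; apply: eq_cintegral => u _.
    by rewrite gkerE /heat mul0r oppr0 expR0 mulr1.
  by rewrite mulr0 subr0 -mulrDr Gam_split // lt_def an a0.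
have J4 := usumZ (rgamma s) J3.
have -> : rgamma s * (I1 s + c * (I2 (h%:C - s) + G0 / (s - h%:C))) - F0 * rgamma (s + 1) =
   rgamma s * (J + I1 s - s^-1 * F0).
  rewrite -J2' (rgamma_rec s); field; exact: s1.
apply: eq_usum J4 => n; rewrite /posterm; case: ifP => _; last by rewrite mulr0.
by rewrite mulrCA [rgamma s * (_ / _)]mulrA rgamma_Gam // mul1r.
Qed.

End Pair.
End ThetaPair.

(** * The Epstein zeta function of a lattice *)

Section Lattice.
Variable R : realType.
Notation I1y := (`]1, +oo[%classic : set R).

Section Theta.
Variable d : nat.

Definition lpt (A : 'M[R]_d) (n : 'cV[int]_d) : 'cV[R]_d := A *m intv R n.

Definition wnorm (v : 'cV[R]_d) : R := pi * dot v v.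

Definition alpha (A : 'M[R]_d) (x : 'cV[R]_d) (l : R) (n : 'cV[int]_d) : R :=
  wnorm (l^-1 *: (lpt A n - x)).

Lemma wnorm_ge0 v : 0 <= wnorm v.
Proof. by rewrite mulr_ge0 ?pi_ge0 // dot_ge0. Qed.

Lemma wnorm_eq0 v : (wnorm v == 0) = (v == 0).
Proof. by rewrite mulf_eq0 dot_eq0 gt_eqF // pi_gt0. Qed.

Lemma alpha_ge0 A x l n : 0 <= alpha A x l n.
Proof. exact: wnorm_ge0. Qed.

Lemma alpha_eq0 A x l n : 0 < l -> (alpha A x l n == 0) = (lpt A n == x).
Proof.
by move=> l0; rewrite /alpha wnorm_eq0 scaler_eq0 invr_eq0 gt_eqF //= subr_eq0.
Qed.

Lemma lpt_inj (A : 'M[R]_d) : A \in unitmx -> injective (lpt A).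
Proof.
move=> Au m n /(can_inj (mulKmx Au)) /matrixP mn; apply/matrixP => i j.
by have := mn i j; rewrite !mxE => /intr_inj.
Qed.

Lemma wnormZ (r : R) v : wnorm (r *: v) = r ^+ 2 * wnorm v.
Proof. by rewrite /wnorm dotZl dotZr; ring. Qed.

Definition gram (A : 'M[R]_d) (t : R) : 'M[R]_d := t *: (A^T *m A).

Lemma gram_posdef A t : A \in unitmx -> 0 < t -> posdef (gram A t).
Proof.
move=> Au t0; split=> [|v v0]; first by rewrite /gram linearZ /= trmx_mul trmxK.
rewrite /gram -scalemxAl dotZr mulr_gt0 // -mulmxA dot_mulmx trmxK lt_def dot_ge0 andbT.
by rewrite dot_eq0 -(mulmx0 _ A) (inj_eq (can_inj (mulKmx Au))).
Qed.

Lemma gauss_gram A t v : gauss (gram A t) v = expR (- (t * wnorm (A *m v))).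
Proof.
rewrite /gauss /gram -scalemxAl dotZr -mulmxA dot_mulmx trmxK /wnorm.
by congr (expR (- _)); ring.
Qed.

Lemma gauss_gram_inv A t v : A \in unitmx -> 0 < t ->
  gauss (invmx (gram A t)) v = expR (- (t^-1 * wnorm ((invmx A)^T *m v))).
Proof.
move=> Au t0; have -> : invmx (gram A t) = gram (invmx A)^T t^-1.
  have gu : gram A t \in unitmx by apply: posdef_unit; exact: gram_posdef.
  apply: (can_inj (mulKmx gu)); rewrite mulmxV // /gram.
  rewrite -scalemxAl -scalemxAr scalerA mulfV ?gt_eqF // scale1r trmxK.
  by rewrite -mulmxA (mulmxA A) mulmxV // mul1mx -trmx_mul mulVmx // trmx1.
exact: gauss_gram.
Qed.

Lemma expR_ln_nat (t : R) n : 0 < t -> expR (n%:R * ln t) = t ^+ n.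
Proof. by move=> t0; rewrite expRM_natl lnK. Qed.

(** With t = u/l^2, det(t A^T A) = t^d det(A)^2 has square root t^(d/2) |det A|. *)
Lemma theta_factor (A : 'M[R]_d) (l u : R) : A \in unitmx -> 0 < l -> 0 < u ->
  (Num.sqrt (\det (gram A (u / l ^+ 2))))%:C *
  ((l ^+ d / `|\det A|)%:C * cpow u (- (d%:R / 2)%:C)) = 1.
Proof.
move=> Au l0 u0; have t0 : 0 < u / l ^+ 2 by rewrite divr_gt0 ?exprn_gt0.
have D0 : 0 < `|\det A| by rewrite normr_gt0 -unitfE -unitmxE.
have -> : Num.sqrt (\det (gram A (u / l ^+ 2))) = expR (d%:R / 2 * ln (u / l ^+ 2)) * `|\det A|.
  rewrite /gram detZ det_mulmx det_tr -(expR_ln_nat d t0).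
  have -> : expR (d%:R * ln (u / l ^+ 2)) * (\det A * \det A) =
     (expR (d%:R / 2 * ln (u / l ^+ 2)) * `|\det A|) ^+ 2.
    rewrite exprMn real_normK ?num_real // !expr2 -expRD; congr (expR _ * _).
    by field.
  by rewrite sqrtr_sqr ger0_norm // mulr_ge0 ?expR_ge0.
rewrite -rmorphN cpow_real -!rmorphM; apply: congr1.
rewrite -(expR_ln_nat d l0) lnM ?posrE ?invr_gt0 ?exprn_gt0 // lnV ?posrE ?exprn_gt0 //.
rewrite lnXn // -[RHS]expR0.
transitivity (expR (d%:R / 2 * (ln u - ln l *+ 2)) * expR (d%:R * ln l) * expR (- (d%:R / 2) * ln u)).
  by field; rewrite gt_eqF.
by rewrite -!expRD; congr expR; rewrite -mulr_natl; field.
Qed.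

(** [theta_transform] for the Gram matrix (u/l^2) A^T A, shift -A^(-1) x and character A^T y. The
    dual points are k + y with k reciprocal, which [alpha] expresses by centre -y and scale 1/l. *)
Lemma lat_theta (A : 'M[R]_d) (x y : 'cV[R]_d) (l u : R) : A \in unitmx ->
  0 < l -> 0 < u -> exists S : R[i],
  usum (fun k => heat (alpha (invmx A)^T (- y) l^-1 k) u^-1 *
                 phase (dot x (lpt (invmx A)^T k + y))) S /\
  usum (fun n => heat (alpha A x l n) u * phase (dot y (lpt A n)))
    ((l ^+ d / `|\det A|)%:C * cpow u (- (d%:R / 2)%:C) * S).
Proof.
move=> Au l0 u0; set t := u / l ^+ 2.
have t0 : 0 < t by rewrite divr_gt0 ?exprn_gt0.
have [_ [S [h1 h2]]] := theta_transform (- (invmx A *m x)) (A^T *m y) (gram_posdef Au t0).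
exists ((Num.sqrt (\det (gram A t)))%:C * S); split.
  apply: eq_usum h2 => k; rewrite /theta_dual gauss_gram_inv //.
  have e : (invmx A)^T *m (intv R k + A^T *m y) = lpt (invmx A)^T k + y.
    by rewrite mulmxDr mulmxA -trmx_mul mulmxV // trmx1 mul1mx.
  rewrite e /heat; congr ((expR (- _))%:C * phase _).
    rewrite /alpha opprK invrK wnormZ /t invf_div; field.
    by rewrite gt_eqF.
  by rewrite dotNr opprK dot_mulmx e dotC.
have -> : (l ^+ d / `|\det A|)%:C * cpow u (- (d%:R / 2)%:C) *
    ((Num.sqrt (\det (gram A t)))%:C * S) = S.
  by rewrite mulrA [X in X * _]mulrC theta_factor // mul1r.
apply: eq_usum h1 => n; rewrite /theta_term gauss_gram.
have e : A *m (intv R n + - (invmx A *m x)) = lpt A n - x.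
  by rewrite mulmxDr mulmxN mulmxA mulmxV // mul1mx.
rewrite e /heat; congr ((expR (- _))%:C * phase _).
  by rewrite /alpha wnormZ /t exprVn; ring.
by rewrite -dot_mulmx.
Qed.

(* The sum is the theta series with y = 0, so its dual side bounds it. *)
Lemma lat_absum (A : 'M[R]_d) (x : 'cV[R]_d) (l : R) : A \in unitmx -> 0 < l ->
  exists C : R, forall u : R, 0 < u -> u < 1 ->
    absum (heat (R := R) ^~ u \o alpha A x l) (C * expR (- (d%:R / 2) * ln u)).
Proof.
move=> Au l0.
have l2i : 0 < l ^+ 2 by rewrite exprn_gt0.
have Bu : (invmx A)^T \in unitmx by rewrite unitmx_tr unitmx_inv.
have [M hM] := gauss_absum (gram_posdef Bu l2i).
pose c := l ^+ d / `|\det A|.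
have c0 : 0 <= c by rewrite divr_ge0 // exprn_ge0 // ltW.
exists (c * M) => u u0 u1.
have [S [h1 h2]] := lat_theta x 0 Au l0 u0.
(* For u < 1 the dual terms are bounded by their values at u = 1, a single convergent Gaussian
   series. *)
have SM : cmod S <= M.
  apply: (usum_cmod_le h1); apply: absum_le (hM 0) => k.
  rewrite cmodM cmod_phase mulr1 cmod_heat cmod_real ger0_norm ?expR_ge0 // addr0.
  rewrite gauss_gram ler_expR lerN2 /alpha invrK oppr0 subr0 wnormZ.
  apply: ler_peMr; first by rewrite mulr_ge0 ?wnorm_ge0 ?(ltW l2i).
  by rewrite ltW // invf_gt1.
have h3 : usum (fun n => (expR (- (alpha A x l n * u)))%:C) (c%:C * cpow u (- (d%:R / 2)%:C) * S).
  by apply: eq_usum h2 => n; rewrite dot0l phase0 mulr1.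
move=> K; under eq_bigr => n _ do rewrite /= cmod_heat.
apply: le_trans (usum_ge_fset K (fun n => expR_ge0 _) h3) _.
apply: le_trans (ler_norm _) _; apply: le_trans (cmod_Re _) _.
rewrite (cmodM (_ * cpow _ _)) (cmodM c%:C) cmod_real ger0_norm // cmod_cpow ReN /=.
rewrite mulrAC; apply: ler_wpM2r; first exact: expR_ge0.
exact: ler_wpM2l.
Qed.

End Theta.

Lemma has_sumE (T : choiceType) (D : set T) (F : T -> R[i]) S :
  has_sum D F S <-> usum (fun z => if z \in D then F z else 0) S.
Proof. exact: ccvgP. Qed.

Lemma has_sum_inj (T U : choiceType) (D : set U) (p : T -> U) (F : U -> R[i]) S :
  injective p -> (forall z, D z -> exists n, p n = z) ->
  has_sum D F S <-> usum (fun n => if p n \in D then F (p n) else 0) S.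
Proof.
move=> pi pD; rewrite has_sumE.
apply: iff_sym; apply: (usum_inj (h := p) (f := fun z => if z \in D then F z else 0)) => //.
move=> u hu; case: ifP => // /set_mem /pD[n pn].
by case: (hu n).
Qed.

Lemma has_sum_lattice d (A : 'M[R]_d) (F : 'cV[R]_d -> R[i]) S : A \in unitmx ->
  has_sum (lattice A) F S <-> usum (F \o lpt A) S.
Proof.
move=> Au; rewrite (has_sum_inj F S (lpt_inj Au)); last by move=> z [n _ <-]; exists n.
by split; apply: eq_usum => n /=; rewrite mem_set //; exists n.
Qed.

(** The power produced by [upper_gammaE] cancels the denominator, leaving a bare kernel integral. *)
Lemma crandallE d nu (v : 'cV[R]_d) : crandall nu v =
  if wnorm v == 0 then - (nu / 2)^-1 else cintegral I1y (gker (nu / 2) (wnorm v)).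
Proof.
rewrite /crandall wnorm_eq0; case: eqP => [_|/eqP v0]; first by rewrite invf_div.
have w0 : 0 < wnorm v by rewrite lt_def wnorm_ge0 wnorm_eq0 v0.
by rewrite upper_gammaE // mulrAC divff ?cpow_neq0 // mul1r.
Qed.

Lemma cpow_pan (u : R) s : pan (cpow u) s.
Proof.
exists (fun k => cpow u s * ((ln u)%:C ^+ k / k`!%:R)), 1, (cmod (cpow u s) * expR (cmod (ln u)%:C)).
split => //; last by move=> z _; exact: cpow_usum.
have := absumZ (cpow u s) (absum_exp_term (ln u)%:C); apply: absum_le => k.
by rewrite expr1n mulr1.
Qed.

(** Here |z - x|^2 = (l^2/pi) alpha; the constant yields the prefactor of the formula. *)
Lemma epstein_termE d (A : 'M[R]_d) (x y : 'cV[R]_d) (l : R) nu n : 0 < l -> lpt A n != x ->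
  epstein_term x y nu (lpt A n) = cpow (pi / l ^+ 2) (nu / 2) *
   (phase (dot y (lpt A n)) / cpow (alpha A x l n) (nu / 2)).
Proof.
move=> l0 nx; rewrite /epstein_term /enorm.
have -> : dot (x - lpt A n) (x - lpt A n) = dot (lpt A n - x) (lpt A n - x).
  by rewrite -opprB dotNl dotNr opprK.
set q := dot (lpt A n - x) _.
have q0 : 0 < q by rewrite lt_def dot_ge0 andbT dot_eq0 subr_eq0.
have -> : alpha A x l n = pi / l ^+ 2 * q.
  by rewrite /alpha wnormZ /wnorm -/q exprVn; ring.
have p0 : 0 < pi / l ^+ 2 :> R by rewrite divr_gt0 ?pi_gt0 ?exprn_gt0.
rewrite (cpowMl _ p0 q0); have sq : 0 < Num.sqrt q by rewrite sqrtr_gt0.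
have -> : cpow q (nu / 2) = cpow (Num.sqrt q) nu.
  rewrite -{1}(sqr_sqrtr (ltW q0)) expr2 (cpowMl _ sq sq) -cpowD; congr cpow.
  by field.
by field; rewrite !cpow_neq0.
Qed.

End Lattice.

(** * The explicit continuation and the Crandall sums *)

Section Epstein.
Variable R : realType.
Notation I1y := (`]1, +oo[%classic : set R).

Section Continuation.
Variables (d : nat) (A : 'M[R]_d) (x y : 'cV[R]_d) (l : R).
Hypotheses (d0 : (0 < d)%N) (Au : A \in unitmx) (l0 : 0 < l).

Let h : R := d%:R / 2.
Let c : R[i] := (l ^+ d / `|\det A|)%:C.
Let B := (invmx A)^T.
Let a := alpha A x l.
Let b := alpha B (- y) l^-1.
Let f n : R[i] := phase (dot y (lpt A n)).
Let g k : R[i] := phase (dot x (lpt B k + y)).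

Let Bu : B \in unitmx. Proof. by rewrite unitmx_tr unitmx_inv. Qed.
Let li0 : 0 < l^-1. Proof. by rewrite invr_gt0. Qed.
Let h0 : 0 < h. Proof. by rewrite divr_gt0 // ltr0n. Qed.
Let f1 n : cmod (f n) <= 1. Proof. by rewrite cmod_phase. Qed.
Let g1 n : cmod (g n) <= 1. Proof. by rewrite cmod_phase. Qed.
Let half0 : 0 < 2^-1 :> R. Proof. by rewrite invr_gt0. Qed.
Let half1 : 2^-1 < 1 :> R. Proof. by rewrite invf_lt1 ?ltr1n. Qed.

(** Right side of the formula with the zero terms displayed. Writing the one at z = x with
    1/Gamma(nu/2 + 1) keeps it regular at nu = 0; the quotient by nu/2 - d/2 is the only possible
    pole. *)
Definition continuation (I1 I2 : R[i] -> R[i]) (F0 G0 : R[i]) (nu : R[i]) : R[i] :=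
  cpow (pi / l ^+ 2) (nu / 2) *
  (rgamma (nu / 2) * (I1 (nu / 2) + c * (I2 (h%:C - nu / 2) + G0 / (nu / 2 - h%:C)))
   - F0 * rgamma (nu / 2 + 1)).

(** [F0] and [G0] are sums with at most one nonzero term, at z = x and k = -y. *)
Definition mellin_data (I1 I2 : R[i] -> R[i]) (F0 G0 : R[i]) :=
  [/\ (forall s, pan I1 s) /\ (forall s, pan I2 s),
      usum (fun n => if a n == 0 then f n else 0) F0,
      usum (fun k => if b k == 0 then g k else 0) G0,
      forall s, usum (posterm a f (fun t => cintegral I1y (gker s t))) (I1 s) &
      forall s, usum (posterm b g (fun t => cintegral I1y (gker s t))) (I2 s)].

Lemma mellin_data_exists : exists I1 I2 F0 G0, mellin_data I1 I2 F0 G0.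
Proof.
have [CA hA] := lat_absum x Au l0.
have [CB hB] := lat_absum (- y) Bu li0.
have [I1 [p1 u1]] := ray_mellin (@alpha_ge0 R d A x l) f1 (hA _ half0 half1).
have [I2 [p2 u2]] := ray_mellin (@alpha_ge0 R d B (- y) l^-1) g1 (hB _ half0 half1).
have [F0 hF _] := absum_usum (absum_zero (@alpha_ge0 R d A x l) f1 (hA _ half0 half1)).
have [G0 hG _] := absum_usum (absum_zero (@alpha_ge0 R d B (- y) l^-1) g1 (hB _ half0 half1)).
by exists I1, I2, F0, G0.
Qed.

Lemma notin_lattice : ~ lattice A x -> forall n, a n != 0.
Proof.
by move=> nx n; apply/negP; rewrite alpha_eq0 // => /eqP e; apply: nx; exists n.
Qed.

Lemma notin_reciprocal : ~ reciprocal_lattice A y -> forall n, b n != 0.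
Proof.
move=> ny n; apply/negP; rewrite alpha_eq0 // => /eqP e; apply: ny; exists (- n) => //.
have -> : map_mx intr (- n) = - intv R n by apply/matrixP => i j; rewrite !mxE mulrNz.
by rewrite mulmxN -[_ *m _]/(lpt B n) e opprK.
Qed.

Lemma usum_none (T : choiceType) (p : T -> R) (q : T -> R[i]) S :
  (forall n, p n != 0) -> usum (fun n => if p n == 0 then q n else 0) S -> S = 0.
Proof.
move=> p0 hS; apply: usum_unique hS _.
have z0 : usum (fun _ : T => 0 : R[i]) 0 by exact: usum_ext0.
by apply: eq_usum z0 => n; rewrite (negPf (p0 n)).
Qed.

Section Data.
Variables (I1 I2 : R[i] -> R[i]) (F0 G0 : R[i]).
Hypothesis md : mellin_data I1 I2 F0 G0.
Let F := continuation I1 I2 F0 G0.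

Let pan_half p : (forall s, pan p s) -> forall s, pan (fun nu : R[i] => p (nu / 2)) s.
Proof.
move=> pp s; have hp : pan p (2^-1 * s + 0) by exact: pp.
by apply: (pan_ext ltr01 _ (pan_comp hp)) => z _; rewrite addr0 mulrC.
Qed.

Let pan_halfC p : (forall s, pan p s) -> forall s, pan (fun nu : R[i] => p (h%:C - nu / 2)) s.
Proof.
move=> pp s; have hp : pan p (- 2^-1 * s + h%:C) by exact: pp.
by apply: (pan_ext ltr01 _ (pan_comp hp)) => z _; rewrite mulNr addrC mulrC.
Qed.

Let pan_half1 p : (forall s, pan p s) -> forall s, pan (fun nu : R[i] => p (nu / 2 + 1)) s.
Proof.
move=> pp s; have hp : pan p (2^-1 * s + 1) by exact: pp.
by apply: (pan_ext ltr01 _ (pan_comp hp)) => z _; rewrite mulrC.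
Qed.

Let p1 s : pan I1 s. Proof. by case: md => -[]. Qed.
Let p2 s : pan I2 s. Proof. by case: md => -[]. Qed.

Lemma continuation_sum nu : d%:R < complex.Re nu ->
  has_sum (lattice A `\ x) (epstein_term x y nu) (F nu).
Proof.
move=> dnu; case: md => _ hF hG h1 h2.
have [CA hA] := lat_absum x Au l0.
have [CB hB] := lat_absum (- y) Bu li0.
have sh : h < complex.Re (nu / 2).
  have -> : nu / 2 = (2^-1)%:C * nu by rewrite mulrC natC fmorphV.
  by rewrite ReZ /h mulrC ltr_pM2l.
have := theta_zeta (@alpha_ge0 R d A x l) (@alpha_ge0 R d B (- y) l^-1) h0 f1 g1
  (fun u u0 => lat_theta x y Au l0 u0) hA hB hF hG h1 h2 sh.
move=> /(usumZ (cpow (pi / l ^+ 2) (nu / 2))) hs.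
apply/(has_sum_inj _ _ (lpt_inj Au)); first by move=> z [[n _ <-] _]; exists n.
apply: eq_usum hs => n; rewrite /posterm lt_def alpha_ge0 andbT alpha_eq0 //.
case: eqP => [e|/eqP ne] /=.
  by rewrite mulr0 ifF //; apply/negP => /set_mem[_]; apply.
rewrite mem_set; last by split; [exists n|exact/eqP].
by rewrite (epstein_termE y nu l0 ne).
Qed.

Lemma pan_cpow_half u s : pan (fun nu : R[i] => cpow (u : R) (nu / 2)) s.
Proof. by apply: pan_half => z; exact: cpow_pan. Qed.

(** For y outside the reciprocal lattice no b k vanishes and G0 = 0; otherwise nu <> d keeps the
    denominator nonzero. *)
Lemma continuation_pan nu : (reciprocal_lattice A y -> nu <> d%:R) -> pan F nu.
Proof.
move=> hy; case: md => _ _ hG _ _.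
have pG : pan (fun nu => G0 / (nu / 2 - h%:C)) nu.
  case: (pselect (reciprocal_lattice A y)) => [/hy nd|ny]; last first.
    have -> : G0 = 0 by exact: usum_none (notin_reciprocal ny) hG.
    by apply: (pan_ext ltr01 _ (pan_cst nu 0)) => z _; rewrite mul0r.
  apply: panZ; apply: panV.
    by apply: (pan_ext ltr01 _ (pan_affine 2^-1 (- h%:C) nu)) => z _; rewrite mulrC.
  rewrite subr_eq0; apply/eqP => e; apply: nd.
  have -> : nu = nu / 2 * 2 by field.
  by rewrite e /h rmorphM fmorphV !rmorph_nat; field.
apply: panM; first exact: pan_cpow_half.
apply: panB.
  apply: panM; first by apply: pan_half => s; exact: rgamma_pan.
  apply: panD; first exact: pan_half.
  by apply: panZ; apply: panD; first exact: pan_halfC.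
by apply: panZ; apply: pan_half1 => s; exact: rgamma_pan.
Qed.

Lemma pan_mero (p : R[i] -> R[i]) s : pan p s -> mero p s.
Proof.
move=> ps; exists 0, p, 1; split => // z _ _.
by rewrite expr0 mulr1.
Qed.

(** Over abstract numbers, so that [field] does not meet the analytic expressions. *)
Lemma clear_pole (p q i j m v r w : R[i]) : w != 0 ->
  p * (q * (i + c * (j + m / (w / 2))) - v * r) * w =
  p * (q * (i * w + c * (j * w + 2 * m)) - v * (r * w)).
Proof. by move: c => k w0; field. Qed.

Lemma continuation_mero nu : mero F nu.
Proof.
have [->|/eqP nd] := eqVneq nu d%:R; last by apply/pan_mero/continuation_pan.
pose K z := cpow (pi / l ^+ 2) (z / 2) *
  (rgamma (z / 2) * (I1 (z / 2) * (z - d%:R) + c * (I2 (h%:C - z / 2) * (z - d%:R) + 2 * G0))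
   - F0 * (rgamma (z / 2 + 1) * (z - d%:R))).
have pz s : pan (fun z : R[i] => z - d%:R) s by exact: panB (pan_id s) (pan_cst s _).
exists 1, K, 1; split; first exact: ltr01.
  apply: panM; first exact: pan_cpow_half.
  apply: panB.
    apply: panM; first by apply: pan_half => s; exact: rgamma_pan.
    apply: panD; first by apply: panM; [exact: pan_half|].
    apply: panZ; apply: panD; last exact: pan_cst.
    by apply: panM; first exact: pan_halfC.
  by apply: panZ; apply: panM => //; apply: pan_half1 => s; exact: rgamma_pan.
move=> z zd _; rewrite expr1 /F /K /continuation.
have -> : z / 2 - h%:C = (z - d%:R) / 2.
  by rewrite /h rmorphM fmorphV !rmorph_nat; ring.
have z0 : z - d%:R != 0 by rewrite subr_eq0.
exact: clear_pole.
Qed.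

(** The value -2/(d - nu) at the zero vector is 1/(nu/2 - d/2), the factor of [G0]. *)
Lemma crandall_sum_dual nu :
  has_sum (reciprocal_lattice A)
    (fun k => crandall (d%:R - nu) (l *: (k + y)) * phase (dot x (k + y)))
    (I2 (h%:C - nu / 2) + G0 / (nu / 2 - h%:C)).
Proof.
case: md => _ _ hG _ h2; apply/(has_sum_lattice _ _ Bu).
rewrite [G0 / _]mulrC.
apply: eq_usum (usum_split (nu / 2 - h%:C)^-1 (@alpha_ge0 R d B (- y) l^-1) hG (h2 (h%:C - nu / 2))) => k /=.
rewrite crandallE mulrC.
have -> : wnorm (l *: (lpt B k + y)) = b k by rewrite /b /alpha invrK opprK.
have e : (d%:R - nu) / 2 = h%:C - nu / 2.
  by rewrite /h rmorphM fmorphV !rmorph_nat mulrBl.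
by rewrite e -invrN opprB.
Qed.

(* At nu = 0 with x in the lattice both sides hold junk values 2/0 = 0. *)
Lemma crandall_sum nu :
  has_sum (lattice A) (fun z => crandall nu (l^-1 *: (z - x)) * phase (dot y z))
    (I1 (nu / 2) - F0 / (nu / 2)).
Proof.
case: md => _ hF _ h1 _.
apply/(has_sum_lattice _ _ Au); rewrite [F0 / _]mulrC -mulNr.
apply: eq_usum (usum_split (- (nu / 2)^-1) (@alpha_ge0 R d A x l) hF (h1 (nu / 2))) => n /=.
by rewrite crandallE mulrC.
Qed.

(** As 1/Gamma(0) = 0, only the term z = x survives, with its limit value. *)
Lemma crandall_over_gamma_sum : lattice A x ->
  has_sum (lattice A) (fun z => crandall_over_gamma 0 (l^-1 *: (z - x)) * phase (dot y z))
    (- F0 * rgamma (0 / 2 + 1)).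
Proof.
move=> xA; case: md => _ hF _ _ _.
apply/(has_sum_lattice _ _ Au); rewrite mulNr -mulrN mulrC.
apply: eq_usum (usumZ (- rgamma (0 / 2 + 1)) hF) => n /=.
rewrite /crandall_over_gamma eqxx /= -wnorm_eq0 -[wnorm _]/(a n).
case: eqP => _ //=; first by rewrite mulr0 mul0r rgamma0 !mul0r.
Qed.

End Data.
End Continuation.
End Epstein.

(** [meromorphic_at] ignores the value at the point itself, so a continuation is pinned down at [nu]
    only through analyticity there. The two cases for [S1] separate the removable singularity at nu
    = 0 with x in the lattice. *)
Theorem theorem2p12 (R : realType) (d : nat) (A : 'M[R]_d) (x y : 'cV[R]_d)
    (nu : R[i]) :
  (0 < d)%N -> A \in unitmx ->
  (reciprocal_lattice A y -> nu <> d%:R) ->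
  (exists Z : R[i] -> R[i], epstein_zeta A x y Z /\ analytic_at Z nu) /\
  (forall Z : R[i] -> R[i], epstein_zeta A x y Z -> analytic_at Z nu ->
   forall lambda : R, 0 < lambda ->
   exists S2 : R[i],
     [/\ has_sum (reciprocal_lattice A)
           (fun k => crandall (d%:R - nu) (lambda *: (k + y))
                     * phase (dot x (k + y))) S2,
         ~ (nu = 0 /\ lattice A x) ->
         exists S1 : R[i],
           has_sum (lattice A)
             (fun z => crandall nu (lambda^-1 *: (z - x))
                       * phase (dot y z)) S1 /\
           Z nu = cpow (pi / lambda ^+ 2) (nu / 2) * rgamma (nu / 2)
                  * (S1 + (lambda ^+ d / `|\det A|)%:C * S2)
       & nu = 0 /\ lattice A x ->
         exists S1 : R[i],
           has_sum (lattice A)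
             (fun z => crandall_over_gamma nu (lambda^-1 *: (z - x))
                       * phase (dot y z)) S1 /\
           Z nu = cpow (pi / lambda ^+ 2) (nu / 2)
                  * (S1 + rgamma (nu / 2)
                          * ((lambda ^+ d / `|\det A|)%:C * S2))]).
Proof.
move=> d0 Au hy; split.
  (* Any positive scale provides a continuation; 1 is taken. *)
  have l0 := @ltr01 R.
  have [I1 [I2 [F0 [G0 md]]]] := mellin_data_exists x y Au l0.
  exists (continuation A 1 I1 I2 F0 G0); split; last first.
    by apply/analytic_atP; exact: (continuation_pan l0 md hy).
  split=> s; first by apply/meromorphic_atP; exact: (continuation_mero l0 md s).
  by move=> ds; exact: (continuation_sum d0 Au l0 md ds).
move=> Z [Zm Zs] /analytic_atP Zp l l0.
have [I1 [I2 [F0 [G0 md]]]] := mellin_data_exists x y Au l0.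
(* Each scale has its own [continuation]; all equal the lattice sum for Re s > d, so uniqueness
   identifies them with Z at nu. *)
have ZF : Z nu = continuation A l I1 I2 F0 G0 nu.
  apply: (@mero_unique R Z _ d%:R) => //.
  - by move=> s; apply/meromorphic_atP.
  - by move=> s; exact: (continuation_mero l0 md s).
  - move=> s ds; apply: usum_unique; first exact/has_sumE/(Zs s ds).
    exact/has_sumE/(continuation_sum d0 Au l0 md ds).
  - exact: (continuation_pan l0 md hy).
exists (I2 ((d%:R / 2)%:C - nu / 2) + G0 / (nu / 2 - (d%:R / 2)%:C)); split.
- exact: (crandall_sum_dual Au md).
- move=> nx; exists (I1 (nu / 2) - F0 / (nu / 2)); split.
    exact: (crandall_sum Au md).
  rewrite ZF /continuation -mulrA; apply: congr1.
  (* At nu = 0 the case hypothesis puts x outside the lattice and F0 = 0. Otherwise [rgamma_rec]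
     turns F0/Gamma(nu/2 + 1) into F0/(nu/2) under the common factor 1/Gamma(nu/2). *)
  have [nu0|nu0] := eqVneq nu 0.
    have -> : F0 = 0.
      case: md => _ hF _ _ _; apply: usum_none hF; apply: notin_lattice => // xA.
      by apply: nx.
    by rewrite !mul0r !subr0.
  have e (s i v r w : R[i]) : s != 0 -> s * r * (i + v) - w * r = s * r * (i - w / s + v).
    by move=> s0; field.
  by rewrite (rgamma_rec (nu / 2)); apply: e; rewrite mulf_neq0 // invr_neq0 // pnatr_eq0.
move=> [nu0 xA]; exists (- F0 * rgamma (0 / 2 + 1)); split.
  by rewrite nu0; exact: (crandall_over_gamma_sum Au md xA).
(* The factor 1/Gamma(0) = 0 removes everything but the term of z = x. *)
rewrite ZF /continuation nu0 mulNr [rgamma (0 / 2)](_ : _ = 0); last by rewrite mul0r rgamma0.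
by rewrite !mul0r addr0 sub0r.
Qed.
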